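(* Let $\tau=\frac{-b+\sqrt{-d}}{2a}$ where $a,b,c$ are mutually coprime integers with $a>0$, $a\tau^2+b\tau+c=0$ and $-d=b^2-4ac$, and suppose $\tau$ lies in $C_{1/(1-u),\infty}$. Then $$\frac{F^2}{6}\left[(u+3)-\frac{u^2+18u-27}{u-9}s_2(\tau)\right]-u(u-1)\frac{d}{du}F^2=\frac{a}{\pi\sqrt{d}}(u-1),$$ where $u=u(\tau)$, $F={}_2F_1\!\left(\frac13,\frac23;1;\frac{1}{1-u}\right)$, and $\frac{d}{du}F^2$ denotes the derivative of $x\mapsto{}_2F_1(\frac13,\frac23;1;\frac{1}{1-x})^2$ evaluated at $x=u(\tau)$.
   Context: $\mathfrak H$ is the upper half-plane, $q=e^{2\pi i\tau}$, $E_2=1-24\sum_{n\ge1}n\frac{q^n}{1-q^n}$, $E_4=1+240\sum_{n\ge1}n^3\frac{q^n}{1-q^n}$, $E_6=1-504\sum_{n\ge1}n^5\frac{q^n}{1-q^n}$, $E_2^*(\tau)=E_2(\tau)-\frac{3}{\pi\mathrm{Im}(\tau)}$, $s_2(\tau)=\frac{E_4(\tau)}{E_6(\tau)}E_2^*(\tau)$. ${}_2F_1$ is the Gauss hypergeometric function. $u(\tau)=-\frac{1}{27}\left(\frac{\eta(\tau)}{\eta(3\tau)}\right)^{12}$ ($\eta$ the Dedekind eta function) is the Hauptmodul of $\Gamma_0(3)$. With $\mathcal{F}_{3B}=\{z\in\mathfrak{H}:|z+1/3|>1/3,|z-1/3|>1/3,|\mathrm{Re}(z)|<1/2\}$, $C_{1/(1-u),\infty}$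 is the connected component of $\{\tau\in\mathcal F_{3B}:|1-u(\tau)|>1\}$ whose closure contains the cusp $\infty$ (i.e. containing points of arbitrarily large imaginary part). *)

(* Defs.v *)
From HB Require Import structures.
From mathcomp Require Import all_boot all_order all_algebra.
From mathcomp Require Import complex.
From mathcomp Require Import all_classical all_reals all_analysis.

Set Implicit Arguments.
Unset Strict Implicit.
Unset Printing Implicit Defensive.

Import Order.TTheory GRing.Theory Num.Theory.
Import numFieldNormedType.Exports.

Local Open Scope classical_set_scope.
Local Open Scope complex_scope.
Local Open Scope ring_scope.

Section ModularFunctions.
Context {R : realType}.
Implicit Types (tau z : R[i]) (a b c : R[i]).

(* R[i]^o is R[i] with its topology and its structure of normed module over
   itself; the norm takes its values in R[i], where x <= y means that y - x is
   real and nonnegative. *)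
Definition climn (v : nat -> R[i]) : R[i] := limn (v : nat -> R[i]^o).

(* The derivative is the complex one, the increment ranging over R[i]. *)
Definition cderive (f : R[i] -> R[i]) : R[i] -> R[i] :=
  derive1 (f : R[i] -> R[i]^o).

Definition cexp z : R[i] :=
  (expR (complex.Re z))%:C * (cos (complex.Im z) +i* sin (complex.Im z)).

Definition nome tau : R[i] := cexp (2 * pi%:C * 'i * tau).

Definition lambert (k : nat) tau : R[i] :=
  climn (fun N => \sum_(1 <= n < N)
    (n%:R ^+ k * (nome tau ^+ n / (1 - nome tau ^+ n)))).

Definition E2 tau : R[i] := 1 - 24 * lambert 1 tau.
Definition E4 tau : R[i] := 1 + 240 * lambert 3 tau.
Definition E6 tau : R[i] := 1 - 504 * lambert 5 tau.

Definition E2star tau : R[i] := E2 tau - 3 / (pi * complex.Im tau)%:C.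

(* Where E6 vanishes the quotient is 0, the inverse of 0 being 0. *)
Definition s2 tau : R[i] := E4 tau / E6 tau * E2star tau.

Definition eta tau : R[i] :=
  cexp (2 * pi%:C * 'i * tau / 24) *
  climn (fun N => \prod_(1 <= n < N) (1 - nome tau ^+ n)).

Definition hauptmodul tau : R[i] :=
  - (1 / 27) * (eta tau / eta (3 * tau)) ^+ 12.

Definition pochhammer a (n : nat) : R[i] := \prod_(k < n) (a + k%:R).

(* Sum of the Gauss series; only meaningful on its disc of convergence. *)
Definition hyp2F1 a b c z : R[i] :=
  climn (series (fun n : nat =>
    pochhammer a n * pochhammer b n / (pochhammer c n * n`!%:R) * z ^+ n)).

Definition F3B : set R[i] := [set z | [/\ 0 < complex.Im z,
  1 / 3 < `|z + 1 / 3|, 1 / 3 < `|z - 1 / 3| & `|complex.Re z| < 1 / 2]].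

Definition region3B : set R[i] :=
  [set z | F3B z /\ 1 < `|1 - hauptmodul z|].

(* The points whose connected component in region3B reaches the cusp at
   infinity, i.e. contains points of arbitrarily large imaginary part. *)
Definition C3B_infty : set R[i] := [set z | region3B z /\
  forall M : R, exists2 w,
      connected_component (region3B : set R[i]^o) z w &
      M < complex.Im w].

End ModularFunctions.

(* Main.v *)
(** Let a, b^3, c^3 be the cubic theta functions of the Borweins, as series in
    the nome q, and x = c^3 / a^3, so that a^3 = b^3 + c^3 and x = 1 / (1 - u).
    Ramanujan's identity for the square of cot/4 + sum u_n sin(n t), specialised
    at multiples of 2 pi / 3, gives Ramanujan's differential system in level 3:
    q dx/dq = a^2 x (1 - x), 12 q da/dq = a (E2 + a^2 (4x - 1)),
    E4 = a^4 (1 + 8x), E6 = a^6 (1 - 20x - 8x^2).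
    Hence a and F = 2F1(1/3, 2/3; 1; x) solve the same second order equation in
    x wherever |x| < 1.  Their Wronskian has zero derivative, so it is locally
    constant, as is then F / a; on the component reaching the cusp both keep
    their limits 0 and 1, so F = a there.  Then x (1 - x) d(F^2)/dx is given by
    q da/dq, and the left-hand side of the theorem collapses to
    (u - 1) (E2 - E2star) / 6 = (u - 1) / (2 pi Im tau).

    With 1/0 = 0, two degenerate points need care.  If u = 9 then x = -1/8,
    but the logarithmic solution of the equation expresses q through x, and shows
    that x is real only on the imaginary axis, where it is positive.  If
    E6(tau) = 0 then s2(tau) = 0 and one needs E2star(tau) = 0: again x is real,
    so tau = iy, and E2 = 3 / (pi y) follows, without the modular
    transformation, from E4^(1/4) being a Legendre function of
    v = E6 / E4^(3/2), whose equation is invariant under v -> -v. *)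

From HB Require Import structures.
From mathcomp Require Import all_boot all_order all_algebra.
From mathcomp Require Import complex.
From mathcomp Require Import all_classical all_reals all_analysis.
From mathcomp Require Import ring lra zify.
Require Import Defs.

Set Implicit Arguments.
Unset Strict Implicit.
Unset Printing Implicit Defensive.

Import Order.TTheory GRing.Theory Num.Theory.
Import numFieldNormedType.Exports.
Local Open Scope classical_set_scope.
Local Open Scope complex_scope.
Local Open Scope ring_scope.

(** * Formal power series *)

Record fps (K : Type) := Fps { coefs : nat -> K }.

Section FpsRing.
Variable K : comNzRingType.
Implicit Types a b c : fps K.

Lemma fpsP a b : coefs a =1 coefs b <-> a = b.
Proof. by split=> [|->//]; case: a b => [a] [b] /= /funext ->. Qed.

HB.instance Definition _ := gen_eqMixin (fps K).
HB.instance Definition _ := gen_choiceMixin (fps K).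

Definition fps_add a b := Fps (fun n => coefs a n + coefs b n).
Definition fps_opp a := Fps (fun n => - coefs a n).
Definition fps_const (k : K) := Fps (fun n => if n is 0 then k else 0).
Definition fps_mul a b :=
  Fps (fun n => \sum_(i < n.+1) coefs a i * coefs b (n - i)%N).

Lemma fps_addA : associative fps_add.
Proof. by move=> a b c; apply/fpsP => n /=; rewrite addrA. Qed.
Lemma fps_addC : commutative fps_add.
Proof. by move=> a b; apply/fpsP => n /=; rewrite addrC. Qed.
Lemma fps_add0 : left_id (fps_const 0) fps_add.
Proof. by move=> a; apply/fpsP => -[|n] /=; rewrite add0r. Qed.
Lemma fps_addN : left_inverse (fps_const 0) fps_opp fps_add.
Proof. by move=> a; apply/fpsP => -[|n] /=; rewrite addNr. Qed.

HB.instance Definition _ :=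
  GRing.isZmodule.Build (fps K) fps_addA fps_addC fps_add0 fps_addN.

Let trunc N a := \poly_(i < N) coefs a i.

Let coef_trunc N a n : (n < N)%N -> (trunc N a)`_n = coefs a n.
Proof. by move=> nN; rewrite coef_poly nN. Qed.

Let trunc_mul N a b n : (n < N)%N ->
  coefs (fps_mul a b) n = (trunc N a * trunc N b)`_n.
Proof.
move=> nN; rewrite coefM; apply: eq_bigr => i _.
by rewrite !coef_trunc //; move: (ltn_ord i); lia.
Qed.

Let trunc_mull N a b (p : {poly K}) n : (n < N)%N ->
  (trunc N (fps_mul a b) * p)`_n = (trunc N a * trunc N b * p)`_n.
Proof.
move=> nN; rewrite !coefM; apply: eq_bigr => i _; congr (_ * _).
rewrite coef_trunc ?(@trunc_mul N) //; move: (ltn_ord i); lia.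
Qed.

Lemma fps_mulC : commutative fps_mul.
Proof. by move=> a b; apply/fpsP => n; rewrite !(@trunc_mul n.+1)// mulrC. Qed.
Lemma fps_mulA : associative fps_mul.
Proof.
move=> a b c; apply/fpsP => n; rewrite !(@trunc_mul n.+1)//.
by rewrite mulrC !trunc_mull// mulrC mulrA.
Qed.
Lemma fps_mul1 : left_id (fps_const 1) fps_mul.
Proof.
move=> a; apply/fpsP => n /=; rewrite big_ord_recl /= mul1r subn0.
by rewrite big1 ?addr0 // => i _; rewrite mul0r.
Qed.
Lemma fps_mulDl : left_distributive fps_mul fps_add.
Proof.
move=> a b c; apply/fpsP => n /=; rewrite -big_split /=.
by apply: eq_bigr => i _; rewrite mulrDl.
Qed.
Lemma fps_1neq0 : fps_const 1 != fps_const 0.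
Proof.
by apply/eqP => /fpsP /(_ 0%N) /= /eqP; rewrite oner_eq0.
Qed.

HB.instance Definition _ := GRing.Zmodule_isComNzRing.Build (fps K)
  fps_mulA fps_mulC fps_mul1 fps_mulDl fps_1neq0.

Lemma coefsD a b n : coefs (a + b) n = coefs a n + coefs b n. Proof. by []. Qed.
Lemma coefsN a n : coefs (- a) n = - coefs a n. Proof. by []. Qed.
Lemma coefsB a b n : coefs (a - b) n = coefs a n - coefs b n. Proof. by []. Qed.
Lemma coefs0 n : coefs (0 : fps K) n = 0. Proof. by case: n. Qed.
Lemma coefs1 n : coefs (1 : fps K) n = (n == 0)%:R. Proof. by case: n. Qed.
Lemma coefsM a b n :
  coefs (a * b) n = \sum_(i < n.+1) coefs a i * coefs b (n - i)%N.
Proof. by []. Qed.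
Lemma coefs_sum I (r : seq I) (P : pred I) (F : I -> fps K) n :
  coefs (\sum_(i <- r | P i) F i) n = \sum_(i <- r | P i) coefs (F i) n.
Proof. by elim/big_rec2: _ => [|i x y _ <-]; rewrite ?coefs0. Qed.
Lemma coefsMn a k n : coefs (a *+ k) n = coefs a n *+ k.
Proof. by elim: k => [|k IH]; rewrite ?coefs0 // !mulrS coefsD IH. Qed.

Lemma coefs_constM k a n : coefs (fps_const k * a) n = k * coefs a n.
Proof.
rewrite coefsM big_ord_recl /= subn0 big1 ?addr0 // => i _.
by rewrite mul0r.
Qed.

Lemma fps_constD k l : fps_const (k + l) = fps_const k + fps_const l.
Proof. by apply/fpsP => -[|n]; rewrite coefsD /= ?addr0. Qed.
Lemma fps_constM k l : fps_const (k * l) = fps_const k * fps_const l.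
Proof. by apply/fpsP => -[|n]; rewrite coefs_constM //= mulr0. Qed.
Lemma fps_const_nat n : fps_const n%:R = n%:R.
Proof.
by apply/fpsP => -[|m]; rewrite coefsMn coefs1 //= mul0rn.
Qed.

Lemma coefs0M a b : coefs (a * b) 0 = coefs a 0 * coefs b 0.
Proof. by rewrite coefsM big_ord1. Qed.
Lemma coefs0X a n : coefs (a ^+ n) 0 = coefs a 0 ^+ n.
Proof. by elim: n => [|n IH]; rewrite ?coefs1 // !exprS coefs0M IH. Qed.

Definition fps_D a := Fps (fun n => n%:R * coefs a n).

Lemma coefs_fps_D a n : coefs (fps_D a) n = n%:R * coefs a n. Proof. by []. Qed.

Lemma fps_DD a b : fps_D (a + b) = fps_D a + fps_D b.
Proof. by apply/fpsP => n; rewrite !(coefsD, coefs_fps_D) mulrDr. Qed.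
Lemma fps_DN a : fps_D (- a) = - fps_D a.
Proof. by apply/fpsP => n; rewrite !(coefsN, coefs_fps_D) mulrN. Qed.
Lemma fps_DB a b : fps_D (a - b) = fps_D a - fps_D b.
Proof. by rewrite fps_DD fps_DN. Qed.
Lemma fps_D_const k : fps_D (fps_const k) = 0.
Proof. by apply/fpsP => -[|n]; rewrite coefs_fps_D /= ?mul0r ?mulr0. Qed.
Lemma fps_DM a b : fps_D (a * b) = fps_D a * b + a * fps_D b.
Proof.
apply/fpsP => n; rewrite coefsD coefs_fps_D !coefsM mulr_sumr -big_split /=.
apply: eq_bigr => i _.
have -> : n%:R = (i : nat)%:R + (n - i)%N%:R :> K.
  by rewrite -natrD subnKC // -ltnS.
rewrite /=; ring.
Qed.
Lemma fps_D1 : fps_D 1 = 0.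
Proof. exact: fps_D_const. Qed.
Lemma fps_D_nat k : fps_D k%:R = 0.
Proof. by rewrite -fps_const_nat fps_D_const. Qed.
Lemma fps_DX a n : fps_D (a ^+ n) = n%:R * a ^+ n.-1 * fps_D a.
Proof.
elim: n => [|[|n] IH]; first by rewrite fps_D1 !mul0r.
  by rewrite expr1 expr0 mul1r mul1r.
rewrite exprS fps_DM IH /= [in RHS]mulrS [in RHS]exprS [in LHS]exprS; ring.
Qed.

End FpsRing.

Section FpsSub.
Variables (K : comNzRingType).
Implicit Types a b c : fps K.

Definition fps_sub3 a :=
  Fps (fun n => if (3 %| n)%N then coefs a (n %/ 3)%N else 0).

Lemma coefs_sub3 a n : coefs (fps_sub3 a) n =
  if (3 %| n)%N then coefs a (n %/ 3)%N else 0.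
Proof. by []. Qed.

Lemma coefs_sub3_mul a n : coefs (fps_sub3 a) (3 * n) = coefs a n.
Proof. by rewrite coefs_sub3 dvdn_mulr // mulKn. Qed.

Lemma fps_sub3D a b : fps_sub3 (a + b) = fps_sub3 a + fps_sub3 b.
Proof.
by apply/fpsP => n; rewrite coefsD !coefs_sub3; case: ifP; rewrite ?addr0.
Qed.
Lemma fps_sub3N a : fps_sub3 (- a) = - fps_sub3 a.
Proof.
by apply/fpsP => n; rewrite coefsN !coefs_sub3; case: ifP; rewrite ?oppr0.
Qed.
Lemma fps_sub3B a b : fps_sub3 (a - b) = fps_sub3 a - fps_sub3 b.
Proof. by rewrite fps_sub3D fps_sub3N. Qed.
Lemma fps_sub3_const k : fps_sub3 (fps_const k) = fps_const k.
Proof.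
apply/fpsP => -[|n] //; rewrite coefs_sub3; case: ifP => // /dvdnP[m].
by rewrite mulnC => -> ; rewrite mulKn //; case: m.
Qed.
Lemma fps_sub3_1 : fps_sub3 (1 : fps K) = 1.
Proof. exact: fps_sub3_const. Qed.
Lemma fps_sub3_nat k : fps_sub3 (k%:R : fps K) = k%:R.
Proof. by rewrite -fps_const_nat fps_sub3_const. Qed.

Lemma big_dvdn3 (F : nat -> K) n : (forall i, ~~ (3 %| i)%N -> F i = 0) ->
  \sum_(0 <= i < (3 * n).+1) F i = \sum_(0 <= i < n.+1) F (3 * i)%N.
Proof.
move=> F0; elim: n => [|n IH]; first by rewrite !big_nat1.
rewrite (_ : (3 * n.+1).+1 = (3 * n).+4)%N; last by lia.
do 3 rewrite big_nat_recr //=.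
rewrite IH [in RHS]big_nat_recr //= [F (3 * n).+1]F0 ?[F (3 * n).+2]F0.
- by rewrite !addr0 (_ : 3 * n.+1 = (3 * n).+3)%N //; lia.
- by apply/negP; lia.
- by apply/negP; lia.
Qed.

Lemma fps_sub3M a b : fps_sub3 (a * b) = fps_sub3 a * fps_sub3 b.
Proof.
apply/fpsP => n; rewrite coefs_sub3; case: ifP => [/dvdnP[m]|/negbT n3].
  rewrite mulnC => ->; rewrite mulKn // !coefsM.
  have cE (c d : fps K) k : \sum_(i < k.+1) coefs c i * coefs d (k - i)%N =
      \sum_(0 <= i < k.+1) coefs c i * coefs d (k - i)%N by rewrite big_mkord.
  rewrite !cE big_dvdn3 => [|i i3]; last first.
    by rewrite coefs_sub3 (negbTE i3) mul0r.
  by apply: eq_big_nat => i _; rewrite -mulnBr !coefs_sub3_mul.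
rewrite coefsM big1 // => i _; rewrite !coefs_sub3.
case: ifP => [i3|]; last by rewrite mul0r.
case: ifP => [j3|]; last by rewrite mulr0.
case/negP: n3; have := ltn_ord i; lia.
Qed.

Lemma fps_D_sub3 a : fps_D (fps_sub3 a) = 3%:R * fps_sub3 (fps_D a).
Proof.
apply/fpsP => n; rewrite -fps_const_nat coefs_constM coefs_fps_D !coefs_sub3.
case: ifP => [/dvdnP[m ->]|]; last by rewrite !mulr0.
by rewrite mulnK // coefs_fps_D natrM mulrA (mulrC m%:R).
Qed.
End FpsSub.

Section FpsDomain.
Variable K : idomainType.
Implicit Types a b c : fps K.

Lemma fps_mulI0 a b : coefs a 0 != 0 -> a * b = 0 -> b = 0.
Proof.
move=> a0 /fpsP ab; apply/fpsP; elim/ltn_ind => n IH; rewrite coefs0.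
have := ab n; rewrite coefs0 coefsM big_ord_recl /= subn0 big1 => [|i _].
  by rewrite addr0 => /eqP; rewrite mulf_eq0 (negbTE a0) => /eqP.
by rewrite IH ?coefs0 ?mulr0 //= /bump; have := ltn_ord i; lia.
Qed.

Lemma fps_mulI a b c : coefs a 0 != 0 -> a * b = a * c -> b = c.
Proof.
move=> a0 abc; apply/eqP; rewrite -subr_eq0; apply/eqP/(fps_mulI0 a0).
by rewrite mulrBr abc subrr.
Qed.

End FpsDomain.

(** * Ramanujan's trigonometric identity for Lambert series *)

Section BigNat.
Variable V : zmodType.

Lemma big_nat_sym_diag (G : nat -> nat -> V) M : (forall m n, G m n = G n m) ->
  \sum_(1 <= m < M.+1) \sum_(1 <= n < M.+1) G m n =
  \sum_(1 <= n < M.+1) G n n +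
  (\sum_(1 <= k < M.+1) \sum_(1 <= n < (M - k).+1) G n (n + k)%N) *+ 2.
Proof.
move=> Gsym; elim: M => [|M IH]; first by rewrite !big_geq // mul0rn addr0.
have L1 : \sum_(1 <= m < M.+2) \sum_(1 <= n < M.+2) G m n =
    \sum_(1 <= m < M.+1) \sum_(1 <= n < M.+1) G m n +
    (\sum_(1 <= m < M.+1) G m M.+1) *+ 2 + G M.+1 M.+1.
  rewrite big_nat_recr //= [X in _ + X = _]big_nat_recr //=.
  rewrite [X in _ + (X + _) = _](eq_bigr (fun m => G m M.+1)) => [|m _]; last first.
    exact: Gsym.
  rewrite [X in X + _ = _](eq_bigr (fun m => \sum_(1 <= n < M.+1) G m n +
    G m M.+1)) => [|m _]; last by rewrite big_nat_recr.
  by rewrite big_split /= mulr2n !addrA.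
have L2 : \sum_(1 <= k < M.+2) \sum_(1 <= n < (M.+1 - k).+1) G n (n + k)%N =
    \sum_(1 <= k < M.+1) \sum_(1 <= n < (M - k).+1) G n (n + k)%N +
    \sum_(1 <= n < M.+1) G n M.+1.
  rewrite big_nat_recr //= subnn [X in _ + X = _]big_geq // addr0.
  rewrite [X in _ = _ + X]big_nat_rev /= -big_split /=.
  apply: eq_big_nat => k /andP[k0 kM].
  rewrite subSn // big_nat_recr //= (_ : ((M - k).+1 + k = M.+1)%N); last by lia.
  by congr (_ + G _ _); lia.
rewrite L1 L2 IH [X in _ = X + _]big_nat_recr //= mulrnDl.
by rewrite addrAC [X in X + _ = _]addrAC -[LHS]addrA.
Qed.

Lemma big_nat_antidiag (G : nat -> nat -> V) M :
  (forall m n, (M < m + n)%N -> G m n = 0) ->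
  \sum_(1 <= m < M.+1) \sum_(1 <= n < M.+1) G m n =
  \sum_(1 <= k < M.+1) \sum_(1 <= m < k) G m (k - m)%N.
Proof.
move=> G0; have -> : \sum_(1 <= k < M.+1) \sum_(1 <= m < k) G m (k - m)%N =
    \sum_(1 <= k < M.+1) \sum_(1 <= m < M.+1 | (m < k)%N) G m (k - m)%N.
  by apply: eq_big_nat => k /andP[k0 kM]; rewrite (big_nat_widen _ _ _ _ _ (ltnW kM)).
rewrite [RHS](exchange_big_dep xpredT) //=; apply: eq_big_nat => m /andP[m0 mM].
rewrite [RHS](_ : _ = \sum_(m.+1 <= k < M.+1) G m (k - m)%N); last first.
  by rewrite [RHS](big_nat_widenl _ 1).
rewrite (big_cat_nat (n := (M - m).+1)) //=; last by lia.
rewrite [X in _ + X]big_nat_cond [X in _ + X]big1 ?addr0; last first.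
  by move=> n /andP[/andP[h1 h2] _]; apply: G0; lia.
rewrite -[m.+1 in RHS]add1n big_addn subSn; last by lia.
by apply: eq_bigr => n _; rewrite addnK.
Qed.

Lemma big_nat_triangle (G : nat -> nat -> V) M :
  \sum_(1 <= k < M.+1) \sum_(k.+1 <= n < M.+1) G k n =
  \sum_(1 <= n < M.+1) \sum_(1 <= k < n) G k n.
Proof.
have -> : \sum_(1 <= k < M.+1) \sum_(k.+1 <= n < M.+1) G k n =
  \sum_(1 <= k < M.+1) \sum_(1 <= n < M.+1 | (k < n)%N) G k n.
  by apply: eq_big_nat => k _; rewrite (big_nat_widenl _ _ _ _ _ (isT : (1 <= k.+1)%N)).
rewrite (exchange_big_dep xpredT) //=; apply: eq_big_nat => n /andP[n0 nM].
by rewrite [RHS](big_nat_widen _ _ _ _ _ (ltnW nM)).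
Qed.

Lemma big_nat_shift_telescope (F : nat -> V) M k : (k <= M)%N ->
  \sum_(1 <= n < (M - k).+1) (F n - F (n + k)%N) =
  \sum_(1 <= n < k.+1) F n - \sum_((M - k).+1 <= n < M.+1) F n.
Proof.
move=> kM; rewrite sumrB.
have e : \sum_(1 <= n < (M - k).+1) F (n + k)%N = \sum_(k.+1 <= n < M.+1) F n.
  by rewrite -[k.+1]add1n big_addn subSn.
rewrite {}e; apply/eqP; rewrite subr_eq addrAC eq_sym subr_eq; apply/eqP.
by rewrite -!big_cat_nat //; lia.
Qed.

End BigNat.

Section Vanish.
Variable K : comNzRingType.
Implicit Types a b c : fps K.

Definition vanish M a := forall j, (j <= M)%N -> coefs a j = 0.

Lemma vanishD M a b : vanish M a -> vanish M b -> vanish M (a + b).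
Proof. by move=> va vb j jM; rewrite coefsD va ?vb ?addr0. Qed.
Lemma vanishN M a : vanish M a -> vanish M (- a).
Proof. by move=> va j jM; rewrite coefsN va ?oppr0. Qed.
Lemma vanishM M a b : vanish M a -> vanish M (b * a).
Proof.
move=> va j jM; rewrite coefsM big1 // => i _.
by rewrite va ?mulr0 //; have := ltn_ord i; lia.
Qed.
Lemma vanish0 M : vanish M 0. Proof. by move=> j _; rewrite coefs0. Qed.
Lemma vanish_sum M I (r : seq I) (P : pred I) (F : I -> fps K) :
  (forall i, P i -> vanish M (F i)) -> vanish M (\sum_(i <- r | P i) F i).
Proof.
move=> vF; elim/big_rec: _ => [|i x Pi vx]; first exact: vanish0.
by apply: vanishD => //; exact: vF.
Qed.
Lemma vanish_eq a b : (forall M, vanish M (a - b)) -> a = b.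
Proof.
move=> v; apply/fpsP => n; apply/eqP; rewrite -subr_eq0.
by have := v n n (leqnn n); rewrite coefsB => ->.
Qed.
End Vanish.

Section Lambert.
Variable K : numFieldType.
Implicit Types (a b c : fps K) (f g h : nat -> K).

Definition fps_X n : fps K := Fps (fun j => (j == n)%:R).

Lemma coefs_XM n a j : coefs (fps_X n * a) j =
  if (n <= j)%N then coefs a (j - n) else 0.
Proof.
rewrite coefsM; case: leqP => nj.
  rewrite (bigD1 (Ordinal (nj : (n < j.+1)%N))) //= eqxx mul1r big1 ?addr0 //.
  by move=> i /eqP ni; case: eqP => [e|]; [case: ni; exact: val_inj|rewrite mul0r].
by rewrite big1 // => i _ /=; case: eqP => [e|]; [have := ltn_ord i; lia|rewrite mul0r].
Qed.

Lemma fps_XD m n : fps_X (m + n) = fps_X m * fps_X n.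
Proof.
apply/fpsP => j; rewrite coefs_XM /=; case: leqP => mj.
  by congr (_%:R); apply/eqP/eqP; lia.
by case: eqP => //; lia.
Qed.

Lemma fps_D_X n : fps_D (fps_X n) = n%:R * fps_X n.
Proof.
apply/fpsP => j; rewrite -fps_const_nat coefs_constM /=.
by case: eqP => [->|]; rewrite ?mulr0.
Qed.

Definition lambert_atom n : fps K := Fps (fun j => ((0 < j) && (n %| j))%N%:R).
Local Notation u := lambert_atom.

Lemma lambert_atomE n : (0 < n)%N -> (1 - fps_X n) * u n = fps_X n.
Proof.
move=> n0; apply/fpsP => j; rewrite mulrBl mul1r coefsB coefs_XM /=.
have [nj|nj] := leqP n j.
  case: (eqVneq j n) => [->|jn].
    by rewrite n0 dvdnn subnn /= subr0.
  by rewrite (_ : (0 < j - n)%N = (0 < j)%N) ?dvdn_subl ?subrr //; lia.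
rewrite subr0; case: eqP => [|_]; first lia.
by case: j nj => //= j nj; rewrite gtnNdvd.
Qed.

Lemma coefs0_1BX n : (0 < n)%N -> coefs (1 - fps_X n) 0 != 0.
Proof. by case: n => // n _; rewrite coefsB coefs1 /= subr0 oner_eq0. Qed.

Lemma lambert_atomM m n : (0 < m)%N -> (0 < n)%N ->
  u m * u n = u (m + n) * (1 + u m + u n).
Proof.
move=> m0 n0; have mn0 : (0 < m + n)%N by lia.
apply: (fps_mulI (coefs0_1BX m0)); apply: (fps_mulI (coefs0_1BX n0)).
apply: (fps_mulI (coefs0_1BX mn0)).
move: (lambert_atomE m0) (lambert_atomE n0) (lambert_atomE mn0).
rewrite fps_XD; set x := fps_X m; set y := fps_X n => hx hy hxy.
transitivity ((1 - x * y) * ((1 - x) * u m) * ((1 - y) * u n)); first by ring.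
transitivity (((1 - x * y) * u (m + n)) * ((1 - x) * (1 - y) +
  (1 - y) * ((1 - x) * u m) + (1 - x) * ((1 - y) * u n))); last by ring.
by rewrite hx hy hxy; ring.
Qed.

Lemma fps_D_lambert_atom n : (0 < n)%N ->
  fps_D (u n) = n%:R * (u n + u n ^+ 2).
Proof.
move=> n0; apply: (fps_mulI (coefs0_1BX n0)).
have hx := lambert_atomE n0; have := congr1 (@fps_D K) hx.
rewrite fps_DM fps_DB fps_D1 fps_D_X => /(canRL (addKr _)) ->.
set x := fps_X n in hx *.
transitivity (n%:R * (x + u n * x)); first by ring.
by rewrite -[in LHS]hx; ring.
Qed.

Lemma coefs_lambert_atom_gt n j : (j < n)%N -> coefs (u n) j = 0.
Proof. by case: j => // j jn; rewrite /= gtnNdvd. Qed.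

Arguments lambert_atom : simpl never.

Lemma vanish_lambert_atomM M m n : (M < m + n)%N -> vanish M (u m * u n).
Proof.
move=> Mmn j jM; rewrite coefsM big1 // => i _; have ij := ltn_ord i.
have [im|im] := ltnP i m; first by rewrite coefs_lambert_atom_gt // mul0r.
by rewrite [X in _ * X]coefs_lambert_atom_gt ?mulr0 //; lia.
Qed.

Definition lambert_sum g : fps K :=
  Fps (fun j => \sum_(1 <= d < j.+1) g d * coefs (u d) j).
Local Notation L := lambert_sum.

Definition lambert_sqr_sum g : fps K :=
  Fps (fun j => \sum_(1 <= d < j.+1) g d * coefs (u d ^+ 2) j).
Local Notation L2 := lambert_sqr_sum.

Lemma coefs_lambert_sum g j :
  coefs (L g) j = \sum_(1 <= d < j.+1) g d * coefs (u d) j.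
Proof. by []. Qed.
Lemma coefs_lambert_sqr_sum g j :
  coefs (L2 g) j = \sum_(1 <= d < j.+1) g d * coefs (u d ^+ 2) j.
Proof. by []. Qed.

Definition psum M g (F : nat -> fps K) := \sum_(1 <= n < M.+1) fps_const (g n) * F n.

Lemma coefs_psum M g F j : coefs (psum M g F) j =
  \sum_(1 <= n < M.+1) g n * coefs (F n) j.
Proof.
by rewrite coefs_sum; apply: eq_bigr => n _; rewrite coefs_constM.
Qed.

Let psum_trunc M g (F : nat -> fps K) (j : nat) : (j <= M)%N ->
  (forall n, (j < n)%N -> coefs (F n) j = 0) ->
  \sum_(1 <= d < j.+1) g d * coefs (F d) j = coefs (psum M g F) j.
Proof.
move=> jM F0; rewrite coefs_psum [RHS](big_cat_nat (n := j.+1)) //=.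
rewrite [X in _ = _ + X]big_nat_cond [X in _ = _ + X]big1 ?addr0 // => n /andP[/andP[h _] _].
by rewrite F0 ?mulr0.
Qed.

Lemma lambert_sum_psum M g : vanish M (L g - psum M g u).
Proof.
move=> j jM; rewrite coefsB -psum_trunc //; first exact: subrr.
by move=> n; exact: coefs_lambert_atom_gt.
Qed.

Lemma lambert_sqr_sum_psum M g : vanish M (L2 g - psum M g (fun n => u n ^+ 2)).
Proof.
move=> j jM; rewrite coefsB -psum_trunc //; first exact: subrr.
by move=> n jn; apply: (@vanish_lambert_atomM n) => //; lia.
Qed.

Lemma lambert_sum_ext f g : (forall n, (0 < n)%N -> f n = g n) -> L f = L g.
Proof.
move=> fg; apply/fpsP => j /=; apply: eq_big_nat => d /andP[d0 _].
by rewrite fg.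
Qed.

Lemma lambert_sumD f g : L (fun n => f n + g n) = L f + L g.
Proof.
apply/fpsP => j; rewrite coefsD /= -big_split; apply: eq_bigr => d _.
by rewrite mulrDl.
Qed.

Lemma lambert_sumZ k g : L (fun n => k * g n) = fps_const k * L g.
Proof.
apply/fpsP => j; rewrite coefs_constM /= mulr_sumr; apply: eq_bigr => d _.
by rewrite mulrA.
Qed.

Lemma lambert_sqr_sumE f : L2 (fun n => n%:R * f n) =
  fps_D (L f) - L (fun n => n%:R * f n).
Proof.
apply/fpsP => j; rewrite coefsB coefs_fps_D coefs_lambert_sqr_sum !coefs_lambert_sum.
rewrite mulr_sumr -sumrB; apply: eq_big_nat => d /andP[d0 _].
have /fpsP/(_ j) := fps_D_lambert_atom d0.
rewrite coefs_fps_D -fps_const_nat coefs_constM coefsD => hj.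
rewrite [X in _ = X - _](_ : _ = f d * (j%:R * coefs (u d) j)); last by ring.
by rewrite hj; ring.
Qed.

Definition inner_sum f n := \sum_(1 <= k < n) f k.

(* Ramanujan's 1916 identity for the square of cot/4 + sum u_n sin(n t),
   with cos(k t) replaced by an arbitrary function f (Liouville). *)
Lemma lambert_liouville_vanish f M :
  vanish M (\sum_(1 <= m < M.+1) \sum_(1 <= n < M.+1)
      fps_const (f `|m - n|%N - f (m + n)%N) * (u m * u n) -
    (fps_const (f 0%N) * psum M (fun=> 1) (fun n => u n ^+ 2) +
     psum M f (fun n => u n ^+ 2) *+ 2 -
     psum M (fun k => (k%:R - 1) * f k + 2 * inner_sum f k) u)).
Proof.
have diag : \sum_(1 <= m < M.+1) \sum_(1 <= n < M.+1)
      fps_const (f `|m - n|%N) * (u m * u n) =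
    fps_const (f 0%N) * psum M (fun=> 1) (fun n => u n ^+ 2) +
    psum M f (fun k => \sum_(1 <= n < (M - k).+1) u n * u (n + k)) *+ 2.
  rewrite big_nat_sym_diag => [|m n]; last by rewrite distnC (mulrC (u m)).
  congr (_ + _ *+ 2).
    rewrite /psum mulr_sumr; apply: eq_bigr => n _.
    by rewrite distnn (mul1r (_ : fps K)) expr2.
  apply: eq_bigr => k _; rewrite mulr_sumr; apply: eq_bigr => n _.
  by rewrite (_ : `|n - (n + k)|%N = k) //; lia.
have tele : psum M f (fun k => \sum_(1 <= n < (M - k).+1) u n * u (n + k)) =
    psum M f (fun k => u k * \sum_(1 <= n < k.+1) u n) -
    psum M f (fun k => \sum_((M - k).+1 <= n < M.+1) u k * u n) -
    psum M (inner_sum f) u.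
  have -> : psum M (inner_sum f) u =
      psum M f (fun k => \sum_(k.+1 <= n < M.+1) u n).
    rewrite /psum -(eq_bigr _ (fun k _ => esym (mulr_sumr _ _ _ _))).
    rewrite big_nat_triangle; apply: eq_bigr => n _.
    rewrite -mulr_suml /inner_sum; congr (_ * _).
    exact: (big_morph _ (@fps_constD K) (erefl : fps_const 0 = 0)).
  rewrite /psum -!sumrB; apply: eq_big_nat => k /andP[k0 kM].
  rewrite -!mulrBr; congr (_ * _).
  rewrite -mulr_sumr -mulrBr -big_nat_shift_telescope; last by lia.
  have -> : \sum_(k.+1 <= n < M.+1) u n = \sum_(1 <= n < (M - k).+1) u (n + k).
    by rewrite -[k.+1]add1n big_addn subSn //; lia.
  rewrite mulr_sumr -sumrB; apply: eq_big_nat => n /andP[n0 _].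
  by have h := lambert_atomM n0 k0; rewrite mulrBr [u k * u n]mulrC h; ring.
have anti : vanish M (\sum_(1 <= m < M.+1) \sum_(1 <= n < M.+1)
      fps_const (f (m + n)%N) * (u m * u n) -
    psum M f (fun k => u k * ((k%:R - 1) + (\sum_(1 <= m < k) u m) *+ 2))).
  move=> j jM; rewrite coefsB coefs_sum.
  rewrite (eq_bigr (fun m => \sum_(1 <= n < M.+1)
    f (m + n)%N * coefs (u m * u n) j)); last first.
    by move=> m _; rewrite coefs_sum; apply: eq_bigr => n _; rewrite coefs_constM.
  rewrite big_nat_antidiag => [|m n mn]; last first.
    by rewrite (@vanish_lambert_atomM (m + n).-1) ?mulr0 //; lia.
  apply/eqP; rewrite subr_eq0 coefs_psum; apply/eqP.
  apply: eq_big_nat => k /andP[k0 kM].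
  transitivity (f k * coefs (\sum_(1 <= m < k) u m * u (k - m)) j).
    rewrite coefs_sum mulr_sumr; apply: eq_big_nat => m /andP[m0 mk].
    by rewrite (subnKC (ltnW mk)).
  congr (_ * coefs _ _).
  rewrite (eq_big_nat _ _ (F2 := fun m => u k * (1 + u m + u (k - m)))) => [|m]; last first.
    move=> /andP[m0 mk]; have km : (0 < k - m)%N by rewrite subn_gt0.
    by rewrite (lambert_atomM m0 km) (subnKC (ltnW mk)).
  rewrite -mulr_sumr; congr (_ * _); rewrite !big_split /= mulr2n addrA.
  congr (_ + _ + _).
    by rewrite sumr_const_nat natrB.
  by rewrite big_nat_rev /=; apply: eq_big_nat => m /andP[m0 mk]; congr u; lia.
pose T1 := \sum_(1 <= m < M.+1) \sum_(1 <= n < M.+1)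
  fps_const (f `|m - n|%N) * (u m * u n).
pose T2 := \sum_(1 <= m < M.+1) \sum_(1 <= n < M.+1)
  fps_const (f (m + n)%N) * (u m * u n).
have -> : \sum_(1 <= m < M.+1) \sum_(1 <= n < M.+1)
      fps_const (f `|m - n|%N - f (m + n)%N) * (u m * u n) = T1 - T2.
  rewrite /T1 /T2 -sumrB; apply: eq_bigr => m _; rewrite -sumrB.
  apply: eq_bigr => n _; rewrite -mulrBl; congr (_ * _).
  by apply/fpsP => -[|j] /=; rewrite ?subr0.
pose W := psum M f (fun k => u k * ((k%:R - 1) + (\sum_(1 <= m < k) u m) *+ 2)).
pose Z := psum M f (fun k => \sum_((M - k).+1 <= n < M.+1) u k * u n).
have vZ : vanish M Z.
  apply: vanish_sum => k _; apply: vanishM.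
  rewrite big_nat_cond; apply: vanish_sum => n /andP[/andP[h1 h2] _].
  by apply: vanish_lambert_atomM; lia.
rewrite [X in vanish _ X](_ : _ = - (T2 - W) - (Z + Z)).
  by apply: vanishD; [apply: vanishN | apply/vanishN/vanishD].
rewrite /T1 diag tele -/Z.
have e1 : psum M f (fun k => u k * \sum_(1 <= n < k.+1) u n) *+ 2 =
  W + (psum M f (fun n => u n ^+ 2)) *+ 2 - psum M (fun k => (k%:R - 1) * f k) u.
  rewrite /W /psum -!sumrMnl -big_split -sumrB; apply: eq_big_nat => k /andP[k0 _] /=.
  rewrite big_nat_recr //= fps_constM.
  have -> : fps_const (k%:R - 1 : K) = k%:R - 1.
    by rewrite -(fps_const_nat K k); apply/fpsP => -[|j]; rewrite coefsB coefs1 /= ?subr0.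
  ring.
have e2 : psum M (fun k => (k%:R - 1) * f k + 2 * inner_sum f k) u =
    psum M (fun k => (k%:R - 1) * f k) u + (psum M (inner_sum f) u) *+ 2.
  rewrite /psum -sumrMnl -big_split; apply: eq_bigr => k _ /=.
  rewrite fps_constD mulrDl; congr (_ + _).
  by rewrite fps_constM fps_const_nat -mulrA mulr_natl.
rewrite e2 mulrnBl mulrnBl e1; ring.
Qed.

Lemma lambert_liouville f (s : seq ((nat -> K) * (nat -> K))) :
  (forall m n, (0 < m)%N -> (0 < n)%N ->
     f `|m - n|%N - f (m + n)%N = \sum_(gh <- s) gh.1 m * gh.2 n) ->
  \sum_(gh <- s) L gh.1 * L gh.2 =
  fps_const (f 0%N) * L2 (fun=> 1) + L2 f *+ 2 -
  L (fun k => (k%:R - 1) * f k + 2 * inner_sum f k).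
Proof.
move=> fE; apply: vanish_eq => M.
have := @lambert_liouville_vanish f M.
set A := \sum_(1 <= m < M.+1) _; set B := (X in A - X) => vAB.
set A' := \sum_(gh <- s) _; set B' := (X in A' - X).
rewrite (_ : A' - B' = (A' - A) + (A - B) - (B' - B)); last by ring.
apply: vanishD; [apply: vanishD => // | apply: vanishN].
  have -> : A = \sum_(gh <- s) psum M gh.1 u * psum M gh.2 u.
    rewrite /A (eq_big_nat _ _ (F2 := fun m => \sum_(gh <- s)
      fps_const (gh.1 m) * u m * psum M gh.2 u)) => [|m /andP[m0 _]].
      rewrite exchange_big; apply: eq_bigr => gh _ /=.
      by rewrite -mulr_suml.
    rewrite (eq_big_nat _ _ (F2 := fun n => \sum_(gh <- s)
      fps_const (gh.1 m) * u m * (fps_const (gh.2 n) * u n))) => [|n /andP[n0 _]].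
      rewrite exchange_big; apply: eq_bigr => gh _ /=.
      by rewrite -mulr_sumr.
    rewrite fE // (big_morph _ (@fps_constD K) (erefl : fps_const 0 = 0)).
    rewrite mulr_suml; apply: eq_bigr => gh _; rewrite fps_constM; ring.
  rewrite /A' -sumrB; apply: vanish_sum => gh _.
  rewrite (_ : _ - _ = L gh.1 * (L gh.2 - psum M gh.2 u) +
    psum M gh.2 u * (L gh.1 - psum M gh.1 u)); last by ring.
  by apply: vanishD; apply: vanishM; exact: lambert_sum_psum.
set p1 := psum M (fun=> 1) (fun n => u n ^+ 2).
rewrite /B /B' -/p1; set p2 := psum M f (fun n => u n ^+ 2); set p3 := psum M _ u.
rewrite (_ : _ - _ = fps_const (f 0%N) * (L2 (fun=> 1) - p1) +
  (L2 f - p2) + (L2 f - p2) - (L (fun k => (k%:R - 1) * f k + 2 * inner_sum f k) - p3));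
  last by ring.
apply: vanishD; last by apply/vanishN; exact: lambert_sum_psum.
apply: vanishD; last exact: lambert_sqr_sum_psum.
apply: vanishD; last exact: lambert_sqr_sum_psum.
by apply: vanishM; exact: lambert_sqr_sum_psum.
Qed.

End Lambert.
Arguments lambert_atom : simpl never.

Section Cubic.
Variable K : numFieldType.
Implicit Types (a b c : fps K) (f g h : nat -> K).
Local Notation L := (@lambert_sum K).
Local Notation u := (@lambert_atom K).

(* The values at n of 2 cos(2 pi n/3) and of (2/sqrt 3) sin(2 pi n/3). *)
Fixpoint cos_sin3 n : K * K :=
  if n is m.+1 then
    let: (c, x) := cos_sin3 m in ((- c - 3 * x) / 2, (c - x) / 2)
  else (2, 0).
Definition cos3 n := (cos_sin3 n).1.
Definition sin3 n := (cos_sin3 n).2.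

Lemma cos3S n : cos3 n.+1 = (- cos3 n - 3 * sin3 n) / 2.
Proof. by rewrite /cos3 /sin3 /=; case: cos_sin3. Qed.
Lemma sin3S n : sin3 n.+1 = (cos3 n - sin3 n) / 2.
Proof. by rewrite /cos3 /sin3 /=; case: cos_sin3. Qed.

Lemma cos3_0 : cos3 0 = 2. Proof. by []. Qed.
Lemma sin3_0 : sin3 0 = 0. Proof. by []. Qed.

Lemma cos3D_sin3D m n : cos3 (m + n) = (cos3 m * cos3 n - 3 * sin3 m * sin3 n) / 2 /\
  sin3 (m + n) = (sin3 m * cos3 n + cos3 m * sin3 n) / 2.
Proof.
elim: m => [|m [IHc IHs]].
  by rewrite add0n cos3_0 sin3_0; split; field.
by rewrite addSn !cos3S !sin3S IHc IHs; split; field.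
Qed.
Lemma cos3D m n : cos3 (m + n) = (cos3 m * cos3 n - 3 * sin3 m * sin3 n) / 2.
Proof. by case: (cos3D_sin3D m n). Qed.
Lemma sin3D m n : sin3 (m + n) = (sin3 m * cos3 n + cos3 m * sin3 n) / 2.
Proof. by case: (cos3D_sin3D m n). Qed.

Lemma cos3_sin3_norm n : cos3 n ^+ 2 + 3 * sin3 n ^+ 2 = 4.
Proof.
elim: n => [|n IH]; first by rewrite cos3_0 sin3_0; ring.
by rewrite cos3S sin3S -[RHS]IH; field.
Qed.

Lemma cos3_dist (m n : nat) : cos3 `|m - n|%N = (cos3 m * cos3 n + 3 * sin3 m * sin3 n) / 2.
Proof.
wlog mn : m n / (m <= n)%N => [hw|].
  have [/hw//|/ltnW/hw] := leqP m n.
  by rewrite distnC => ->; field.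
rewrite (distnEr mn) -{2 3}(subnKC mn); move: (n - m)%N => k.
rewrite cos3D sin3D; transitivity ((cos3 m ^+ 2 + 3 * sin3 m ^+ 2) * cos3 k / 4).
  by rewrite cos3_sin3_norm; field.
by field.
Qed.

Lemma sin3_dist (m n : nat) : `|m - n|%N%:R * sin3 `|m - n|%N =
  (m%:R - n%:R) * (sin3 m * cos3 n - cos3 m * sin3 n) / 2.
Proof.
wlog mn : m n / (m <= n)%N => [hw|].
  have [/hw//|/ltnW/hw] := leqP m n.
  by rewrite distnC => ->; field.
rewrite (distnEr mn) natrB //.
suff -> : sin3 (n - m) = (sin3 n * cos3 m - cos3 n * sin3 m) / 2 by field.
rewrite -{2 3}(subnKC mn); move: (n - m)%N => k.
rewrite cos3D sin3D; transitivity ((cos3 m ^+ 2 + 3 * sin3 m ^+ 2) * sin3 k / 4).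
  by rewrite cos3_sin3_norm; field.
by field.
Qed.

Lemma sqr_dist (m n : nat) : `|m - n|%N%:R ^+ 2 = (m%:R - n%:R) ^+ 2 :> K.
Proof.
wlog mn : m n / (m <= n)%N => [hw|].
  have [/hw//|/ltnW/hw] := leqP m n.
  by rewrite distnC => ->; ring.
by rewrite (distnEr mn) natrB //; ring.
Qed.

Lemma cos3E n : cos3 n = if (3 %| n)%N then 2 else -1.
Proof.
have p k : cos3 (k + 3) = cos3 k by rewrite addn3 !(cos3S, sin3S); field.
have h k r : cos3 (k * 3 + r) = cos3 r.
  elim: k => // k IH; rewrite (_ : k.+1 * 3 + r = (k * 3 + r) + 3)%N ?p //; lia.
rewrite {1}(divn_eq n 3) h /dvdn; case: (n %% 3)%N (ltn_pmod n (isT : (0 < 3)%N)).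
  by [].
by move=> [|[|//]] _; rewrite !(cos3S, sin3S) cos3_0 sin3_0; field.
Qed.

Lemma inner_sum_closed f T : T 1%N = 2 * f 1%N ->
  (forall k, T k.+1 - T k = (k%:R + 2) * f k.+1 - (k%:R - 1) * f k) ->
  forall k, (0 < k)%N -> (k%:R + 1) * f k + 2 * inner_sum f k = T k.
Proof.
move=> T1 TS; elim=> // -[_ _|k IH _].
  by rewrite /inner_sum big_geq // T1; ring.
rewrite /inner_sum big_nat_recr //= -/(inner_sum f k.+1) mulrDr.
apply/eqP; rewrite -subr_eq0 -[T k.+2](subrK (T k.+1)) TS -IH //.
by apply/eqP; ring.
Qed.

Lemma lambert_sum_comb (t : seq (int * (nat -> K))) :
  L (fun k => \sum_(zg <- t) zg.1%:~R * zg.2 k) = \sum_(zg <- t) zg.1%:~R * L zg.2.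
Proof.
have cz (z : int) : fps_const z%:~R = z%:~R :> fps K.
  case: z => n; rewrite -?pmulrn ?NegzE ?mulrNz -?pmulrn.
    exact: fps_const_nat.
  by apply/fpsP => j; rewrite coefsN -fps_const_nat; case: j => //=; rewrite oppr0.
elim: t => [|[z g] t IH].
  by rewrite big_nil; apply/fpsP => j; rewrite coefs_lambert_sum big1 ?coefs0 // => i _;
     rewrite big_nil mul0r.
rewrite big_cons -IH -cz -lambert_sumZ -lambert_sumD; apply: lambert_sum_ext => n _.
by rewrite big_cons.
Qed.

Lemma lambert_liouville_int f g (s : seq (int * ((nat -> K) * (nat -> K))))
    (t : seq (int * (nat -> K))) (T := fun k => \sum_(zg <- t) zg.1%:~R * zg.2 k) :
  (forall k, f k = k%:R * (3 * g k)) ->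
  (forall m n : nat, f `|m - n|%N - f (m + n)%N =
     \sum_(zgh <- s) zgh.1%:~R * (zgh.2.1 m * zgh.2.2 n)) ->
  T 1%N = 2 * f 1%N ->
  (forall k, T k.+1 - T k = (k%:R + 2) * f k.+1 - (k%:R - 1) * f k) ->
  \sum_(zgh <- s) zgh.1%:~R * (L zgh.2.1 * L zgh.2.2) =
  6 * fps_D (L g) - \sum_(zg <- t) zg.1%:~R * L zg.2.
Proof.
move=> fg fs T1 TS; have ft := inner_sum_closed T1 TS; have := @lambert_liouville K f
  [seq ((fun m => z.1%:~R * z.2.1 m), z.2.2) | z <- s].
rewrite big_map /= => H.
rewrite [LHS](_ : _ = \sum_(z <- s) L (fun m => z.1%:~R * z.2.1 m) * L z.2.2); last first.
  apply: eq_bigr => z _; have := lambert_sum_comb [:: (z.1, z.2.1)].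
  rewrite !big_seq1 /= mulrA => <-; congr (_ * _).
  by apply: lambert_sum_ext => n _; rewrite big_seq1.
rewrite H => [{H}|m n _ _]; last first.
  by rewrite big_map fs; apply: eq_bigr => i _; rewrite mulrA.
have -> : f 0%N = 0 by rewrite fg mul0r.
have -> : lambert_sqr_sum f = 3 * fps_D (L g) - L f.
  have -> : f = (fun n => n%:R * (3 * g n)) by exact/funext.
  by rewrite lambert_sqr_sumE lambert_sumZ fps_DM fps_const_nat fps_D_nat mul0r add0r.
rewrite -lambert_sum_comb -(lambert_sum_ext ft) (_ : fps_const 0 = 0) //.
rewrite (_ : (fun k => (k%:R + 1) * f k + 2 * inner_sum f k) =
  (fun k => 2 * f k + ((k%:R - 1) * f k + 2 * inner_sum f k))); last first.
  by apply/funext => k; ring.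
by rewrite [in RHS]lambert_sumD lambert_sumZ fps_const_nat; ring.
Qed.

Definition pow k n : K := n%:R ^+ k.
Definition powc k n := pow k n * cos3 n.
Definition pows k n := pow k n * sin3 n.
Notation Lp k := (L (pow k)).
Notation Lc k := (L (powc k)).
Notation Lx k := (L (pows k)).

Lemma liouville_pow2 :
  - 12 * (Lp 1 * Lp 1) = 6 * fps_D (Lp 1) - 5 * Lp 3 - Lp 1.
Proof.
have := @lambert_liouville_int (fun k => 3 * pow 2 k) (pow 1)
 [:: (-12, (pow 1, pow 1))] [:: (5, pow 3); (1, pow 1)].
rewrite !big_cons !big_nil /= => H.
rewrite (_ : - 12 * _ = (- 12)%:~R * (Lp 1 * Lp 1) + 0); last by ring.
rewrite H /pow.
- by ring.
- by move=> k; ring.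
- by move=> m n; rewrite !big_cons !big_nil /= sqr_dist natrD; ring.
- by rewrite !big_cons !big_nil /=; ring.
- by move=> k; rewrite !big_cons !big_nil /= -natr1; ring.
Qed.

Lemma liouville_pow4 :
  - 240 * (Lp 1 * Lp 3) = 30 * fps_D (Lp 3) - 21 * Lp 5 - 10 * Lp 3 + Lp 1.
Proof.
have := @lambert_liouville_int (fun k => 15 * pow 4 k) (fun k => 5 * pow 3 k)
 [:: (-120, (pow 1, pow 3)); (-120, (pow 3, pow 1))]
 [:: (21, pow 5); (10, pow 3); (-1, pow 1)].
rewrite !big_cons !big_nil /= => H.
rewrite (_ : - 240 * _ = (- 120)%:~R * (Lp 1 * Lp 3) + ((- 120)%:~R * (Lp 3 * Lp 1) + 0));
  last by ring.
rewrite H /pow.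
- by rewrite lambert_sumZ fps_DM fps_const_nat fps_D_nat; ring.
- by move=> k; ring.
- by move=> m n; rewrite !big_cons !big_nil /= (exprM _ 2 2) sqr_dist natrD; ring.
- by rewrite !big_cons !big_nil /=; ring.
- by move=> k; rewrite !big_cons !big_nil /= -natr1; ring.
Qed.

Lemma liouville_sin1 :
  - 6 * (Lx 0 * Lc 1) = 6 * fps_D (Lx 0) - 3 * Lx 2 - 2 * Lx 0 + Lc 1.
Proof.
have := @lambert_liouville_int (fun k => 3 * pows 1 k) (pows 0)
 [:: (-3, (pows 0, powc 1)); (-3, (powc 1, pows 0))]
 [:: (3, pows 2); (2, pows 0); (-1, powc 1)].
rewrite !big_cons !big_nil /= => H.
rewrite (_ : - 6 * _ = (- 3)%:~R * (Lx 0 * Lc 1) + ((- 3)%:~R * (Lc 1 * Lx 0) + 0));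
  last by ring.
rewrite H /powc /pows /pow.
- by ring.
- by move=> k; ring.
- by move=> m n; rewrite !big_cons !big_nil /= !expr1 sin3_dist sin3D natrD; field.
- by rewrite !big_cons !big_nil /= cos3S sin3S cos3_0 sin3_0; field.
- by move=> k; rewrite !big_cons !big_nil /= -natr1 !(cos3S, sin3S); field.
Qed.

Lemma liouville_cos2 :
  18 * (Lx 0 * Lx 2) - 6 * (Lc 1 * Lc 1) =
  6 * fps_D (Lc 1) - 3 * Lc 3 + 2 * Lx 0 - 4 * Lc 1 - 3 * Lx 2.
Proof.
have := @lambert_liouville_int (fun k => 3 * powc 2 k) (powc 1)
 [:: (9, (pows 0, pows 2)); (9, (pows 2, pows 0)); (-6, (powc 1, powc 1))]
 [:: (3, powc 3); (-2, pows 0); (4, powc 1); (3, pows 2)].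
rewrite !big_cons !big_nil /= => H.
rewrite (_ : 18 * _ - _ = 9%:~R * (Lx 0 * Lx 2) + (9%:~R * (Lx 2 * Lx 0) +
  ((- 6)%:~R * (Lc 1 * Lc 1) + 0))); last by ring.
rewrite H /powc /pows /pow.
- by ring.
- by move=> k; ring.
- by move=> m n; rewrite !big_cons !big_nil /= sqr_dist cos3_dist cos3D natrD; field.
- by rewrite !big_cons !big_nil /= cos3S sin3S cos3_0 sin3_0; field.
- by move=> k; rewrite !big_cons !big_nil /= -natr1 !(cos3S, sin3S); field.
Qed.

Lemma liouville_sin3 :
  - 18 * (Lx 2 * Lc 1) - 6 * (Lx 0 * Lc 3) =
  6 * fps_D (Lx 2) - 3 * Lx 4 + 2 * Lx 0 - 2 * Lc 1 - 6 * Lx 2 + Lc 3.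
Proof.
have := @lambert_liouville_int (fun k => 3 * pows 3 k) (pows 2)
 [:: (-9, (pows 2, powc 1)); (-3, (pows 0, powc 3)); (-3, (powc 3, pows 0));
     (-9, (powc 1, pows 2))]
 [:: (3, pows 4); (-2, pows 0); (2, powc 1); (6, pows 2); (-1, powc 3)].
rewrite !big_cons !big_nil /= => H.
rewrite (_ : - 18 * _ - _ = (- 9)%:~R * (Lx 2 * Lc 1) + ((- 3)%:~R * (Lx 0 * Lc 3) +
  ((- 3)%:~R * (Lc 3 * Lx 0) + ((- 9)%:~R * (Lc 1 * Lx 2) + 0)))); last by ring.
rewrite H /powc /pows /pow.
- by ring.
- by move=> k; ring.
- move=> m n; rewrite !big_cons !big_nil /= exprSr -(mulrA (_ ^+ 2)) sqr_dist sin3_dist.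
  by rewrite sin3D natrD; field.
- by rewrite !big_cons !big_nil /= cos3S sin3S cos3_0 sin3_0; field.
- by move=> k; rewrite !big_cons !big_nil /= -natr1 !(cos3S, sin3S); field.
Qed.

Lemma liouville_cos4 :
  18 * (Lx 0 * Lx 4) + 54 * (Lx 2 * Lx 2) - 24 * (Lc 1 * Lc 3) =
  6 * fps_D (Lc 3) - 3 * Lc 5 - 6 * Lx 0 + 8 * Lc 1 + 12 * Lx 2 - 8 * Lc 3 - 3 * Lx 4.
Proof.
have := @lambert_liouville_int (fun k => 3 * powc 4 k) (powc 3)
 [:: (9, (pows 0, pows 4)); (54, (pows 2, pows 2)); (9, (pows 4, pows 0));
     (-12, (powc 3, powc 1)); (-12, (powc 1, powc 3))]
 [:: (3, powc 5); (6, pows 0); (-8, powc 1); (-12, pows 2); (8, powc 3); (3, pows 4)].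
rewrite !big_cons !big_nil /= => H.
rewrite (_ : 18 * _ + _ - _ = 9%:~R * (Lx 0 * Lx 4) + (54%:~R * (Lx 2 * Lx 2) +
  (9%:~R * (Lx 4 * Lx 0) + ((- 12)%:~R * (Lc 3 * Lc 1) +
  ((- 12)%:~R * (Lc 1 * Lc 3) + 0))))); last by ring.
rewrite H /powc /pows /pow.
- by ring.
- by move=> k; ring.
- move=> m n; rewrite !big_cons !big_nil /= (exprM _ 2 2) sqr_dist cos3_dist cos3D.
  by rewrite natrD; field.
- by rewrite !big_cons !big_nil /= cos3S sin3S cos3_0 sin3_0; field.
- by move=> k; rewrite !big_cons !big_nil /= -natr1 !(cos3S, sin3S); field.
Qed.
End Cubic.

Section CubicSeries.
Variable K : numFieldType.
Implicit Types (a b c : fps K) (f g h : nat -> K).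
Local Notation L := (@lambert_sum K).
Local Notation u := (@lambert_atom K).
Local Notation Lp k := (L (pow K k)).
Local Notation Lc k := (L (powc K k)).
Local Notation Lx k := (L (pows K k)).

Lemma coefs_lambert_atom n j : coefs (u n) j = ((0 < j) && (n %| j))%N%:R.
Proof. by []. Qed.

Lemma coefs_lambert_sum_widen M g j : (j <= M)%N ->
  coefs (L g) j = \sum_(1 <= d < M.+1) g d * coefs (u d) j.
Proof.
move=> jM; rewrite coefs_lambert_sum [RHS](big_cat_nat (n := j.+1)) //.
rewrite [X in _ = _ + X]big_nat_cond [X in _ = _ + X]big1 ?addr0 //.
by move=> n /andP[/andP[h _] _]; rewrite coefs_lambert_atom_gt ?mulr0.
Qed.

Lemma lambert_sum_dvd3 g :
  L (fun n => if (3 %| n)%N then g (n %/ 3)%N else 0) = fps_sub3 (L g).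
Proof.
apply/fpsP => j; rewrite coefs_sub3; case: ifP => [/dvdnP[m]|/negbT j3].
  rewrite mulnC => ->; rewrite mulKn // coefs_lambert_sum.
  set F := fun d => (if (3 %| d)%N then g (d %/ 3)%N else 0) * coefs (u d) (3 * m).
  have F0 : F 0%N = 0 by rewrite /F coefs_lambert_atom; case: m {F} => [|m]; rewrite ?mulr0 // mulnS mulr0.
  have := @big_dvdn3 _ F m; rewrite big_nat_recl // F0 add0r big_add1 => ->; last first.
    by move=> i i3; rewrite /F (negbTE i3) mul0r.
  rewrite big_nat_recl // F0 add0r coefs_lambert_sum [RHS]big_add1 /=.
  apply: eq_bigr => i _; rewrite /F dvdn_mulr // mulKn //.
  by rewrite !coefs_lambert_atom muln_gt0 dvdn_pmul2l.
rewrite coefs_lambert_sum big1 // => d _; case: ifP; rewrite ?mul0r // => d3.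
rewrite coefs_lambert_atom; case: (boolP (d %| j)%N) => [dj|]; last by rewrite andbF mulr0.
by case/negP: j3; exact: dvdn_trans dj.
Qed.

Lemma lambert_cosE k : Lc k = - Lp k + 3 ^+ k.+1 * fps_sub3 (Lp k).
Proof.
rewrite -lambert_sum_dvd3.
have -> : 3 ^+ k.+1 = fps_const (3 ^+ k.+1) :> fps K.
  elim: k.+1 => // m IH; rewrite !exprS IH fps_constM fps_const_nat //.
rewrite -lambert_sumZ -[- Lp k]mulN1r.
have -> : -1 = fps_const (-1) :> fps K.
  by apply/fpsP => -[|m]; rewrite coefsN coefs1 //= oppr0.
rewrite -lambert_sumZ -lambert_sumD; apply: lambert_sum_ext => n _.
rewrite /powc cos3E /pow; case: ifP => [/dvdnP[m ->]|_]; last by ring.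
by rewrite mulnK // natrM exprMn exprS; ring.
Qed.

Lemma lambert_sqr_conj g j : coefs (lambert_sqr_sum g + L g) j =
  \sum_(1 <= m < j.+1) m%:R * g (j %/ m)%N * coefs (u m) j.
Proof.
rewrite coefsD coefs_lambert_sqr_sum coefs_lambert_sum -big_split.
transitivity (\sum_(1 <= d < j.+1) \sum_(1 <= m < j.+1)
    m%:R * g d * (d * m == j)%N%:R).
  apply: eq_big_nat => d /andP[d0 dj].
  have d0' : d%:R != 0 :> K by rewrite pnatr_eq0 -lt0n.
  have -> : coefs (u d ^+ 2) j = j%:R / d%:R * coefs (u d) j - coefs (u d) j.
    apply: (mulfI d0'); have /fpsP/(_ j) := fps_D_lambert_atom K d0.
    rewrite coefs_fps_D -fps_const_nat coefs_constM coefsD => h.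
    by transitivity (j%:R * coefs (u d) j - d%:R * coefs (u d) j); [rewrite h; ring|field].
  rewrite -[LHS]mulrDr subrK coefs_lambert_atom.
  case: (boolP (d %| j)%N) => [/dvdnP[m jE]|dj']; last first.
    rewrite andbF !mulr0 big1 // => m _; case: eqP => [e|]; rewrite ?mulr0 //.
    by rewrite -e dvdn_mulr in dj'.
  have j0 : (0 < j)%N by lia.
  have m0 : (0 < m)%N by case: m jE => // e; rewrite e in j0.
  have mj : (m < j.+1)%N by rewrite jE ltnS leq_pmulr.
  rewrite andbT j0 mulr1 (bigD1_seq m) ?iota_uniq ?mem_index_iota ?m0 //=.
  rewrite big1 => [|i im]; last first.
    case: eqP => [e|]; rewrite ?mulr0 //; case/eqP: im.
    by move: e; rewrite jE mulnC => /eqP; rewrite eqn_pmul2r // => /eqP.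
  by rewrite mulnC -jE eqxx mulr1 addr0 jE natrM mulfK // mulrC.
rewrite exchange_big_nat; apply: eq_big_nat => m /andP[m0 mj].
rewrite coefs_lambert_atom.
case: (boolP (m %| j)%N) => [/dvdnP[d jE]|mj']; last first.
  rewrite andbF !mulr0 big1 // => d _; case: eqP => [e|]; rewrite ?mulr0 //.
  by rewrite -e dvdn_mull in mj'.
have j0 : (0 < j)%N by lia.
have d0 : (0 < d)%N by case: d jE => // e; rewrite e in j0.
have dj : (d < j.+1)%N by rewrite jE ltnS leq_pmulr.
rewrite andbT j0 mulr1 (bigD1_seq d) ?iota_uniq ?mem_index_iota ?d0 //=.
rewrite big1 => [|i im]; last first.
  case: eqP => [e|]; rewrite ?mulr0 //; case/eqP: im.
  by move: e; rewrite jE => /eqP; rewrite eqn_pmul2r // => /eqP.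
by rewrite -jE eqxx mulr1 addr0 jE mulnK.
Qed.

Lemma lambert_sqr_one : lambert_sqr_sum (fun=> 1) + L (fun=> 1) = Lp 1.
Proof.
apply/fpsP => j; rewrite lambert_sqr_conj coefs_lambert_sum.
by apply: eq_bigr => m _; rewrite mulr1.
Qed.

Lemma lambert_sqr_cos :
  lambert_sqr_sum (@cos3 K) + L (@cos3 K) = - Lp 1 + 3 * fps_sub3 (Lp 1).
Proof.
apply/fpsP => j; rewrite lambert_sqr_conj coefsD coefsN -fps_const_nat coefs_constM.
rewrite coefs_sub3 [X in - X + _]coefs_lambert_sum -sumrN.
have -> : (if (3 %| j)%N then coefs (Lp 1) (j %/ 3) else 0) =
    \sum_(1 <= m < j.+1) m%:R * ((3 * m %| j)%N && (0 < j)%N)%:R.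
  case: ifP => [/dvdnP[i ->]|j3]; last first.
    rewrite big1 // => m _; case: (boolP (3 * m %| j)%N); rewrite ?mulr0 //.
    by move=> /(dvdn_trans (dvdn_mulr m (dvdnn 3))); rewrite j3.
  rewrite mulnK // (@coefs_lambert_sum_widen (i * 3)) ?leq_pmulr //.
  apply: eq_bigr => m _; rewrite /pow expr1 coefs_lambert_atom.
  by rewrite mulnC dvdn_pmul2r // muln_gt0 andbT andbC.
rewrite mulr_sumr -big_split; apply: eq_big_nat => m /andP[m0 mj].
transitivity (- (pow K 1 m * coefs (u m) j) +
  3 * (m%:R * ((3 * m %| j)%N && (0 < j)%N)%:R)); last by [].
rewrite /pow expr1 coefs_lambert_atom cos3E.
case: (boolP (m %| j)%N) => [/dvdnP[d ->]|mj'].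
  rewrite mulnK // dvdn_pmul2r // andbT.
  by case: (0 < d * m)%N; case: (3 %| d)%N; rewrite /=; ring.
rewrite (_ : (3 * m %| j)%N = false) ?andbF ?mulr0 ?addr0 ?oppr0 ?mulr0 //.
by apply: contraNF mj'; exact/dvdn_trans/dvdn_mull.
Qed.

Lemma liouville_cos0 :
  3 * (Lx 0 * Lx 0) + Lx 0 = Lp 1 - 3 * fps_sub3 (Lp 1).
Proof.
have := @lambert_liouville K (@cos3 K) [:: (fun n => 3 * sin3 K n, @sin3 K)].
rewrite big_seq1 /= => H.
have := lambert_sqr_cos; set c2 := lambert_sqr_sum _; set c1 := L (@cos3 K) => hc.
have := lambert_sqr_one; set u2 := lambert_sqr_sum _; set u1 := L _ => hu.
have inn k : (0 < k)%N -> 2 * inner_sum (@cos3 K) k = - cos3 K k + sin3 K k - 2.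
  elim: k => // -[_ _|k IH _].
    by rewrite /inner_sum big_geq // cos3S sin3S cos3_0 sin3_0; field.
  rewrite /inner_sum big_nat_recr //= -/(inner_sum _ k.+1) mulrDr IH //.
  by rewrite (cos3S _ k.+1) (sin3S _ k.+1); field.
have e0 : Lx 0 = L (@sin3 K) by apply: lambert_sum_ext => n _; rewrite /pows /pow mul1r.
move: H; rewrite lambert_sumZ fps_const_nat -e0 -/c2 -/u2 => H.
rewrite [3 * _]mulrA H => [{H}|m n _ _]; last first.
  by rewrite big_seq1 /= cos3_dist cos3D; field.
rewrite (@lambert_sum_ext K _ (fun k => powc K 1 k + (- 2 * cos3 K k +
  (pows K 0 k + - 2 * 1)))); last first.
  by move=> k k0; rewrite inn // /powc /pows /pow; ring.
rewrite !lambert_sumD !lambert_sumZ -/c1 -/u1 lambert_cosE fps_const_nat.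
have -> : fps_const (-2) = - 2 :> fps K.
  by rewrite -(fps_const_nat K 2); apply/fpsP => -[|m]; rewrite coefsN //= oppr0.
have -> : u2 = Lp 1 - u1 by rewrite -hu addrK.
have -> : c2 = - Lp 1 + 3 * fps_sub3 (Lp 1) - c1 by rewrite -hc addrK.
by ring.
Qed.

End CubicSeries.

(** * Differential relations of level 3 *)

Section CubicRelations.
Variable K : numFieldType.
Local Notation L := (@lambert_sum K).
Local Notation Lp k := (L (pow K k)).
Local Notation Lx k := (L (pows K k)).
Local Notation D := (@fps_D K).

Definition fps_E2 : fps K := 1 - 24 * Lp 1.
Definition fps_E4 : fps K := 1 + 240 * Lp 3.
Definition fps_E6 : fps K := 1 - 504 * Lp 5.
(* The cubic theta functions a, b^3 and c^3 of J. and P. Borwein. *)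
Definition fps_a : fps K := 1 + 6 * Lx 0.
Definition fps_b3 : fps K := 1 - 9 * Lx 2.
Definition fps_c3 : fps K := fps_a ^+ 3 - fps_b3.

Local Notation P := fps_E2.
Local Notation Q := fps_E4.
Local Notation R := fps_E6.
Local Notation a := fps_a.
Local Notation B := fps_b3.
Local Notation C := fps_c3.
Local Notation P3 := (fps_sub3 fps_E2).
Local Notation Q3 := (fps_sub3 fps_E4).

Lemma fps_natI n (x y : fps K) : (0 < n)%N -> n%:R * x = n%:R * y -> x = y.
Proof.
move=> n0; apply: fps_mulI; rewrite -fps_const_nat /= pnatr_eq0; lia.
Qed.

Lemma fps_nat_eq0 n (x y : fps K) : (0 < n)%N -> n%:R * (x - y) = 0 -> x = y.
Proof. by move=> n0 h; apply: (fps_natI n0); apply/eqP; rewrite -subr_eq0 -mulrBr h. Qed.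

Let al := Lx 0.
Let be := Lx 2.
Let ga := Lx 4.
Let q := fps_sub3 (Lp 1).
Let t := Lp 3.
Let t3 := fps_sub3 (Lp 3).
Let w := Lp 5.
Let w3 := fps_sub3 (Lp 5).
Let p := Lp 1.

Let pE : p = 3 * al ^+ 2 + al + 3 * q.
Proof.
by rewrite -[LHS](subrK (3 * q)) /p /q -liouville_cos0 /al; ring.
Qed.

Let Dp : D p = 6 * al * D al + D al + 3 * D q.
Proof. by rewrite pE !(fps_D_nat, fps_DD, fps_DM, fps_DX) /=; ring. Qed.

Let c1 : L (powc K 1) = 9 * q - p.
Proof. by rewrite lambert_cosE -/p -/q; ring. Qed.
Let c3 : L (powc K 3) = 81 * t3 - t.
Proof. by rewrite lambert_cosE -/t -/t3; ring. Qed.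
Let c5 : L (powc K 5) = 729 * w3 - w.
Proof. by rewrite lambert_cosE -/w -/w3; ring. Qed.

Let sub0 (x y : fps K) : x = y -> x - y = 0. Proof. by move->; rewrite subrr. Qed.

Let r1 : - 12 * p * p - (6 * D p - 5 * t - p) = 0.
Proof. by rewrite -[X in X - _]mulrA; apply/sub0/liouville_pow2. Qed.
Let r13 : - 12 * q * q - (2 * D q - 5 * t3 - q) = 0.
Proof.
have := congr1 (@fps_sub3 K) (liouville_pow2 K).
rewrite !(fps_sub3B, fps_sub3M, fps_sub3N, fps_sub3_nat) -/q -/t3.
have -> : 6 * fps_sub3 (D (Lp 1)) = 2 * D q by rewrite /q fps_D_sub3 mulrA -natrM.
by move=> <-; ring.
Qed.
Let r2 : - 240 * p * t - (30 * D t - 21 * w - 10 * t + p) = 0.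
Proof. by rewrite -[X in X - _]mulrA; apply/sub0/liouville_pow4. Qed.
Let r23 : - 240 * q * t3 - (10 * D t3 - 21 * w3 - 10 * t3 + q) = 0.
Proof.
have := congr1 (@fps_sub3 K) (liouville_pow4 K).
rewrite !(fps_sub3_nat, fps_sub3D, fps_sub3N, fps_sub3M) -/q -/t3 -/w3.
by move=> h; apply: sub0; rewrite -[LHS]mulrA h fps_D_sub3; ring.
Qed.
Let h1 : - 6 * (al * (9 * q - p)) - (6 * D al - 3 * be - 2 * al + (9 * q - p)) = 0.
Proof. by apply: sub0; rewrite -c1; exact: liouville_sin1. Qed.
Let h2 : 18 * (al * be) - 6 * ((9 * q - p) * (9 * q - p)) -
  (6 * (9 * D q - D p) - 3 * (81 * t3 - t) + 2 * al - 4 * (9 * q - p) - 3 * be) = 0.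
Proof.
have -> : 9 * D q - D p = D (9 * q - p) by rewrite !(fps_D_nat, fps_DB, fps_DM); ring.
by apply: sub0; rewrite -c1 -c3; exact: liouville_cos2.
Qed.
Let h3 : - 18 * (be * (9 * q - p)) - 6 * (al * (81 * t3 - t)) -
  (6 * D be - 3 * ga + 2 * al - 2 * (9 * q - p) - 6 * be + (81 * t3 - t)) = 0.
Proof. by apply: sub0; rewrite -c1 -c3; exact: liouville_sin3. Qed.
Let h4 : 18 * (al * ga) + 54 * (be * be) - 24 * ((9 * q - p) * (81 * t3 - t)) -
  (6 * (81 * D t3 - D t) - 3 * (729 * w3 - w) - 6 * al + 8 * (9 * q - p) + 12 * be -
   8 * (81 * t3 - t) - 3 * ga) = 0.
Proof.
have -> : 81 * D t3 - D t = D (81 * t3 - t) by rewrite !(fps_D_nat, fps_DB, fps_DM); ring.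
by apply: sub0; rewrite -c1 -c3 -c5; exact: liouville_cos4.
Qed.

Let aE : a = 1 + 6 * al. Proof. by []. Qed.
Let bE : B = 1 - 9 * be. Proof. by []. Qed.
Let PE : P = 1 - 24 * p. Proof. by []. Qed.
Let QE : Q = 1 + 240 * t. Proof. by []. Qed.
Let Q3E : Q3 = 1 + 240 * t3.
Proof. by rewrite /fps_E4 fps_sub3D fps_sub3M !fps_sub3_nat fps_sub3_1. Qed.
Let RE : R = 1 - 504 * w. Proof. by []. Qed.
Let Da : D a = 6 * D al.
Proof. by rewrite aE fps_DD fps_D1 fps_DM fps_D_nat; ring. Qed.
Let DB : D B = - (9 * D be).
Proof. by rewrite bE fps_DB fps_D1 fps_DM fps_D_nat; ring. Qed.
Let DQ : D Q = 240 * D t.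
Proof. by rewrite QE fps_DD fps_D1 fps_DM fps_D_nat; ring. Qed.

Lemma fps_E2_a : 3 * P3 - P = 2 * a ^+ 2.
Proof.
rewrite PE /fps_E2 fps_sub3B fps_sub3M fps_sub3_nat fps_sub3_1 -/q pE aE; ring.
Qed.

Lemma fps_D_E2 : 12 * D P = P ^+ 2 - Q.
Proof.
have -> : D P = - (24 * D p) by rewrite PE fps_DB fps_D1 fps_DM fps_D_nat; ring.
apply: (@fps_nat_eq0 1) => //.
transitivity (48 * (- 12 * p * p - (6 * D p - 5 * t - p))).
  by rewrite PE QE; ring.
by rewrite r1 mulr0.
Qed.

Lemma fps_D_E4 : 3 * D Q = P * Q - R.
Proof.
rewrite DQ; apply: (@fps_nat_eq0 1) => //.
transitivity (-24 * (- 240 * p * t - (30 * D t - 21 * w - 10 * t + p))).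
  by rewrite PE QE RE; ring.
by rewrite r2 mulr0.
Qed.

Lemma fps_D_a : 12 * D a = a * P + 3 * a ^+ 3 - 4 * B.
Proof.
rewrite Da; apply: (@fps_nat_eq0 1) => //.
transitivity (-12 * (- 6 * (al * (9 * q - p)) -
  (6 * D al - 3 * be - 2 * al + (9 * q - p)))).
  by rewrite PE aE bE pE; ring.
by rewrite h1 mulr0.
Qed.

Lemma fps_E4_b3 : Q = 9 * a ^+ 4 - 8 * a * B.
Proof.
apply: (@fps_nat_eq0 7) => //; move: r1 r13 h1 h2.
set x1 := (X in X = 0 -> _) => hx1.
set x2 := (X in X = 0 -> _) => hx2.
set x3 := (X in X = 0 -> _) => hx3.
set x4 := (X in X = 0 -> _) => hx4.
transitivity (408 * x1 - 5832 * x2 - 288 * x3 - 1728 * al * x3 + 120 * x4).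
  by rewrite /x1 /x2 /x3 /x4 Dp aE bE QE pE; ring.
by rewrite hx1 hx2 hx3 hx4; ring.
Qed.

Lemma fps_E4_sub3_b3 : 9 * Q3 = a ^+ 4 + 8 * a * B.
Proof.
apply: (@fps_nat_eq0 7) => //; move: r1 r13 h1 h2.
set x1 := (X in X = 0 -> _) => hx1.
set x2 := (X in X = 0 -> _) => hx2.
set x3 := (X in X = 0 -> _) => hx3.
set x4 := (X in X = 0 -> _) => hx4.
transitivity (72 * x1 - 2808 * x2 + 48 * x3 + 288 * al * x3 + 120 * x4).
  by rewrite /x1 /x2 /x3 /x4 Dp aE bE Q3E pE; ring.
by rewrite hx1 hx2 hx3 hx4; ring.
Qed.

Lemma fps_D_b3 : 4 * D B = (P - a ^+ 2) * B.
Proof.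
have a0 : coefs a 0 != 0.
  by rewrite coefsD coefs0M coefs_lambert_sum big_geq // mulr0 addr0 oner_eq0.
apply: (fps_mulI a0).
have dt1 : D Q - (36 * a ^+ 3 * D a - 8 * (D a * B + a * D B)) = 0.
  by rewrite fps_E4_b3 !(fps_D_nat, fps_DB, fps_DM, fps_DX) /=; ring.
have dt2 : 2160 * D t3 - (4 * a ^+ 3 * D a + 8 * (D a * B + a * D B)) = 0.
  transitivity (D (9 * Q3) - (4 * a ^+ 3 * D a + 8 * (D a * B + a * D B))).
    by rewrite Q3E !(fps_D_nat, fps_D1, fps_DD, fps_DM); ring.
  by rewrite fps_E4_sub3_b3 !(fps_D_nat, fps_DD, fps_DM, fps_DX) /=; ring.
apply: (@fps_nat_eq0 560) => //; move: r2 r23 h3 h4 (sub0 fps_E4_b3)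
  (sub0 fps_E4_sub3_b3) dt1 dt2 h1.
rewrite DQ QE Q3E.
set x1 := (X in X = 0 -> _) => hx1.
set x2 := (X in X = 0 -> _) => hx2.
set x3 := (X in X = 0 -> _) => hx3.
set x4 := (X in X = 0 -> _) => hx4.
set x5 := (X in X = 0 -> _) => hx5.
set x6 := (X in X = 0 -> _) => hx6.
set x7 := (X in X = 0 -> _) => hx7.
set x8 := (X in X = 0 -> _) => hx8.
set x9 := (X in X = 0 -> _) => hx9.
transitivity (240 * x1 - 240 * 729 * x2 - (1680 + 1680 * 6 * al) * x3 + 1680 * x4 +
  (12 - 288 * q + 41 * a ^+ 2) * x5 + (432 - 432 * 24 * q - 189 * a ^+ 2) * x6
  - 12 * x7 - 432 * x8 + (3360 - 3360 * 9 * be + 2160 * a ^+ 3) * x9).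
  rewrite /x1 /x2 /x3 /x4 /x5 /x6 /x7 /x8 /x9 Da DB PE aE bE pE.
  by ring.
by rewrite hx1 hx2 hx3 hx4 hx5 hx6 hx7 hx8 hx9; ring.
Qed.

Lemma fps_D_c3 : 4 * D C = (P + 3 * a ^+ 2) * C.
Proof.
rewrite /fps_c3 fps_DB fps_DX /=.
transitivity (a ^+ 2 * (12 * D a) - 4 * D B); first by ring.
by rewrite fps_D_a fps_D_b3; ring.
Qed.

Lemma fps_E4_c3 : Q = a * (a ^+ 3 + 8 * C).
Proof. by rewrite fps_E4_b3 /fps_c3; ring. Qed.

Lemma fps_E6_c3 : R = a ^+ 6 - 20 * a ^+ 3 * C - 8 * C ^+ 2.
Proof.
have -> : R = P * Q - 3 * D Q by rewrite fps_D_E4; ring.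
have -> : 3 * D Q = (a ^+ 3 + 2 * C) * (12 * D a) + 6 * a * (4 * D C).
  rewrite fps_E4_c3 !(fps_D_nat, fps_DD, fps_DM, fps_DX) /=; ring.
by rewrite fps_D_a fps_D_c3 fps_E4_c3 /fps_c3; ring.
Qed.

Lemma fps_D_E6 : 2 * D R = P * R - Q ^+ 2.
Proof.
have -> : 2 * D R = (a ^+ 5 - 10 * a ^+ 2 * C) * (12 * D a) -
    (10 * a ^+ 3 + 8 * C) * (4 * D C).
  by rewrite fps_E6_c3 !(fps_D_nat, fps_DB, fps_DM, fps_DX) /=; ring.
rewrite fps_D_a fps_D_c3 fps_E6_c3 fps_E4_c3.
have -> : B = a ^+ 3 - C by rewrite /fps_c3; ring.
by ring.
Qed.

End CubicRelations.

Section EulerProduct.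
Variable K : numFieldType.
Local Notation L := (@lambert_sum K).
Local Notation Lp k := (L (pow K k)).
Local Notation u := (@lambert_atom K).
Local Notation D := (@fps_D K).
Local Notation X := (@fps_X K).

Definition fps_poly (p : {poly K}) : fps K := Fps (fun j => p`_j).

Lemma fps_polyM p q : fps_poly (p * q) = fps_poly p * fps_poly q.
Proof. by apply/fpsP => j; rewrite /= coefM. Qed.
Lemma fps_poly1 : fps_poly 1 = 1.
Proof. by apply/fpsP => j; rewrite coefs1 /= coef1. Qed.
Lemma fps_poly_1BXn n : fps_poly (1 - 'X^n) = 1 - X n.
Proof. by apply/fpsP => j; rewrite coefsB coefs1 /= coefB coef1 coefXn. Qed.

Definition euler_poly N : {poly K} := \prod_(1 <= n < N) (1 - 'X^n).

Lemma euler_polyS N : (0 < N)%N -> euler_poly N.+1 = euler_poly N * (1 - 'X^N).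
Proof. by move=> N0; rewrite /euler_poly big_nat_recr. Qed.

Lemma euler_poly_stable j N M : (j < N)%N -> (N <= M)%N ->
  (euler_poly M)`_j = (euler_poly N)`_j.
Proof.
move=> jN; elim: M => [|M IH NM]; first by lia.
have [->//|NM'] : (N = M.+1 \/ N <= M)%N by lia.
rewrite euler_polyS; last by lia.
rewrite mulrBr mulr1 coefB coefMXn (_ : (j < M)%N = true) ?subr0 ?IH //; lia.
Qed.

Definition fps_euler : fps K := Fps (fun j => (euler_poly j.+1)`_j).
Local Notation Phi := fps_euler.

Lemma coefs_euler N j : (j < N)%N -> coefs Phi j = (euler_poly N)`_j.
Proof. by move=> jN; rewrite (@euler_poly_stable j j.+1 N). Qed.

Lemma fps_D_euler_poly N : D (fps_poly (euler_poly N)) =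
  - (\sum_(1 <= n < N) n%:R * u n) * fps_poly (euler_poly N).
Proof.
elim: N => [|[|N] IH]; rewrite /euler_poly.
- by rewrite !big_geq // fps_poly1 fps_D1; ring.
- by rewrite !big_geq // fps_poly1 fps_D1; ring.
rewrite -/(euler_poly _) euler_polyS // fps_polyM fps_poly_1BXn fps_DM IH.
rewrite fps_DB fps_D1 fps_D_X [in RHS]big_nat_recr //=.
have h := @lambert_atomE K N.+1 isT.
rewrite -[X N.+1 in X in _ + X = _]h; ring.
Qed.

Lemma fps_D_euler : D Phi = - Lp 1 * Phi.
Proof.
apply/fpsP => j; have /fpsP/(_ j) := fps_D_euler_poly j.+1.
rewrite !coefs_fps_D !coefsM -/(coefs _ _) => ->; apply: eq_bigr => i _.
rewrite !coefsN (@coefs_euler j.+1); last by have := ltn_ord i; lia.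
congr (- _ * _).
rewrite (@coefs_lambert_sum_widen _ j); last by rewrite -ltnS.
rewrite coefs_sum; apply: eq_bigr => n _.
by rewrite -fps_const_nat coefs_constM /pow expr1.
Qed.

Lemma coefs0_euler : coefs Phi 0 = 1.
Proof. by rewrite /= /euler_poly big_geq // coef1. Qed.

Lemma fps_ode_uniq_at k (l a b : fps K) : coefs l 0 = k%:R ->
  D a = l * a -> D b = l * b -> coefs a k = coefs b k -> a = b.
Proof.
move=> l0 da db e0; apply/fpsP; elim/ltn_ind => n IH.
have [->//|nk] := eqVneq n k.
move: da db => /fpsP/(_ n) + /fpsP/(_ n).
rewrite !coefs_fps_D !coefsM !big_ord_recl /= l0 !subn0 => da db.
have nk0 : n%:R - k%:R != 0 :> K by rewrite subr_eq0 eqr_nat.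
apply: (mulfI nk0); rewrite !mulrBl da db [LHS]addrAC [RHS]addrAC !subrr !add0r.
apply: eq_bigr => i _; rewrite IH //= /bump.
by have := ltn_ord i; lia.
Qed.

Local Notation Phi3 := (fps_sub3 Phi).
Local Notation a := (fps_a K).
Local Notation B := (fps_b3 K).
Local Notation C := (fps_c3 K).
Let p := Lp 1.
Let q := fps_sub3 (Lp 1).

Let fps_D_euler3 : D Phi3 = - 3 * q * Phi3.
Proof. by rewrite fps_D_sub3 fps_D_euler fps_sub3M fps_sub3N -/q; ring. Qed.

Let Pp : fps_E2 K = 1 - 24 * p. Proof. by []. Qed.
Let a2pq : 2 * fps_a K ^+ 2 = 2 - 72 * q + 24 * p.
Proof.
rewrite -fps_E2_a Pp fps_sub3B fps_sub3_1 fps_sub3M fps_sub3_nat -/q; ring.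
Qed.

Lemma coefs0_lambert_sum (g : nat -> K) : coefs (L g) 0 = 0.
Proof. by rewrite coefs_lambert_sum big_geq. Qed.

Lemma coefs_natM n (x : fps K) j : coefs (n%:R * x) j = n%:R * coefs x j.
Proof. by rewrite -fps_const_nat coefs_constM. Qed.

Lemma coefs0_sub3 (x : fps K) : coefs (fps_sub3 x) 0 = coefs x 0.
Proof. by []. Qed.

Lemma coefs0_a : coefs a 0 = 1.
Proof. by rewrite coefsD coefs_natM coefs0_lambert_sum coefs1 mulr0 addr0. Qed.
Lemma coefs0_b3 : coefs B 0 = 1.
Proof. by rewrite coefsB coefs_natM coefs0_lambert_sum coefs1 mulr0 subr0. Qed.
Lemma coefs0_c3 : coefs C 0 = 0.
Proof. by rewrite coefsB coefs0X coefs0_a coefs0_b3 expr1n subrr. Qed.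

Lemma coefs1_lambert_sum (g : nat -> K) : coefs (L g) 1 = g 1%N.
Proof. by rewrite coefs_lambert_sum big_nat1 coefs_lambert_atom mulr1. Qed.

Lemma coefs1M (x y : fps K) :
  coefs (x * y) 1 = coefs x 0 * coefs y 1 + coefs x 1 * coefs y 0.
Proof. by rewrite coefsM big_ord_recl big_ord1. Qed.

Lemma coefs1_c3 : coefs C 1 = 27.
Proof.
have s1 : sin3 K 1 = 1 by rewrite sin3S cos3_0 sin3_0; field.
have a1 : coefs a 1 = 6.
  by rewrite coefsD coefs_natM coefs1_lambert_sum coefs1 /pows /pow s1 /=; ring.
rewrite coefsB coefsB coefs_natM coefs1_lambert_sum coefs1 /pows /pow s1.
rewrite !exprS expr0 !(coefs1M, coefs0M) !coefs0_a a1 !coefs1 /=; ring.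
Qed.

Lemma fps_b3_euler : B * Phi3 ^+ 3 = Phi ^+ 9.
Proof.
have DB : D B = - 9 * (p - q) * B.
  apply: (@fps_natI K 8) => //.
  transitivity (2 * (4 * D B)); first by ring.
  rewrite fps_D_b3; transitivity ((2 * fps_E2 K - 2 * a ^+ 2) * B); first by ring.
  by rewrite a2pq Pp; ring.
apply: (@fps_ode_uniq_at 0 (- 9 * p)).
- by rewrite coefs0M coefs0_lambert_sum mulr0.
- by rewrite fps_DM fps_DX DB fps_D_euler3 /=; ring.
- by rewrite fps_DX fps_D_euler -/p /= (exprS _ 8); ring.
- by rewrite coefs0M !coefs0X coefs0_sub3 coefs0_euler coefs0_b3 !expr1n mulr1.
Qed.

Lemma fps_c3_euler : C * Phi ^+ 3 = 27 * X 1 * Phi3 ^+ 9.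
Proof.
have DC : D C = (1 + 3 * p - 27 * q) * C.
  apply: (@fps_natI K 8) => //.
  transitivity (2 * (4 * D C)); first by ring.
  rewrite fps_D_c3; transitivity ((2 * fps_E2 K + 3 * (2 * a ^+ 2)) * C); first by ring.
  by rewrite a2pq Pp; ring.
have l0 : coefs (1 - 27 * q) 0 = 1.
  by rewrite coefsB coefs_natM coefs0_sub3 coefs0_lambert_sum mulr0 subr0 coefs1.
apply: (@fps_ode_uniq_at 1 (1 - 27 * q)) => //.
- by rewrite fps_DM fps_DX DC fps_D_euler -/p /= (exprS _ 2); ring.
- rewrite fps_DM [D (27 * _)]fps_DM fps_DX fps_D_nat fps_D_X fps_D_euler3 /= (exprS _ 8); ring.
- rewrite coefs1M coefs0_c3 mul0r add0r coefs1_c3 coefs0X coefs0_euler.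
  rewrite coefs1M !coefs_natM !coefs0X coefs0_sub3 coefs0_euler.
  by rewrite (_ : coefs (X 1) 0 = 0) // (_ : coefs (X 1) 1 = 1) // !expr1n; ring.
Qed.
End EulerProduct.

(** * Power series on the unit disc *)

Section Modulus.
Variable R : realType.
Local Notation C := R[i].
Implicit Types (x y z w h l : C).

Definition cabs (z : C) : R := Normc.normc z.

Lemma normr_cabs z : `|z| = (cabs z)%:C. Proof. by []. Qed.

Lemma cabs_ge0 z : 0 <= cabs z.
Proof. by case: z => a b; exact: sqrtr_ge0. Qed.
Lemma cabsM z w : cabs (z * w) = cabs z * cabs w.
Proof. exact: Normc.normcM. Qed.
Lemma cabsD_le z w : cabs (z + w) <= cabs z + cabs w.
Proof. exact: le_normcD. Qed.
Lemma cabsN z : cabs (- z) = cabs z.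
Proof. exact: normcN. Qed.
Lemma cabs0 : cabs 0 = 0. Proof. exact: Normc.normc0. Qed.
Lemma cabs1 : cabs 1 = 1. Proof. exact: Normc.normc1. Qed.
Lemma cabsV z : cabs z^-1 = (cabs z)^-1. Proof. exact: Normc.normcV. Qed.
Lemma cabsf z w : cabs (z / w) = cabs z / cabs w.
Proof. by rewrite cabsM cabsV. Qed.
Lemma cabsX z n : cabs (z ^+ n) = cabs z ^+ n.
Proof. by elim: n => [|n IH]; rewrite ?cabs1 // !exprS cabsM IH. Qed.
Lemma cabs_eq0 z : (cabs z == 0) = (z == 0).
Proof. by apply/eqP/eqP => [/Normc.eq0_normc//|->]; rewrite cabs0. Qed.
Lemma cabs_gt0 z : (0 < cabs z) = (z != 0).
Proof. by rewrite lt_neqAle cabs_ge0 andbT eq_sym cabs_eq0. Qed.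
Lemma cabs_real (a : R) : cabs a%:C = `|a|.
Proof. by rewrite /cabs /= expr0n addr0 sqrtr_sqr. Qed.
Lemma cabs_nat n : cabs n%:R = n%:R.
Proof. by rewrite -[n%:R](rmorph_nat (real_complex R)) cabs_real ger0_norm. Qed.
Lemma cabsB_sym z w : cabs (z - w) = cabs (w - z).
Proof. by rewrite -opprB cabsN. Qed.
Lemma cabs_dist_le z w x : cabs (z - w) <= cabs (z - x) + cabs (x - w).
Proof. by rewrite (_ : z - w = (z - x) + (x - w)) ?cabsD_le //; ring. Qed.
Lemma cabsB_ge z w : cabs z - cabs w <= cabs (z - w).
Proof. by rewrite lerBlDr -{1}(subrK w z) cabsD_le. Qed.
Lemma cabs_Re z : `|complex.Re z| <= cabs z.
Proof.
case: z => a b; rewrite /cabs /= -sqrtr_sqr ler_sqrt.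
  by rewrite lerDl sqr_ge0.
by rewrite addr_ge0 // sqr_ge0.
Qed.
Lemma cabs_Im z : `|complex.Im z| <= cabs z.
Proof.
case: z => a b; rewrite /cabs /= -sqrtr_sqr ler_sqrt.
  by rewrite lerDr sqr_ge0.
by rewrite addr_ge0 // sqr_ge0.
Qed.
Lemma cabs_le_ReIm z : cabs z <= `|complex.Re z| + `|complex.Im z|.
Proof.
rewrite {1}(complexE z) (le_trans (cabsD_le _ _)) //.
rewrite cabsM !cabs_real (_ : cabs 'i = 1) ?mul1r //.
by rewrite /cabs /= expr0n expr1n add0r sqrtr1.
Qed.
Lemma cabs_sum (F : nat -> C) (m n : nat) :
  cabs (\sum_(m <= k < n) F k) <= \sum_(m <= k < n) cabs (F k).
Proof.
elim/big_rec2: _ => [|i x y _ IH]; first by rewrite cabs0.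
by rewrite (le_trans (cabsD_le _ _)) // lerD2l.
Qed.

End Modulus.

Section Limits.
Variable R : realType.
Local Notation C := R[i].
Implicit Types (u v : nat -> C) (l : C).

Definition clim u l := forall e : R, 0 < e ->
  exists N, forall n, (N <= n)%N -> cabs (u n - l) < e.

Lemma hausdorff_C : hausdorff_space (C^o : topologicalType).
Proof. exact: (@norm_hausdorff C C^o). Qed.

Lemma clim_cvg u l : clim u l -> (u : nat -> C^o) @ \oo --> (l : C^o).
Proof.
move=> ul; apply/cvgrPdist_lt => e e0.
have [e' e'0 ->] : exists2 e' : R, 0 < e' & e = e'%:C.
  by case: e e0 => a b; rewrite ltcE /= => /andP[/eqP -> a0]; exists a.
have [N hN] := ul _ e'0; exists N => // n /= Nn.
by rewrite distrC normr_cabs ltcR hN.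
Qed.

Lemma clim_climn u l : clim u l -> climn u = l.
Proof. by move=> /clim_cvg; apply: cvg_lim; exact: hausdorff_C. Qed.

Lemma clim_uniq u l l' : clim u l -> clim u l' -> l = l'.
Proof. by move=> /clim_climn <- /clim_climn <-. Qed.

Lemma clim_ext u v l : u =1 v -> clim u l -> clim v l.
Proof. by move=> uv; rewrite (funext uv). Qed.

Lemma clim_cst l : clim (fun=> l) l.
Proof. by move=> e e0; exists 0%N => n _; rewrite subrr cabs0. Qed.

Lemma climD u v l l' : clim u l -> clim v l' -> clim (fun n => u n + v n) (l + l').
Proof.
move=> ul vl e e0; have e20 : 0 < e / 2 by rewrite divr_gt0.
have [N hN] := ul _ e20; have [M hM] := vl _ e20.
exists (maxn N M) => n; rewrite geq_max => /andP[/hN h1 /hM h2].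
rewrite opprD addrACA (le_lt_trans (cabsD_le _ _)) //; lra.
Qed.

Lemma climZ (a : C) u l : clim u l -> clim (fun n => a * u n) (a * l).
Proof.
move=> ul e e0; have a0 : 0 < cabs a + 1 by rewrite ltr_wpDl // cabs_ge0.
have [N hN] := ul _ (divr_gt0 e0 a0); exists N => n /hN h.
rewrite -mulrBr cabsM; have := cabs_ge0 (u n - l).
move: h; rewrite ltr_pdivlMr // => h h'; nra.
Qed.

Lemma climN u l : clim u l -> clim (fun n => - u n) (- l).
Proof. by move=> /(climZ (-1)); rewrite mulN1r; apply: clim_ext => n; rewrite mulN1r. Qed.

Lemma climB u v l l' : clim u l -> clim v l' -> clim (fun n => u n - v n) (l - l').
Proof. by move=> ul /climN; exact: climD. Qed.

Lemma clim_bounded u l : clim u l -> exists2 B : R, 0 <= B & exists N,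
  forall n, (N <= n)%N -> cabs (u n) <= B.
Proof.
move=> /(_ 1 ltr01)[N hN]; exists (cabs l + 1).
  by rewrite addr_ge0 ?cabs_ge0.
exists N => n /hN h; have := cabsB_ge (u n) l; lra.
Qed.

Lemma clim0 u : (forall e : R, 0 < e ->
  exists N, forall n, (N <= n)%N -> cabs (u n) < e) -> clim u 0.
Proof. by move=> h e /h[N hN]; exists N => n /hN; rewrite subr0. Qed.

Lemma climM u v l l' : clim u l -> clim v l' -> clim (fun n => u n * v n) (l * l').
Proof.
move=> ul vl; have [B B0 [N hN]] := clim_bounded ul.
have uv0 : clim (fun n => u n * (v n - l')) 0.
  apply: clim0 => e e0; have B10 : 0 < B + 1 by lra.
  have [M hM] := vl _ (divr_gt0 e0 B10).
  exists (maxn N M) => n; rewrite geq_max => /andP[/hN h1 /hM h2].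
  rewrite cabsM; have := cabs_ge0 (v n - l'); have := cabs_ge0 (u n).
  by move: h2; rewrite ltr_pdivlMr // => h2 h3 h4; nra.
have := climD uv0 (climZ l' ul); rewrite add0r mulrC; apply: clim_ext => n; ring.
Qed.

Lemma clim_le u l (B : R) : clim u l -> (forall n, cabs (u n) <= B) -> cabs l <= B.
Proof.
move=> ul uB; apply/ler_addgt0Pr => e e0; have [N hN] := ul _ e0.
have := hN N (leqnn N); rewrite cabsB_sym => h.
have := cabsB_ge l (u N); have := uB N; lra.
Qed.

Lemma clim_shift u l k : clim u l -> clim (fun n => u (n + k)%N) l.
Proof.
move=> ul e /ul[N hN]; exists N => n Nn; apply: hN; lia.
Qed.

Lemma rexpr_lt (t e : R) : 0 <= t < 1 -> 0 < e ->
  exists N, forall n, (N <= n)%N -> t ^+ n < e.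
Proof.
move=> /andP[t0 t1] e0; have : `|t| < 1 by rewrite ger0_norm.
move=> /cvg_expr/cvgrPdist_lt/(_ _ e0)[N _ hN]; exists N => n /hN /=.
by rewrite sub0r normrN ger0_norm // exprn_ge0.
Qed.

Lemma clim_geo u l (M t : R) : 0 <= t < 1 ->
  (forall n, cabs (u n - l) <= M * t ^+ n) -> clim u l.
Proof.
move=> t01 h e e0.
have M10 : 0 < `|M| + 1 by rewrite ltr_wpDl.
have [N hN] := rexpr_lt t01 (divr_gt0 e0 M10); exists N => n /hN ht.
rewrite (le_lt_trans (h n)) //.
have : 0 <= t ^+ n by case/andP: t01 => t0 _; rewrite exprn_ge0.
move: ht; rewrite ltr_pdivlMr // => ht tn.
by have := ler_norm M; nra.
Qed.

Lemma natr_expr_bounded (t : R) : 0 <= t < 1 ->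
  exists2 M : R, 0 <= M & forall n, n%:R * t ^+ n <= M.
Proof.
move=> /andP[t0 t1]; exists ((1 - t)^-1); first by rewrite invr_ge0 subr_ge0 ltW.
have t10 : 0 < 1 - t by rewrite subr_gt0.
move=> n; rewrite -[leRHS]mul1r ler_pdivlMr //.
suff : n%:R * t ^+ n * (1 - t) <= 1 - t ^+ n.
  by have : 0 <= t ^+ n by [rewrite exprn_ge0]; lra.
elim: n => [|n IH]; first by rewrite !mul0r expr0 subrr.
have tn0 : 0 <= t ^+ n by rewrite exprn_ge0.
have : n%:R * t ^+ n * (1 - t) * t <= (1 - t ^+ n) * t by rewrite ler_wpM2r.
have tn1 : t * t ^+ n <= 1 by rewrite -exprS exprn_ile1 // ltW.
have : t * t ^+ n * (1 - t) <= 1 * (1 - t) by rewrite ler_wpM2r // ltW.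
rewrite exprS -natr1; lra.
Qed.

Lemma geo_sum_le (t : R) m n : 0 <= t < 1 ->
  \sum_(m <= k < n) t ^+ k <= t ^+ m / (1 - t).
Proof.
move=> /andP[t0 t1]; have t10 : 0 < 1 - t by rewrite subr_gt0.
rewrite ler_pdivlMr //; have [nm|mn] := leqP n m.
  by rewrite big_geq // mul0r exprn_ge0.
suff -> : (\sum_(m <= k < n) t ^+ k) * (1 - t) = t ^+ m - t ^+ n.
  by rewrite gerBl exprn_ge0.
have -> : (\sum_(m <= k < n) t ^+ k) * (1 - t) =
    - (\sum_(m <= k < n) (t ^+ k.+1 - t ^+ k)).
  rewrite mulr_suml -sumrN; apply: eq_bigr => k _; rewrite exprS; ring.
by rewrite telescope_sumr 1?ltnW // opprB.
Qed.

Lemma geo_series_clim (a : nat -> C) (M t : R) : 0 <= t < 1 -> 0 <= M ->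
  (forall n, cabs (a n) <= M * t ^+ n) ->
  exists2 l, clim (fun N => \sum_(0 <= k < N) a k) l &
    forall N, cabs (l - \sum_(0 <= k < N) a k) <= M / (1 - t) * t ^+ N.
Proof.
move=> t01 M0 ha; have /andP[t0 t1] := t01.
have tail m n : cabs (\sum_(m <= k < n) a k) <= M / (1 - t) * t ^+ m.
  rewrite (le_trans (cabs_sum _ _ _)) //.
  rewrite (@le_trans _ _ (\sum_(m <= k < n) M * t ^+ k)) ?ler_sum //.
  rewrite -mulr_sumr mulrAC -mulrA ler_wpM2l //.
  exact: geo_sum_le.
have cv (f : C -> R) : (forall z, `|f z| <= cabs z) ->
    cvgn (series (fun n => f (a n))).
  move=> fle; apply: normed_cvg.
  apply: (@series_le_cvg _ _ (geometric M t)) => //.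
  - by move=> n /=.
  - by move=> n; rewrite /geometric /= mulr_ge0 // exprn_ge0.
  - by move=> n; rewrite /= (le_trans (fle _)) //.
  - by apply: is_cvg_geometric_series; rewrite ger0_norm.
have cvR := cv _ (@cabs_Re R); have cvI := cv _ (@cabs_Im R).
set lr := limn (series (fun n => complex.Re (a n))) in cvR.
set li := limn (series (fun n => complex.Im (a n))) in cvI.
have ReS N : complex.Re (\sum_(0 <= k < N) a k) = series (fun n => complex.Re (a n)) N.
  by rewrite /series /= (big_morph (@complex.Re R) (id1 := 0) (op1 := +%R)) // => -[? ?] [].
have ImS N : complex.Im (\sum_(0 <= k < N) a k) = series (fun n => complex.Im (a n)) N.
  by rewrite /series /= (big_morph (@complex.Im R) (id1 := 0) (op1 := +%R)) // => -[? ?] [].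
have lim : clim (fun N => \sum_(0 <= k < N) a k) (lr +i* li).
  move=> e e0; have e20 : 0 < e / 2 by rewrite divr_gt0.
  have /cvgrPdist_lt/(_ _ e20)[N _ hN] := cvR.
  have /cvgrPdist_lt/(_ _ e20)[N' _ hN'] := cvI.
  exists (maxn N N') => n; rewrite geq_max => /andP[/hN h1 /hN' h2].
  rewrite (le_lt_trans (cabs_le_ReIm _)) //.
  have -> z w : complex.Re (z - w) = complex.Re z - complex.Re w :> R by case: z w => [? ?] [].
  have -> z w : complex.Im (z - w) = complex.Im z - complex.Im w :> R by case: z w => [? ?] [].
  rewrite ReS ImS /= distrC [X in _ + X]distrC.
  move: h1 h2; rewrite /= => h1 h2; lra.
exists (lr +i* li) => // N.
have := clim_shift N (climB lim (clim_cst (\sum_(0 <= k < N) a k))).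
move=> /clim_le; apply => n.
have -> : \sum_(0 <= k < n + N) a k - \sum_(0 <= k < N) a k = \sum_(N <= k < n + N) a k.
  by rewrite (big_cat_nat (n := N)) ?leq_addl // addrC addKr.
exact: tail.
Qed.

End Limits.

Section Tame.
Variable R : realType.
Local Notation C := R[i].
Local Notation D := (@fps_D R).
Implicit Types (a b c : fps R).

(* The power series converges absolutely on the open unit disc. *)
Definition tame c := forall r : R, 0 <= r < 1 ->
  exists2 M : R, 0 <= M & forall n, `|coefs c n| * r ^+ n <= M.

Lemma tame_dom a b : (forall n, `|coefs a n| <= `|coefs b n|) -> tame b -> tame a.
Proof.
move=> ab tb r /[dup] /andP[r0 _] /tb[M M0 hM]; exists M => // n.
by rewrite (le_trans _ (hM n)) // ler_wpM2r // exprn_ge0.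
Qed.

Lemma tame_bounded c (M : R) : (forall n, `|coefs c n| <= M) -> tame c.
Proof.
move=> hM r /andP[r0 r1]; exists M; first exact: le_trans (hM 0%N).
move=> n; rewrite -[leRHS]mulr1 ler_pM // ?exprn_ge0 ?exprn_ile1 //; exact: ltW.
Qed.

Lemma tame_const (k : R) : tame (fps_const k).
Proof. by apply: (@tame_bounded _ `|k|) => -[|n] /=; rewrite ?normr0. Qed.
Lemma tame1 : tame 1. Proof. exact: tame_const. Qed.
Lemma tame_nat n : tame n%:R.
Proof. by rewrite -fps_const_nat; exact: tame_const. Qed.

Lemma tame_X n : tame (fps_X R n).
Proof.
by apply: (@tame_bounded _ 1) => m /=; case: eqP; rewrite ?normr1 ?normr0.
Qed.

Lemma tameD a b : tame a -> tame b -> tame (a + b).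
Proof.
move=> ta tb r r01; have /andP[r0 r1] := r01.
have [M M0 hM] := ta r r01; have [N N0 hN] := tb r r01.
exists (M + N); first exact: addr_ge0.
move=> n; rewrite coefsD (le_trans _ (lerD (hM n) (hN n))) // -mulrDl.
by rewrite ler_wpM2r ?exprn_ge0 // ler_normD.
Qed.

Lemma tameN a : tame a -> tame (- a).
Proof. by apply: tame_dom => n; rewrite coefsN normrN. Qed.

Lemma tameB a b : tame a -> tame b -> tame (a - b).
Proof. by move=> ta /tameN; exact: tameD. Qed.

Lemma mid_radius (r : R) : 0 <= r < 1 -> exists rho t : R,
  [/\ 0 < rho, r < rho, rho < 1, 0 <= t < 1 & r = rho * t].
Proof.
move=> /andP[r0 r1]; exists ((r + 1) / 2), (r / ((r + 1) / 2)).
have h : 0 < (r + 1) / 2 by lra.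
split; [by []|lra|lra| |by rewrite mulrC divfK // gt_eqF].
by apply/andP; split; [apply: divr_ge0 => //; exact: ltW|rewrite ltr_pdivrMr // mul1r; lra].
Qed.

Lemma tame_D a : tame a -> tame (D a).
Proof.
move=> ta r /mid_radius[rho [t [rho0 _ rho1 t01 ->]]].
have [|M M0 hM] := ta rho; first by rewrite (ltW rho0).
have [N N0 hN] := natr_expr_bounded t01.
exists (M * N) => [|n]; first exact: mulr_ge0.
rewrite coefs_fps_D normrM normr_nat exprMn.
rewrite (_ : _ * _ = (`|coefs a n| * rho ^+ n) * (n%:R * t ^+ n)); last by ring.
have /andP[t0 _] := t01.
by rewrite ler_pM // ?mulr_ge0 // ?exprn_ge0 // ltW.
Qed.

Lemma tameM a b : tame a -> tame b -> tame (a * b).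
Proof.
move=> ta tb r /mid_radius[rho [t [rho0 _ rho1 t01 ->]]].
have rho01 : 0 <= rho < 1 by rewrite (ltW rho0).
have [M M0 hM] := ta rho rho01; have [N N0 hN] := tb rho rho01.
have [B B0 hB] := natr_expr_bounded t01.
exists (M * N * (B + 1)) => [|n]; first by rewrite mulr_ge0 ?mulr_ge0 ?addr_ge0.
have /andP[t0 t1] := t01.
have h : `|coefs (a * b) n| * rho ^+ n <= n.+1%:R * (M * N).
  rewrite coefsM (le_trans (ler_wpM2r _ (ler_norm_sum _ _ _))) //.
    by rewrite exprn_ge0 // ltW.
  rewrite mulr_suml (le_trans (ler_sum _ (G := fun=> M * N) _)) //.
    move=> i _; rewrite normrM.
    have -> : rho ^+ n = rho ^+ i * rho ^+ (n - i).
      by rewrite -exprD subnKC // -ltnS.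
    rewrite mulrACA ler_pM // mulr_ge0 // exprn_ge0 // ltW //.
  by rewrite sumr_const card_ord mulr_natl.
rewrite exprMn mulrA; have tn0 : 0 <= t ^+ n by rewrite exprn_ge0.
rewrite (le_trans (ler_wpM2r tn0 h)) //.
rewrite mulrAC mulrC ler_wpM2l ?mulr_ge0 // -natr1 mulrDl mul1r lerD //.
by rewrite exprn_ile1 // ltW.
Qed.

Lemma tameX a n : tame a -> tame (a ^+ n).
Proof. by move=> ta; elim: n => [|n IH]; [exact: tame1|rewrite exprS; exact: tameM]. Qed.

Lemma tame_sub3 a : tame a -> tame (fps_sub3 a).
Proof.
move=> ta r /andP[r0 r1]; have [|M M0 hM] := ta (r ^+ 3).
  by rewrite exprn_ge0 // exprn_ilt1.
exists M => // n; rewrite coefs_sub3; case: ifP => [/dvdnP[m ->]|_].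
  by rewrite mulnK // mulnC exprM.
by rewrite normr0 mul0r.
Qed.

Lemma tame_natpow k : tame (Fps (fun n => n%:R ^+ k)).
Proof.
elim: k => [|k IH].
  by apply: (@tame_bounded _ 1) => n; rewrite /= expr0 normr1.
apply: (tame_dom _ (tame_D IH)) => n /=; by rewrite exprS.
Qed.

Lemma tame_lambert (g : nat -> R) (M : R) k :
  (forall n, `|g n| <= M * n%:R ^+ k) -> tame (lambert_sum g).
Proof.
move=> gM; have M0 : 0 <= M by have := le_trans (normr_ge0 _) (gM 1%N); rewrite expr1n mulr1.
apply: (@tame_dom _ (fps_const M * Fps (fun n => n%:R ^+ k.+1))); last first.
  by apply: tameM; [exact: tame_const|exact: tame_natpow].
move=> n; rewrite coefs_constM (_ : coefs (Fps (fun n => n%:R ^+ k.+1)) n = n%:R ^+ k.+1) //.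
rewrite [leRHS]ger0_norm ?mulr_ge0 ?exprn_ge0 //.
rewrite coefs_lambert_sum big_add1 /= big_mkord (le_trans (ler_norm_sum _ _ _)) //.
rewrite (le_trans (ler_sum _ (G := fun=> M * n%:R ^+ k) _)) //.
  move=> i _; rewrite normrM.
  have h : `|coefs (lambert_atom R i.+1) n| <= 1.
    by rewrite coefs_lambert_atom; case: (_ && _); rewrite ?normr1 ?normr0.
  rewrite (le_trans (ler_pM _ _ (gM _) h)) // mulr1 ler_wpM2l //.
  by rewrite lerXn2r ?nnegrE // ler_nat ltn_ord.
by rewrite sumr_const card_ord -[leLHS]mulr_natl exprS mulrCA.
Qed.

End Tame.

Section Eval.
Variable R : realType.
Local Notation C := R[i].
Local Notation D := (@fps_D R).
Implicit Types (a b c : fps R) (z w : C).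

Definition psums c z (N : nat) : C := \sum_(0 <= k < N) (coefs c k)%:C * z ^+ k.

Definition ev c z : C := climn (psums c z).

Lemma ev_tail c (r : R) : tame c -> 0 <= r < 1 -> exists M t : R,
  [/\ 0 <= M, 0 <= t < 1 & forall z, cabs z <= r ->
    clim (psums c z) (ev c z) /\
    forall N, cabs (ev c z - psums c z N) <= M * t ^+ N].
Proof.
move=> tc /mid_radius[rho [t [rho0 _ rho1 t01 rE]]].
have [|M M0 hM] := tc rho; first by rewrite (ltW rho0).
have /andP[t0 t1] := t01.
exists (M / (1 - t)), t; split=> //; first by rewrite divr_ge0 // subr_ge0 ltW.
move=> z zr; have [n|l lim tl] := @geo_series_clim R (fun k => (coefs c k)%:C * z ^+ k) M t t01 M0.
  rewrite cabsM cabs_real cabsX (le_trans (_ : _ <= `|coefs c n| * (rho * t) ^+ n)) //.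
    by rewrite ler_wpM2l // lerXn2r ?nnegrE ?cabs_ge0 // -rE // (le_trans (cabs_ge0 z)).
  have /andP[t0' _] := t01.
  by rewrite exprMn mulrA ler_wpM2r // exprn_ge0.
have -> : ev c z = l by exact: clim_climn.
by split.
Qed.

Lemma ev_clim c z : tame c -> cabs z < 1 -> clim (psums c z) (ev c z).
Proof.
move=> tc z1; have [|M [t [_ _ h]]] := @ev_tail c (cabs z) tc.
  by rewrite cabs_ge0.
by have [] := h z (lexx _).
Qed.

Lemma ev_eq c z l : clim (psums c z) l -> ev c z = l.
Proof. exact: clim_climn. Qed.

Lemma psums_D a b z N : psums (a + b) z N = psums a z N + psums b z N.
Proof.
by rewrite /psums -big_split; apply: eq_bigr => k _ /=; rewrite rmorphD mulrDl.
Qed.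
Lemma psums_N a z N : psums (- a) z N = - psums a z N.
Proof.
by rewrite /psums -sumrN; apply: eq_bigr => k _ /=; rewrite rmorphN mulNr.
Qed.

Lemma evD a b z : tame a -> tame b -> cabs z < 1 -> ev (a + b) z = ev a z + ev b z.
Proof.
move=> ta tb z1; apply: ev_eq.
by apply: (clim_ext _ (climD (ev_clim ta z1) (ev_clim tb z1))) => n; rewrite psums_D.
Qed.
Lemma evN a z : tame a -> cabs z < 1 -> ev (- a) z = - ev a z.
Proof.
move=> ta z1; apply: ev_eq.
by apply: (clim_ext _ (climN (ev_clim ta z1))) => n; rewrite psums_N.
Qed.
Lemma evB a b z : tame a -> tame b -> cabs z < 1 -> ev (a - b) z = ev a z - ev b z.
Proof. by move=> ta tb z1; rewrite evD ?evN //; exact: tameN. Qed.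

Lemma psums_finite a z n N : (forall k, (n <= k)%N -> coefs a k = 0) -> (n <= N)%N ->
  psums a z N = psums a z n.
Proof.
move=> a0 nN; rewrite /psums (big_cat_nat (n := n)) //=.
rewrite [X in _ + X]big_nat_cond [X in _ + X]big1 ?addr0 // => k /andP[/andP[nk _] _].
by rewrite a0 // rmorph0 mul0r.
Qed.

Lemma ev_finite a z n : (forall k, (n <= k)%N -> coefs a k = 0) ->
  ev a z = psums a z n.
Proof.
move=> a0; apply: ev_eq => e e0; exists n => N nN.
by rewrite (psums_finite _ a0 nN) subrr cabs0.
Qed.

Lemma ev_const (k : R) z : ev (fps_const k) z = k%:C.
Proof.
rewrite (@ev_finite _ _ 1); last by case.
by rewrite /psums big_nat1 expr0 mulr1.
Qed.
Lemma ev1 z : ev 1 z = 1. Proof. exact: ev_const. Qed.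
Lemma ev_nat n z : ev n%:R z = n%:R.
Proof. by rewrite -fps_const_nat ev_const rmorph_nat. Qed.

Lemma ev_X n z : ev (fps_X R n) z = z ^+ n.
Proof.
rewrite (@ev_finite _ _ n.+1) => [|k nk]; last first.
  by rewrite /=; case: eqP => // e; rewrite e ltnn in nk.
rewrite /psums big_nat_recr //= eqxx mul1r big_nat_cond big1 ?add0r //.
by move=> k /andP[/andP[_ kn] _]; rewrite (ltn_eqF kn) rmorph0 mul0r.
Qed.

Lemma ev_at0 c : ev c 0 = (coefs c 0)%:C.
Proof.
apply: ev_eq => e e0; exists 1%N => -[//|n] _.
rewrite /psums big_nat_recl // expr0 mulr1 big1 ?addr0 ?subrr ?cabs0 // => k _.
by rewrite exprS mul0r mulr0.
Qed.

Lemma cauchy_diff (x y : nat -> C) N :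
  (\sum_(0 <= i < N) x i) * (\sum_(0 <= j < N) y j) -
  \sum_(0 <= k < N) \sum_(i < k.+1) x i * y (k - i)%N =
  \sum_(0 <= i < N) \sum_(N - i <= j < N) x i * y j.
Proof.
have -> : \sum_(0 <= k < N) \sum_(i < k.+1) x i * y (k - i)%N =
    \sum_(0 <= i < N) \sum_(0 <= j < N - i) x i * y j.
  elim: N => [|N IH]; first by rewrite !big_geq.
  rewrite big_nat_recr //= IH [in RHS]big_nat_recr //= subSnn big_nat1.
  rewrite big_ord_recr /= subnn addrA; congr (_ + _).
  rewrite -(big_mkord xpredT (fun i => x i * y (N - i)%N)) -big_split.
  apply: eq_big_nat => i /andP[_ iN]; rewrite subSn; last exact: ltnW.
  by rewrite big_nat_recr.
rewrite mulr_suml -sumrB; apply: eq_big_nat => i /andP[_ iN].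
rewrite mulr_sumr (big_cat_nat (n := N - i)) //= ?leq_subr //.
by rewrite addrC addrK.
Qed.

Lemma evM a b z : tame a -> tame b -> cabs z < 1 -> ev (a * b) z = ev a z * ev b z.
Proof.
move=> ta tb z1; apply: ev_eq.
have /mid_radius[rho [t [rho0 _ rho1 t01 zE]]] : 0 <= cabs z < 1 by rewrite cabs_ge0.
have rho01 : 0 <= rho < 1 by rewrite (ltW rho0).
have [M M0 hM] := ta rho rho01; have [M' M'0 hM'] := tb rho rho01.
have /andP[t0 t1] := t01.
have ha i : cabs ((coefs a i)%:C * z ^+ i) <= M * t ^+ i.
  by rewrite cabsM cabs_real cabsX zE exprMn mulrA ler_wpM2r ?exprn_ge0.
have hb i : cabs ((coefs b i)%:C * z ^+ i) <= M' * t ^+ i.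
  by rewrite cabsM cabs_real cabsX zE exprMn mulrA ler_wpM2r ?exprn_ge0.
have diff0 : clim (fun N => psums a z N * psums b z N - psums (a * b) z N) 0.
  have /mid_radius[s [s' [s0 _ s1 s'01 tE]]] := t01.
  have s01 : 0 <= s < 1 by rewrite (ltW s0).
  have [B B0 hB] := natr_expr_bounded s01.
  apply: (@clim_geo _ _ _ (M * M' / (1 - t) * B) s') => // N; rewrite subr0.
  have -> : psums (a * b) z N = \sum_(0 <= k < N) \sum_(i < k.+1)
      ((coefs a i)%:C * z ^+ i) * ((coefs b (k - i)%N)%:C * z ^+ (k - i)).
    apply: eq_bigr => k _; rewrite coefsM rmorph_sum mulr_suml.
    apply: eq_bigr => i _; rewrite rmorphM mulrACA -exprD subnKC // -ltnS.
    exact: ltn_ord.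
  rewrite cauchy_diff (le_trans (cabs_sum _ _ _)) //.
  rewrite (@le_trans _ _ (\sum_(0 <= i < N) M * M' / (1 - t) * t ^+ N)) //.
    apply: ler_sum_nat => i /andP[_ iN].
    rewrite -mulr_sumr cabsM (le_trans (ler_pM (cabs_ge0 _) (cabs_ge0 _) (ha i)
      (_ : _ <= M' * (t ^+ (N - i) / (1 - t))))) //.
      rewrite (le_trans (cabs_sum _ _ _)) //.
      rewrite (@le_trans _ _ (\sum_(N - i <= k < N) M' * t ^+ k)) ?ler_sum //.
      by rewrite -mulr_sumr ler_wpM2l // geo_sum_le.
    rewrite (_ : M * t ^+ i * (M' * (t ^+ (N - i) / (1 - t))) =
      M * M' / (1 - t) * (t ^+ i * t ^+ (N - i))); last by ring.
    by rewrite -exprD subnKC // ltnW.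
  rewrite sumr_const_nat subn0 -mulr_natl {2}tE exprMn.
  rewrite (_ : N%:R * (M * M' / (1 - t) * (s ^+ N * s' ^+ N)) =
    M * M' / (1 - t) * (N%:R * s ^+ N) * s' ^+ N); last by ring.
  have /andP[s'0 _] := s'01.
  rewrite ler_wpM2r ?exprn_ge0 // ler_wpM2l //.
  by rewrite divr_ge0 ?mulr_ge0 // subr_ge0 ltW.
have := climB (climM (ev_clim ta z1) (ev_clim tb z1)) diff0.
by rewrite subr0; apply: clim_ext => n; ring.
Qed.

Lemma evX a z n : tame a -> cabs z < 1 -> ev (a ^+ n) z = ev a z ^+ n.
Proof.
move=> ta z1; elim: n => [|n IH]; first exact: ev1.
by rewrite !exprS evM ?IH //; exact: tameX.
Qed.

Lemma cabs_X_lt1 z n : cabs z < 1 -> cabs (z ^+ n.+1) < 1.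
Proof. by move=> z1; rewrite cabsX exprn_ilt1 // cabs_ge0. Qed.

Lemma ev_sub3 a z : tame a -> cabs z < 1 -> ev (fps_sub3 a) z = ev a (z ^+ 3).
Proof.
move=> ta z1; have lim := ev_clim (tame_sub3 ta) z1.
have lim3 := ev_clim ta (@cabs_X_lt1 z 2 z1).
apply: (@clim_uniq _ (fun n => psums a (z ^+ 3) n.+1)); last first.
  by move=> e /lim3[N hN]; exists N => n Nn; apply: hN; lia.
move=> e /lim[N hN]; exists N => n Nn.
have -> : psums a (z ^+ 3) n.+1 = psums (fps_sub3 a) z (3 * n).+1.
  rewrite /psums big_dvdn3 => [|i i3]; last first.
    by rewrite coefs_sub3 (negbTE i3) rmorph0 mul0r.
  by apply: eq_bigr => i _; rewrite coefs_sub3_mul exprM.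
by apply: hN; lia.
Qed.

Lemma ev_real a (x : R) : `|x| < 1 -> tame a -> complex.Im (ev a x%:C) = 0.
Proof.
move=> x1 ta; have lim : clim (psums a x%:C) (ev a x%:C).
  by apply: ev_clim => //; rewrite cabs_real.
apply/eqP/negPn/negP => n0; have e0 : 0 < `|complex.Im (ev a x%:C)| by rewrite normr_gt0.
have [N /(_ N (leqnn N))] := lim _ e0.
rewrite ltNge (le_trans _ (cabs_Im _)) //.
have -> : complex.Im (psums a x%:C N - ev a x%:C) = - complex.Im (ev a x%:C).
  have -> : psums a x%:C N = (\sum_(0 <= k < N) coefs a k * x ^+ k)%:C.
    by rewrite rmorph_sum; apply: eq_bigr => k _; rewrite rmorphM rmorphXn.
  by case: (ev a _) => p q /=; rewrite add0r.
by rewrite normrN.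
Qed.

End Eval.

Section Derivative.
Variable R : realType.
Local Notation C := R[i].
Implicit Types (f g : C -> C) (z w h l : C).

Definition ccont f z := forall e : R, 0 < e ->
  exists2 d : R, 0 < d & forall w, cabs (w - z) < d -> cabs (f w - f z) < e.

Lemma ccont_cst k z : ccont (fun=> k) z.
Proof. by move=> e e0; exists 1 => // w _; rewrite subrr cabs0. Qed.
Lemma ccont_id z : ccont id z.
Proof. by move=> e e0; exists e. Qed.
Lemma ccontD f g z : ccont f z -> ccont g z -> ccont (fun w => f w + g w) z.
Proof.
move=> cf cg e e0; have e20 : 0 < e / 2 by lra.
have [d d0 hd] := cf _ e20; have [d' d'0 hd'] := cg _ e20.
exists (Num.min d d'); first by rewrite lt_min d0.
move=> w; rewrite lt_min => /andP[/hd h1 /hd' h2].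
rewrite (_ : _ - _ = (f w - f z) + (g w - g z)); last by ring.
by rewrite (le_lt_trans (cabsD_le _ _)) //; lra.
Qed.
Lemma ccontM f g z : ccont f z -> ccont g z -> ccont (fun w => f w * g w) z.
Proof.
move=> cf cg e e0.
have F0 := cabs_ge0 (f z); have G0 := cabs_ge0 (g z).
pose B := cabs (f z) + cabs (g z) + 1; have B0 : 0 < B by rewrite /B; lra.
pose e1 := Num.min 1 (e / (2 * B)).
have e10 : 0 < e1 by rewrite lt_min ltr01 divr_gt0 // mulr_gt0.
have [d d0 hd] := cf _ e10; have [d' d'0 hd'] := cg _ e10.
exists (Num.min d d'); first by rewrite lt_min d0.
move=> w; rewrite lt_min => /andP[/hd + /hd'].
rewrite !lt_min !ltr_pdivlMr ?mulr_gt0 // => /andP[h1 h2] /andP[h3 h4].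
rewrite (_ : _ - _ = (f w - f z) * (g w - g z) + ((f w - f z) * g z + f z * (g w - g z)));
  last by ring.
rewrite (le_lt_trans (cabsD_le _ _)) //.
have := cabsD_le ((f w - f z) * g z) (f z * (g w - g z)); rewrite !cabsM => h5.
move: h1 h2 h3 h4 h5 (cabs_ge0 (f w - f z)) (cabs_ge0 (g w - g z)) F0 G0.
rewrite /B; move: (cabs (f w - f z)) (cabs (g w - g z)) (cabs (f z)) (cabs (g z)) => x y F G.
by move: (cabs _) => s; move=> *; nra.
Qed.
Lemma ccontV f z : f z != 0 -> ccont f z -> ccont (fun w => (f w)^-1) z.
Proof.
move=> fz0 cf e e0; have F0 : 0 < cabs (f z) by rewrite cabs_gt0.
set F := cabs (f z) in F0.
have e1 : 0 < Num.min (F / 2) (e * F ^+ 2 / 2).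
  by rewrite lt_min !divr_gt0 // mulr_gt0 // exprn_gt0.
have [d d0 hd] := cf _ e1; exists d => // w /hd.
rewrite lt_min => /andP[h1 h2].
have h3 : F / 2 < cabs (f w).
  by have := cabsB_ge (f z) (f w); rewrite cabsB_sym -/F; lra.
have fw0 : f w != 0 by rewrite -cabs_gt0; lra.
rewrite (_ : _ - _ = - (f w - f z) / (f w * f z)); last by field; rewrite fw0 fz0.
rewrite cabsf cabsN cabsM -/F ltr_pdivrMr; last by rewrite mulr_gt0 // cabs_gt0.
move: h2 h3; move: (cabs (f w - f z)) (cabs (f w)) => x y h2; rewrite -subr_gt0 => h3.
by have := mulr_gt0 (mulr_gt0 e0 F0) h3; lra.
Qed.
Lemma ccontN f z : ccont f z -> ccont (fun w => - f w) z.
Proof.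
by move=> cf e /cf[d d0 hd]; exists d => // w /hd; rewrite -opprD cabsN.
Qed.
Lemma ccontB f g z : ccont f z -> ccont g z -> ccont (fun w => f w - g w) z.
Proof. by move=> cf /ccontN; exact: ccontD. Qed.
Lemma ccontX f n z : ccont f z -> ccont (fun w => f w ^+ n) z.
Proof.
move=> cf; elim: n => [|n IH]; first exact: ccont_cst.
rewrite (_ : (fun w => f w ^+ n.+1) = (fun w => f w * f w ^+ n)).
  exact: ccontM.
by apply/funext => w; rewrite exprS.
Qed.
Lemma ccont_div f g z : ccont f z -> ccont g z -> g z != 0 -> ccont (fun w => f w / g w) z.
Proof. by move=> cf cg g0; apply: ccontM => //; exact: ccontV. Qed.
Lemma ccont_comp f g z : ccont f z -> ccont g (f z) -> ccont (fun w => g (f w)) z.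
Proof.
move=> cf cg e /cg[d d0 hd]; have [d' d'0 hd'] := cf _ d0.
by exists d' => // w /hd' /hd.
Qed.
Lemma ccont_neq0 f z : ccont f z -> f z != 0 -> exists2 d : R, 0 < d &
  forall w, cabs (w - z) < d -> f w != 0.
Proof.
move=> cf fz0; have [|d d0 hd] := cf (cabs (f z)); first by rewrite cabs_gt0.
exists d => // w /hd; apply: contraTneq => ->.
by rewrite sub0r cabsN ltxx.
Qed.
Lemma ccont_lt f z (b : R) : ccont f z -> cabs (f z) < b -> exists2 d : R, 0 < d &
  forall w, cabs (w - z) < d -> cabs (f w) < b.
Proof.
move=> cf fb; have [|d d0 hd] := cf (b - cabs (f z)); first by rewrite subr_gt0.
by exists d => // w /hd; have := cabsB_ge (f w) (f z); lra.
Qed.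

Definition cder f z l := exists phi, [/\ forall w, f w - f z = phi w * (w - z),
  phi z = l & ccont phi z].

Lemma cder_ccont f z l : cder f z l -> ccont f z.
Proof.
move=> [phi [hf _ cphi]]; rewrite (_ : f = fun w => f z + phi w * (w - z)).
  apply: ccontD; first exact: ccont_cst.
  by apply: ccontM => //; apply: ccontB; [exact: ccont_id|exact: ccont_cst].
by apply/funext => w; rewrite -hf addrC subrK.
Qed.

Lemma cder_eq f z l l' : cder f z l -> l = l' -> cder f z l'.
Proof. by move=> ? <-. Qed.

Lemma cder_cst k z : cder (fun=> k) z 0.
Proof. by exists (fun=> 0); split=> [w||]; rewrite ?subrr ?mul0r //; exact: ccont_cst. Qed.
Lemma cder_id z : cder id z 1.
Proof. by exists (fun=> 1); split=> [w||]; rewrite ?mul1r //; exact: ccont_cst. Qed.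
Lemma cderD f g z l l' : cder f z l -> cder g z l' -> cder (fun w => f w + g w) z (l + l').
Proof.
move=> [p [hp <- cp]] [q [hq <- cq]]; exists (fun w => p w + q w); split=> //.
  by move=> w; rewrite mulrDl -hp -hq; ring.
exact: ccontD.
Qed.
Lemma cderN f z l : cder f z l -> cder (fun w => - f w) z (- l).
Proof.
move=> [p [hp <- cp]]; exists (fun w => - p w); split=> //.
  by move=> w; rewrite mulNr -hp; ring.
exact: ccontN.
Qed.
Lemma cderB f g z l l' : cder f z l -> cder g z l' -> cder (fun w => f w - g w) z (l - l').
Proof. by move=> df /cderN; exact: cderD. Qed.
Lemma cderM f g z l l' : cder f z l -> cder g z l' ->
  cder (fun w => f w * g w) z (l * g z + f z * l').
Proof.
move=> df dg; have cg := cder_ccont dg; move: df dg => [p [hp <- cp]] [q [hq <- cq]].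
exists (fun w => p w * g w + f z * q w); split=> //.
  move=> w; transitivity ((p w * (w - z)) * g w + f z * (q w * (w - z))); last by ring.
  by rewrite -hp -hq; ring.
by apply: ccontD; apply: ccontM => //; exact: ccont_cst.
Qed.
Lemma cderX f z l n : cder f z l -> cder (fun w => f w ^+ n) z (n%:R * f z ^+ n.-1 * l).
Proof.
move=> df; elim: n => [|n IH].
  by apply: cder_eq (cder_cst 1 z) _; rewrite !mul0r.
rewrite (_ : (fun w => f w ^+ n.+1) = (fun w => f w * f w ^+ n)); last first.
  by apply/funext => w; rewrite exprS.
apply: cder_eq (cderM df IH) _ => /=.
case: n {IH} => [|n]; first by rewrite !expr0; ring.
by rewrite /= -[in RHS]natr1 exprS; ring.
Qed.
Lemma cderV f z l : f z != 0 -> cder f z l ->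
  cder (fun w => (f w)^-1) z (- l / f z ^+ 2).
Proof.
move=> f0 df; have cf := cder_ccont df; have [d d0 hd] := ccont_neq0 cf f0.
move: df => [p [hp <- cp]].
exists (fun w => if f w == 0 then - (f z)^-1 / (w - z) else - p w / (f w * f z)); split=> //.
- move=> w; case: eqP => [e|/eqP fw0].
    rewrite e invr0 sub0r divfK // subr_eq0; apply: contraNneq f0 => <-.
    exact/eqP.
  apply: (mulfI fw0); apply: (mulfI f0).
  transitivity (- (p w * (w - z))); last by field; rewrite fw0 f0.
  by rewrite -hp; field; rewrite fw0 f0.
- by rewrite (negbTE f0) expr2.
have cq : ccont (fun w => - p w / (f w * f z)) z.
  apply: ccont_div; [exact: ccontN|apply: ccontM => //; exact: ccont_cst|].
  by rewrite mulf_neq0.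
move=> e /cq[d' d'0 hd']; exists (Num.min d d'); first by rewrite lt_min d0.
by move=> w; rewrite lt_min => /andP[/hd/negbTE -> /hd']; rewrite (negbTE f0).
Qed.
Lemma cder_div f g z l l' : g z != 0 -> cder f z l -> cder g z l' ->
  cder (fun w => f w / g w) z ((l * g z - f z * l') / g z ^+ 2).
Proof.
move=> g0 df dg; apply: cder_eq (cderM df (cderV g0 dg)) _.
by field.
Qed.
Lemma cder_comp f g z l l' : cder f z l -> cder g (f z) l' ->
  cder (fun w => g (f w)) z (l' * l).
Proof.
move=> df; have cf := cder_ccont df.
move: df => [p [hp <- cp]] [q [hq <- cq]].
exists (fun w => q (f w) * p w); split=> //.
  by move=> w; rewrite hq hp mulrA.
by apply: ccontM => //; exact: ccont_comp.
Qed.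

Lemma cder_quad f z l (K d : R) : 0 < d -> (forall w, cabs (w - z) < d ->
    cabs (f w - f z - l * (w - z)) <= K * cabs (w - z) ^+ 2) -> cder f z l.
Proof.
move=> d0 hK; exists (fun w => if w == z then l else (f w - f z) / (w - z)); split.
- move=> w; case: eqP => [->|/eqP wz]; first by rewrite !subrr mulr0.
  by rewrite divfK // subr_eq0.
- by rewrite eqxx.
move=> e e0; have K0 : 0 < `|K| + 1 by rewrite ltr_wpDl.
exists (Num.min d (e / (`|K| + 1))); first by rewrite lt_min d0 divr_gt0.
move=> w; rewrite lt_min eqxx => /andP[/hK hw]; rewrite ltr_pdivlMr // => we.
case: eqP => [_|/eqP wz]; first by rewrite subrr cabs0.
have wz0 : w - z != 0 by rewrite subr_eq0.
have awz : 0 < cabs (w - z) by rewrite cabs_gt0.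
rewrite (_ : _ - l = (f w - f z - l * (w - z)) / (w - z)); last by field.
rewrite cabsf ltr_pdivrMr //; apply: le_lt_trans hw _.
have := ler_norm K; nra.
Qed.

(* The filter form of the derivative, in which the increment tends to 0. *)
Lemma cder_cderive f z l : cder f z l -> cderive f z = l.
Proof.
move=> [p [hp <- cp]]; rewrite /cderive /derive1.
apply: (@cvg_lim C^o); first exact: hausdorff_C.
apply/(@cvgrPdist_lt C C^o) => e e0.
have [e' e'0 ->] : exists2 e' : R, 0 < e' & e = e'%:C.
  by case: e e0 => a b; rewrite ltcE /= => /andP[/eqP -> a0]; exists a.
have [d d0 hd] := cp _ e'0.
exists d%:C => /=; first by rewrite ltcR.
move=> h /=; rewrite sub0r normrN normr_cabs ltcR => hd1 h0.
rewrite hp addrK scalerAl -[h^-1 *: p (h + z)]/(h^-1 * p (h + z)).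
rewrite mulrAC mulVf // mul1r distrC normr_cabs ltcR; apply: hd.
by rewrite addrK.
Qed.

Lemma expr_quad z h (r : R) n : cabs z <= r -> cabs (z + h) <= r ->
  r ^+ 2 * cabs ((z + h) ^+ n - z ^+ n - n%:R * z ^+ n.-1 * h) <=
  n%:R ^+ 2 * r ^+ n * cabs h ^+ 2.
Proof.
move=> zr zhr; have r0 : 0 <= r := le_trans (cabs_ge0 z) zr.
have a0 := cabs_ge0 h.
elim: n => [|n IH].
  by rewrite !expr0 subrr !mul0r subrr cabs0 mulr0 expr0n !mul0r.
have -> : (z + h) ^+ n.+1 - z ^+ n.+1 - n.+1%:R * z ^+ n.+1.-1 * h =
    (z + h) * ((z + h) ^+ n - z ^+ n - n%:R * z ^+ n.-1 * h) +
    n%:R * z ^+ n.-1 * h ^+ 2.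
  case: n {IH} => [|n] /=; first by rewrite !expr0 !expr1; ring.
  by rewrite !(exprS _ n.+1) -!natr1 (exprS z n); ring.
rewrite (le_trans (ler_wpM2l (sqr_ge0 r) (cabsD_le _ _))) // mulrDr.
set E := (z + h) ^+ n - _ - _ in IH *.
have h1 : r ^+ 2 * cabs ((z + h) * E) <= n%:R ^+ 2 * r ^+ n.+1 * cabs h ^+ 2.
  rewrite cabsM mulrCA (le_trans (ler_pM (cabs_ge0 _) _ zhr IH)) //.
    by rewrite mulr_ge0 ?sqr_ge0 ?cabs_ge0.
  by rewrite (exprS r n) le_eqVlt; apply/orP; left; apply/eqP; ring.
have h2 : r ^+ 2 * cabs (n%:R * z ^+ n.-1 * h ^+ 2) <= n%:R * r ^+ n.+1 * cabs h ^+ 2.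
  case: n {IH h1 E} => [|n]; first by rewrite !mul0r cabs0 mulr0 ?mul0r.
  rewrite !cabsM !cabsX cabs_nat /= (_ : r ^+ n.+2 = r ^+ 2 * r ^+ n); last by rewrite -exprD.
  rewrite (_ : n.+1%:R * (r ^+ 2 * r ^+ n) * cabs h ^+ 2 =
    r ^+ 2 * (n.+1%:R * r ^+ n * cabs h ^+ 2)); last by ring.
  rewrite ler_wpM2l ?sqr_ge0 // ler_wpM2r ?sqr_ge0 // ler_wpM2l //.
  by rewrite lerXn2r ?nnegrE ?cabs_ge0.
apply: le_trans (lerD h1 h2) _; rewrite -!mulrDl.
rewrite ler_wpM2r ?sqr_ge0 // ler_wpM2r ?exprn_ge0 //.
by rewrite -natrX -natrD -natrX ler_nat; lia.
Qed.

Definition fps_deriv (c : fps R) : fps R := Fps (fun n => n.+1%:R * coefs c n.+1).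

Lemma fps_D_deriv c : fps_D c = fps_X R 1 * fps_deriv c.
Proof.
by apply/fpsP => -[|n]; rewrite coefs_XM /= ?mul0r // subn1.
Qed.

Lemma tame_deriv c : tame c -> tame (fps_deriv c).
Proof.
move=> /tame_D tc r /mid_radius[rho [t [rho0 rrho rho1 t01 rE]]].
have [|M M0 hM] := tc rho; first by rewrite (ltW rho0).
exists (M / rho); first by rewrite divr_ge0 // ltW.
have /andP[t0 _] := t01; have r0 : 0 <= r by rewrite rE mulr_ge0 // ltW.
move=> n; rewrite ler_pdivlMr //; apply: le_trans (hM n.+1).
rewrite exprSr mulrA; apply: ler_wpM2r; first exact: ltW.
apply: (ler_wpM2l (normr_ge0 _)).
by rewrite lerXn2r ?nnegrE ?(ltW rrho) ?(ltW rho0).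
Qed.

Lemma cder_ev c z : tame c -> cabs z < 1 -> cder (ev c) z (ev (fps_deriv c) z).
Proof.
move=> tc z1.
pose r := (cabs z + 1) / 2.
have z0 := cabs_ge0 z.
have r0 : 0 < r by rewrite /r; lra.
have zr : cabs z < r by rewrite /r; lra.
have r1 : r < 1 by rewrite /r; lra.
have r01 : 0 <= r < 1 by rewrite ltW.
have /mid_radius[rho [t [rho0 _ rho1 t01 rE]]] := r01.
have [|M M0 hM] := tame_D (tame_D tc) (r := rho); first by rewrite (ltW rho0).
have /andP[t0 t1] := t01.
apply: (@cder_quad _ _ _ (M / (1 - t) / r ^+ 2) (r - cabs z)); first by rewrite subr_gt0.
move=> w wz; set h := w - z; have wE : w = z + h by rewrite /h addrC subrK.
have wr : cabs w <= r by have := cabsB_ge w z; lra.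
have w1 : cabs w < 1 by lra.
have lim : clim (fun N => psums c w N.+1 - psums c z N.+1 - psums (fps_deriv c) z N * h)
   (ev c w - ev c z - ev (fps_deriv c) z * h).
  apply: climB.
    have shift u l : clim u l -> clim (fun N => u N.+1) l.
      by move=> ul e /ul[N hN]; exists N => n Nn; apply: hN; exact: leqW.
    by apply: climB; apply: shift; exact: ev_clim.
  apply: climM; last exact: clim_cst.
  exact: ev_clim (tame_deriv tc) z1.
apply: (clim_le lim) => N.
rewrite mulrAC ler_pdivlMr ?exprn_gt0 // mulrC.
have -> : psums c w N.+1 - psums c z N.+1 - psums (fps_deriv c) z N * h =
    \sum_(0 <= k < N.+1) (coefs c k)%:C * (w ^+ k - z ^+ k - k%:R * z ^+ k.-1 * h).
  have -> : psums (fps_deriv c) z N * h =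
      \sum_(0 <= k < N.+1) (coefs c k)%:C * (k%:R * z ^+ k.-1 * h).
    rewrite big_nat_recl // !mul0r mulr0 add0r /psums mulr_suml.
    apply: eq_bigr => k _ /=; rewrite rmorphM rmorph_nat; ring.
  rewrite /psums -!sumrB; apply: eq_bigr => k _; ring.
rewrite (le_trans (ler_wpM2l (sqr_ge0 r) (cabs_sum _ _ _))) // mulr_sumr.
rewrite (@le_trans _ _ (\sum_(0 <= k < N.+1) (M * t ^+ k) * cabs h ^+ 2)) //.
  apply: ler_sum => k _; rewrite cabsM cabs_real mulrCA.
  have := @expr_quad z h r k (ltW zr); rewrite -wE => /(_ wr) hk.
  apply: le_trans (ler_wpM2l (normr_ge0 (coefs c k)) hk) _.
  rewrite rE exprMn.
  rewrite (_ : _ * _ = (k%:R * (k%:R * `|coefs c k|) * rho ^+ k) * t ^+ k * cabs h ^+ 2); last by ring.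
  rewrite ler_wpM2r ?sqr_ge0 // ler_wpM2r ?exprn_ge0 //.
  by have := hM k; rewrite !coefs_fps_D !normrM !normr_nat.
rewrite -mulr_suml -mulr_sumr ler_wpM2r ?sqr_ge0 // ler_wpM2l //.
by have := geo_sum_le 0 N.+1 t01; rewrite expr0 mul1r.
Qed.

Lemma ev_ccont c z : tame c -> cabs z < 1 -> ccont (ev c) z.
Proof. by move=> tc z1; exact: cder_ccont (cder_ev tc z1). Qed.

Lemma ev_fps_D c z : tame c -> cabs z < 1 -> ev (fps_D c) z = z * ev (fps_deriv c) z.
Proof.
move=> tc z1; rewrite fps_D_deriv evM ?ev_X ?expr1 //; first exact: tame_X.
exact: tame_deriv.
Qed.

End Derivative.

Section EulerEval.
Variable R : realType.
Local Notation C := R[i].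
Implicit Types (z q : C).
Local Notation Phi := (fps_euler R).
Local Notation L := (@lambert_sum R).
Local Notation u := (@lambert_atom R).

Lemma tame_lambert_pow k : tame (L (pow R k)).
Proof.
by apply: (@tame_lambert _ _ 1 k) => n; rewrite mul1r ger0_norm // exprn_ge0.
Qed.

Lemma one_sub_expr_neq0 q n : cabs q < 1 -> 1 - q ^+ n.+1 != 0.
Proof.
move=> q1; rewrite subr_eq0; apply/eqP => h.
by have := @cabs_X_lt1 _ q n q1; rewrite -h cabs1 ltxx.
Qed.

Lemma tame_lambert_atom n : tame (u n).
Proof.
apply: (@tame_bounded _ _ 1) => j; rewrite coefs_lambert_atom.
by case: (_ && _); rewrite ?normr1 ?normr0.
Qed.

Lemma ev_lambert_atom n q : cabs q < 1 ->
  ev (u n.+1) q = q ^+ n.+1 / (1 - q ^+ n.+1).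
Proof.
move=> q1; have h := congr1 (fun c => ev c q) (@lambert_atomE R n.+1 isT).
have q0 := one_sub_expr_neq0 n q1.
apply: (mulfI q0); rewrite mulrC [in RHS]mulrC divfK //.
have tX := @tame_X R n.+1; have tu := tame_lambert_atom n.+1.
rewrite evM ?evB ?ev1 ?ev_X // in h; first by rewrite mulrC.
- exact: tame1.
- by apply: tameB => //; exact: tame1.
Qed.

Lemma ev_tail1 c q N : (forall n, `|coefs c n| <= 1) -> cabs q < 1 ->
  cabs (ev c q - psums c q N) <= (1 - cabs q)^-1 * cabs q ^+ N.
Proof.
move=> c1 q1; have q01 : 0 <= cabs q < 1 by rewrite cabs_ge0.
have [n|l lim tl] := @geo_series_clim R (fun k => (coefs c k)%:C * q ^+ k) 1 _ q01 ler01.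
  by rewrite cabsM cabs_real cabsX ler_wpM2r // exprn_ge0 // cabs_ge0.
rewrite (ev_eq lim) (le_trans (tl N)) // mul1r; exact: lexx.
Qed.

Lemma lambert_clim k q : cabs q < 1 ->
  clim (fun N => \sum_(1 <= n < N) (n%:R ^+ k * (q ^+ n / (1 - q ^+ n))))
       (ev (L (pow R k)) q).
Proof.
move=> q1; have lim := ev_clim (tame_lambert_pow k) q1.
have q01 : 0 <= cabs q < 1 by rewrite cabs_ge0.
have /andP[q0 _] := q01.
have /mid_radius[rho [t [rho0 _ rho1 t01 qE]]] := q01.
have [|M M0 hM] := @tame_natpow R k.+1 rho; first by rewrite (ltW rho0).
have /andP[t0 t1] := t01.
suff : clim (fun N => \sum_(1 <= n < N) (n%:R ^+ k * (q ^+ n / (1 - q ^+ n))) -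
    psums (L (pow R k)) q N) 0.
  by move=> /(fun h => climD h lim); rewrite add0r; apply: clim_ext => n; rewrite subrK.
apply: (@clim_geo _ _ _ ((1 - cabs q)^-1 * M) t) => // N; rewrite subr0.
have -> : psums (L (pow R k)) q N = \sum_(1 <= n < N) n%:R ^+ k * psums (u n) q N.
  rewrite /psums; case: N => [|N]; first by rewrite !big_geq.
  rewrite (eq_bigr _ (fun n _ => mulr_sumr _ _ _ _)) exchange_big_nat.
  apply: eq_big_nat => j /andP[_ jN].
  rewrite (@coefs_lambert_sum_widen _ N) // rmorph_sum mulr_suml.
  apply: eq_bigr => n _; rewrite rmorphM rmorphXn rmorph_nat; ring.
rewrite -sumrB (le_trans (cabs_sum _ _ _)) //.
rewrite (@le_trans _ _ (\sum_(1 <= n < N) N%:R ^+ k * ((1 - cabs q)^-1 * cabs q ^+ N))) //.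
  apply: ler_sum_nat => -[//|n] /andP[_ nN].
  rewrite -mulrBr -ev_lambert_atom // cabsM cabsX cabs_nat.
  rewrite ler_pM ?exprn_ge0 ?cabs_ge0 //.
    by rewrite lerXn2r ?nnegrE // ler_nat ltnW.
  apply: ev_tail1 => // j; rewrite coefs_lambert_atom.
  by case: (_ && _); rewrite ?normr1 ?normr0.
rewrite sumr_const_nat.
have c0 : 0 <= N%:R ^+ k * ((1 - cabs q)^-1 * cabs q ^+ N).
  by rewrite !mulr_ge0 ?exprn_ge0 ?invr_ge0 ?subr_ge0 // ltW.
rewrite (@le_trans _ _ (N%:R ^+ k * ((1 - cabs q)^-1 * cabs q ^+ N) *+ N)) //.
  by rewrite ler_wpMn2l // leq_subr.
rewrite -mulr_natl {2}qE exprMn.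
have -> : N%:R * (N%:R ^+ k * ((1 - cabs q)^-1 * (rho ^+ N * t ^+ N))) =
  (1 - cabs q)^-1 * (N%:R ^+ k.+1 * rho ^+ N) * t ^+ N by rewrite exprS; ring.
rewrite ler_wpM2r ?exprn_ge0 // ler_wpM2l ?invr_ge0 ?subr_ge0 ?(ltW q1) //.
by have := hM N; rewrite /= ger0_norm // exprn_ge0.
Qed.

Definition majorizes (m p : {poly R}) := forall j, `|p`_j| <= m`_j.

Lemma majorizesM m p m' p' : majorizes m p -> majorizes m' p' -> majorizes (m * m') (p * p').
Proof.
move=> h h' j; rewrite !coefM (le_trans (ler_norm_sum _ _ _)) //.
by apply: ler_sum => i _; rewrite normrM ler_pM.
Qed.

Lemma majorizes_coef m p (r : R) j : majorizes m p -> 0 <= r -> `|p`_j| * r ^+ j <= m.[r].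
Proof.
move=> h r0; have m0 i : 0 <= m`_i := le_trans (normr_ge0 _) (h i).
rewrite (le_trans (ler_wpM2r (exprn_ge0 _ r0) (h j))) // horner_coef.
have [js|js] := ltnP j (size m); last first.
  by rewrite nth_default // mul0r sumr_ge0 // => i _; rewrite mulr_ge0 ?exprn_ge0.
rewrite (bigD1 (Ordinal js)) //= lerDl sumr_ge0 // => i _.
by rewrite mulr_ge0 ?exprn_ge0.
Qed.

Lemma coef_euler_bound (r : R) : 0 <= r < 1 -> exists2 M : R, 0 <= M &
  forall N j, `|(euler_poly R N)`_j| * r ^+ j <= M.
Proof.
move=> r01; have /andP[r0 r1] := r01.
exists (expR (1 - r)^-1); first exact: expR_ge0.
move=> N j; pose m : {poly R} := \prod_(1 <= n < N) (1 + 'X^n).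
have mm : majorizes m (euler_poly R N).
  rewrite /m /euler_poly; elim/big_rec2: _ => [i|n p p' _ IH].
    by rewrite !coef1 ger0_norm.
  apply: majorizesM => // i; rewrite coefB coefD !coef1 coefXn.
  by case: (_ == _); case: (_ == _) => /=; rewrite ?subrr ?subr0 ?sub0r ?normrN ?normr1 ?normr0
     ?addr0 ?add0r ?ler0n // -natrD ler0n.
rewrite (le_trans (majorizes_coef j mm r0)) // /m horner_prod.
rewrite (@le_trans _ _ (\prod_(1 <= n < N) expR (r ^+ n))) //.
  rewrite ler_prod // => n _; rewrite hornerD hornerC hornerXn expR_ge1Dx andbT.
  by rewrite addr_ge0 // exprn_ge0.
rewrite -(big_morph _ (@expRD R) (@expR0 R)) ler_expR.
have := geo_sum_le 1 N r01; rewrite expr1 => /le_trans; apply.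
by rewrite ler_piMl ?invr_ge0 ?subr_ge0 ?ltW.
Qed.

Lemma tame_euler : tame Phi.
Proof.
by move=> r /coef_euler_bound[M M0 hM]; exists M => // n; rewrite (@coefs_euler _ n.+1).
Qed.

Lemma tame_fps_poly (p : {poly R}) : tame (fps_poly p).
Proof.
apply: (@tame_bounded _ _ (\sum_(i < size p) `|p`_i|)) => n /=.
have [ns|ns] := ltnP n (size p); last by rewrite nth_default // normr0 sumr_ge0.
by rewrite (bigD1 (Ordinal ns)) //= lerDl sumr_ge0.
Qed.

Lemma ev_euler_poly N q : cabs q < 1 ->
  ev (fps_poly (euler_poly R N)) q = \prod_(1 <= n < N) (1 - q ^+ n).
Proof.
move=> q1; elim: N => [|[|N] IH].
- by rewrite /euler_poly !big_geq // fps_poly1 ev1.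
- by rewrite /euler_poly !big_geq // fps_poly1 ev1.
rewrite euler_polyS // fps_polyM evM //; try exact: tame_fps_poly.
rewrite IH [in RHS]big_nat_recr //=; congr (_ * _).
by rewrite fps_poly_1BXn evB ?ev1 ?ev_X //; [exact: tame1|exact: tame_X].
Qed.

Lemma euler_clim q : cabs q < 1 ->
  clim (fun N => \prod_(1 <= n < N) (1 - q ^+ n)) (ev Phi q).
Proof.
move=> q1; have /mid_radius[rho [t [rho0 _ rho1 t01 qE]]] : 0 <= cabs q < 1.
  by rewrite cabs_ge0.
have [|M M0 hM] := @coef_euler_bound rho; first by rewrite (ltW rho0).
have /andP[t0 t1] := t01.
apply: (@clim_geo _ _ _ (2 * M / (1 - t)) t) => // N.
rewrite -ev_euler_poly // -evB //; [|exact: tame_fps_poly|exact: tame_euler].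
set c := fps_poly _ - _.
have [|n|l lim tl] := @geo_series_clim R (fun k => (coefs c k)%:C * q ^+ k) (2 * M) t t01.
- by rewrite mulr_ge0.
- rewrite cabsM cabs_real cabsX qE exprMn mulrA ler_wpM2r ?exprn_ge0 //.
  rewrite coefsB (@coefs_euler _ n.+1) //.
  apply: le_trans (ler_wpM2r (exprn_ge0 n (ltW rho0)) (ler_normB _ _)) _.
  have -> : 2 * M = M + M by ring.
  by rewrite mulrDl; apply: lerD; exact: hM.
rewrite (ev_eq lim); have := tl N; rewrite big_nat_cond big1 ?subr0 //.
move=> k /andP[/andP[_ kN] _]; rewrite coefsB (coefs_euler _ kN) subrr.
by rewrite rmorph0 mul0r.
Qed.

Lemma prod_one_sub_ge (r : R) M N : 0 <= r < 1 -> 1 - \sum_(M <= n < N) r ^+ n <=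
  \prod_(M <= n < N) (1 - r ^+ n).
Proof.
move=> /andP[r0 r1]; elim: N => [|N IH]; first by rewrite !big_geq // subr0.
have [NM|MN] := ltnP N M; first by rewrite !big_geq // subr0.
rewrite !big_nat_recr //=.
set p := \prod_(_ <= _ < _) _ in IH *; set s := \sum_(_ <= _ < _) _ in IH *.
have rN0 : 0 <= r ^+ N by rewrite exprn_ge0.
have rN1 : r ^+ N <= 1 by rewrite exprn_ile1 // ltW.
have s0 : 0 <= s by rewrite /s sumr_ge0 // => n _; rewrite exprn_ge0.
nra.
Qed.

Lemma ev_euler_neq0 q : cabs q < 1 -> ev Phi q != 0.
Proof.
move=> q1; have q01 : 0 <= cabs q < 1 by rewrite cabs_ge0.
have /andP[q0 _] := q01; set r := cabs q in q1 q01 q0.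
have [|M hM] := rexpr_lt q01 (e := (1 - r) / 2); first by lra.
pose K := maxn M 1; have KM : (M <= K)%N by rewrite leq_maxl.
have K1 : (1 <= K)%N by rewrite leq_maxr.
pose c := \prod_(1 <= n < K) (1 - r ^+ n).
have c0 : 0 < c.
  rewrite /c big_nat_cond; apply: prodr_gt0 => n /andP[/andP[n0 _] _].
  by rewrite subr_gt0 exprn_ilt1 //; lia.
have lim := clim_shift K (euler_clim q1).
apply/eqP => e0; rewrite e0 in lim.
have [|N /(_ N (leqnn N))] := lim (c / 2); first by lra.
rewrite subr0; apply/negP; rewrite -leNgt.
have h (a b : nat) : \prod_(a <= n < b) (1 - r ^+ n) <= cabs (\prod_(a <= n < b) (1 - q ^+ n)).
  rewrite (big_morph _ (@cabsM R) (@cabs1 R)) ler_prod // => n _.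
  apply/andP; split; first by rewrite subr_ge0 exprn_ile1 // ltW.
  by have := cabsB_ge 1 (q ^+ n); rewrite cabs1 cabsX.
rewrite (big_cat_nat (n := K)) //= ?leq_addl // cabsM.
apply: ler_pM; [exact: ltW|by rewrite invr_ge0|exact: h|].
apply: le_trans (h _ _); apply: le_trans (prod_one_sub_ge _ _ q01).
have := geo_sum_le K (N + K) q01.
have : r ^+ K / (1 - r) <= 2^-1.
  rewrite ler_pdivrMr ?subr_gt0 //; have := hM K KM; lra.
lra.
Qed.

Lemma tame_a : tame (fps_a R).
Proof.
apply: tameD; first exact: tame1.
apply: tameM; first exact: tame_nat.
apply: (@tame_lambert _ _ 2 0) => n; rewrite /pows /pow !expr0 mul1r mulr1.
have := cos3_sin3_norm R n; have := sqr_ge0 (cos3 R n).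
by rewrite ler_norml => h1 h2; apply/andP; split; nra.
Qed.
Lemma tame_b3 : tame (fps_b3 R).
Proof.
apply: tameB; first exact: tame1.
apply: tameM; first exact: tame_nat.
apply: (@tame_lambert _ _ 2 2) => n; rewrite /pows /pow normrM mulrC.
rewrite [X in _ * X]ger0_norm ?exprn_ge0 // ler_wpM2r ?exprn_ge0 //.
have := cos3_sin3_norm R n; have := sqr_ge0 (cos3 R n).
by rewrite ler_norml => h1 h2; apply/andP; split; nra.
Qed.
Lemma tame_c3 : tame (fps_c3 R).
Proof. by apply: tameB; [apply: tameX; exact: tame_a|exact: tame_b3]. Qed.
Lemma tame_E2 : tame (fps_E2 R).
Proof.
apply: tameB; first exact: tame1.
by apply: tameM; [exact: tame_nat|exact: tame_lambert_pow].
Qed.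
Lemma tame_E4 : tame (fps_E4 R).
Proof.
apply: tameD; first exact: tame1.
by apply: tameM; [exact: tame_nat|exact: tame_lambert_pow].
Qed.
Lemma tame_E6 : tame (fps_E6 R).
Proof.
apply: tameB; first exact: tame1.
by apply: tameM; [exact: tame_nat|exact: tame_lambert_pow].
Qed.

Lemma ev_b3_euler q : cabs q < 1 -> ev (fps_b3 R) q * ev Phi (q ^+ 3) ^+ 3 = ev Phi q ^+ 9.
Proof.
move=> q1; have te := tame_euler; have te3 := tame_sub3 te; have tb := tame_b3.
have := congr1 (fun c => ev c q) (fps_b3_euler R).
by rewrite evM ?evX ?ev_sub3 //; exact: tameX.
Qed.
Lemma ev_c3_euler q : cabs q < 1 ->
  ev (fps_c3 R) q * ev Phi q ^+ 3 = 27 * q * ev Phi (q ^+ 3) ^+ 9.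
Proof.
move=> q1; have te := tame_euler; have te3 := tame_sub3 te; have tc := tame_c3.
have tX := @tame_X R 1.
have := congr1 (fun c => ev c q) (fps_c3_euler R).
have t27 : tame (27 * fps_X R 1) by apply: tameM => //; exact: tame_nat.
rewrite evM ?evX ?[ev (27 * _ * _) q]evM ?evX ?ev_sub3 ?[ev (27 * _) q]evM //;
  try (by apply: tameX); try exact: tame_nat.
by rewrite ev_nat ev_X expr1.
Qed.

Lemma ev_c3_neq0 q : cabs q < 1 -> q != 0 -> ev (fps_c3 R) q != 0.
Proof.
move=> q1 q0; apply/eqP => e; have := ev_c3_euler q1; rewrite e mul0r => /esym/eqP.
rewrite mulf_eq0 expf_eq0 mulf_eq0 (negbTE q0) pnatr_eq0.
by rewrite (negbTE (ev_euler_neq0 (@cabs_X_lt1 _ q 2 q1))).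
Qed.

End EulerEval.

Section RealDerivative.
Variable R : realType.
Implicit Types (f : R -> R) (x l e : R).

Lemma is_derive_eps f x l : is_derive x 1 f l -> forall e, 0 < e ->
  exists2 d : R, 0 < d & forall h, `|h| < d -> `|f (x + h) - f x - l * h| <= e * `|h|.
Proof.
move=> df e e0; have := @ex_derive _ _ _ _ _ _ _ df; rewrite /derivable => cv.
have : (h^-1 *: (f (h *: 1 + x) - f x) @[h --> 0^']) --> l.
  by rewrite -(@derive_val _ _ _ _ _ _ _ df).
move=> /cvgrPdist_lt/(_ _ e0)[d /= d0 hd]; exists d => // h hd1.
have [->|h0] := eqVneq h 0; first by rewrite addr0 subrr mulr0 subr0 normr0 mulr0.
have := hd h; rewrite /= sub0r normrN => /(_ hd1 h0).
rewrite [h%:A](mulr1 h) (addrC h x) => /ltW hle.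
rewrite (_ : _ - _ = - ((l - h^-1 *: (f (x + h) - f x)) * h)).
  by rewrite normrN normrM ler_wpM2r.
by rewrite /GRing.scale /=; field.
Qed.

Lemma eps_is_derive f x l : (forall e, 0 < e ->
  exists2 d : R, 0 < d & forall h, `|h| < d -> `|f (x + h) - f x - l * h| <= e * `|h|) ->
  is_derive x 1 f l.
Proof.
move=> hf; have cv : (h^-1 *: (f (h *: 1 + x) - f x) @[h --> 0^']) --> l.
  apply/cvgrPdist_lt => e e0; have e20 : 0 < e / 2 by rewrite divr_gt0.
  have [d d0 hd] := hf _ e20; exists d => //= h; rewrite /ball_ /= sub0r normrN => hd1 h0.
  have := hd h hd1; rewrite [h%:A](mulr1 h) (addrC h x) => hle.
  rewrite (_ : _ - _ = - ((f (x + h) - f x - l * h) / h)); last first.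
    by rewrite /GRing.scale /=; field.
  rewrite normrN normf_div ltr_pdivrMr ?normr_gt0 //.
  apply: le_lt_trans hle _; rewrite ltr_pM2r ?normr_gt0 //; lra.
apply: DeriveDef; first by apply/cvg_ex; exists l.
by apply: cvg_lim.
Qed.

End RealDerivative.

Section Cexp.
Variable R : realType.
Local Notation C := R[i].
Implicit Types (z w h : C).

Lemma cder_eps (f : C -> C) z l : (forall e : R, 0 < e -> exists2 d : R, 0 < d &
    forall w, cabs (w - z) < d ->
    cabs (f w - f z - l * (w - z)) <= e * cabs (w - z)) -> cder f z l.
Proof.
move=> hf; exists (fun w => if w == z then l else (f w - f z) / (w - z)); split.
- move=> w; case: eqP => [->|/eqP wz]; first by rewrite !subrr mulr0.
  by rewrite divfK // subr_eq0.
- by rewrite eqxx.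
move=> e e0; have [|d d0 hd] := hf (e / 2); first by rewrite divr_gt0.
exists d => // w /hd; rewrite eqxx; case: eqP => [_ _|/eqP wz hw].
  by rewrite subrr cabs0.
have wz0 : w - z != 0 by rewrite subr_eq0.
have awz : 0 < cabs (w - z) by rewrite cabs_gt0.
rewrite (_ : _ - l = (f w - f z - l * (w - z)) / (w - z)); last by field.
by rewrite cabsf ltr_pdivrMr //; apply: le_lt_trans hw _; rewrite ltr_pM2r //; lra.
Qed.

Lemma cexpD z w : cexp (z + w) = cexp z * cexp w.
Proof.
case: z w => [a b] [c d]; rewrite /cexp /= expRD cosD sinD rmorphM mulrACA.
by congr (_ * _); apply/eqP; rewrite eq_complex /=; apply/andP; split; apply/eqP; ring.
Qed.
Lemma cexp0 : cexp (0 : C) = 1.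
Proof. by rewrite /cexp /= expR0 cos0 sin0 mul1r. Qed.
Lemma cexpMn n z : cexp (n%:R * z) = cexp z ^+ n.
Proof.
elim: n => [|n IH]; first by rewrite mul0r cexp0.
by rewrite -natr1 mulrDl mul1r cexpD IH exprSr.
Qed.
Lemma cabs_cexp z : cabs (cexp z) = expR (complex.Re z).
Proof.
rewrite /cexp cabsM cabs_real ger0_norm ?expR_ge0 // [X in _ * X](_ : _ = 1) ?mulr1 //.
by rewrite /cabs /= cos2Dsin2 sqrtr1.
Qed.
Lemma cexp_neq0 z : cexp z != 0.
Proof. by rewrite -cabs_gt0 cabs_cexp expR_gt0. Qed.

Lemma cder_cexp0 : cder (@cexp R) 0 1.
Proof.
apply: cder_eps => e e0.
have e6 : 0 < Num.min 1 (e / 6) by rewrite lt_min ltr01 divr_gt0.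
set e' := Num.min _ _ in e6.
have e'1 : e' <= 1 by rewrite ge_min lexx.
have e'e : e' * 6 <= e by rewrite -ler_pdivlMr // ge_min lexx orbT.
have [d1 d10 h1] := is_derive_eps (is_derive_expR (0 : R)) e6.
have [d2 d20 h2] := is_derive_eps (is_derive_cos (0 : R)) e6.
have [d3 d30 h3] := is_derive_eps (is_derive_sin (0 : R)) e6.
exists (Num.min d1 (Num.min d2 (Num.min d3 (e' / 2)))).
  by rewrite !lt_min d10 d20 d30 divr_gt0.
move=> w; rewrite subr0 mul1r cexp0 !lt_min => /and4P[].
move=> w1 w2 w3 w4; apply: le_trans (cabs_le_ReIm _) _; move: w1 w2 w3 w4.
move: (cabs_Re w) (cabs_Im w) (cabs_ge0 w); move: (cabs w) => W.
case: w => [x y] /= hx hy W0 w1 w2 w3 w4.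
have := h1 x (le_lt_trans hx w1); have := h2 y (le_lt_trans hy w2).
have := h3 y (le_lt_trans hy w3).
rewrite !add0r sin0 cos0 expR0 oppr0 mul0r !mul1r !subr0 ?addr0 => s1 s2 s3.
rewrite !mul0r !subr0 !addr0.
set E := expR x in s3 *; set cc := cos y in s2 *; set ss := sin y in s1 *.
have xe : `|x| <= e' / 2 by apply: le_trans hx (ltW w4).
have ye : `|y| <= e' / 2 by apply: le_trans hy (ltW w4).
have [E1 E2] : `|E - 1| <= e' /\ `|E| <= 2.
  have hE : `|E - 1| <= e'.
    rewrite (_ : E - 1 = (E - 1 - x) + x); last by ring.
    apply: le_trans (ler_normD _ _) _.
    have := normr_ge0 x; nra.
  split=> //; rewrite (_ : E = (E - 1) + 1); last by ring.
  by apply: le_trans (ler_normD _ _) _; rewrite normr1; lra.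
have ex : e' * `|x| <= e' * W by rewrite ler_wpM2l // ltW.
have ey : e' * `|y| <= e' * W by rewrite ler_wpM2l // ltW.
have r1 : `|E * cc - 1 - x| <= 3 * e' * W.
  rewrite (_ : _ - x = (E - 1 - x) + E * (cc - 1)); last by ring.
  apply: le_trans (ler_normD _ _) _; rewrite normrM.
  have := ler_pM (normr_ge0 _) (normr_ge0 _) E2 s2; lra.
have r2 : `|E * ss - y| <= 3 * e' * W.
  rewrite (_ : _ - y = E * (ss - y) + (E - 1) * y); last by ring.
  apply: le_trans (ler_normD _ _) _; rewrite !normrM.
  have := ler_pM (normr_ge0 _) (normr_ge0 _) E2 s1.
  have := ler_pM (normr_ge0 _) (normr_ge0 _) E1 hy; lra.
have : e' * 6 * W <= e * W by rewrite ler_wpM2r.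
lra.
Qed.

Lemma cder_cexp z : cder (@cexp R) z (cexp z).
Proof.
have d1 : cder (fun w => w - z) z 1.
  by apply: cder_eq (cderB (cder_id z) (cder_cst z z)) _; rewrite subr0.
have d2 : cder (fun w => cexp (w - z)) z (1 * 1).
  by apply: cder_comp d1 _; rewrite subrr; exact: cder_cexp0.
have := cderM (cder_cst (cexp z) z) d2.
rewrite (_ : (fun w => cexp z * cexp (w - z)) = @cexp R).
  by move=> h; apply: cder_eq h _; ring.
by apply/funext => w; rewrite -cexpD addrC subrK.
Qed.

End Cexp.

Section LocallyConstant.
Variable R : realType.
Local Notation C := R[i].
Implicit Types (z w h : C) (f : C -> C).

Lemma cder_line f z v (t : R) l : cder f (z + t%:C * v) l ->
  is_derive t 1 (fun s : R => complex.Re (f (z + s%:C * v))) (complex.Re (l * v)) /\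
  is_derive t 1 (fun s : R => complex.Im (f (z + s%:C * v))) (complex.Im (l * v)).
Proof.
set z' := z + t%:C * v => df.
have h (pr : C -> R) : (forall a b, pr (a - b) = pr a - pr b) ->
    (forall (a : R) b, pr (a%:C * b) = a * pr b) -> (forall a, `|pr a| <= cabs a) ->
    is_derive t 1 (fun s : R => pr (f (z + s%:C * v))) (pr (l * v)).
  move=> prB prZ prle; apply: eps_is_derive => e e0.
  have v0 : 0 < cabs v + 1 by rewrite ltr_wpDl ?cabs_ge0.
  case: df => p [hp pl cp].
  have [|d d0 hd] := cp (e / (cabs v + 1)); first by rewrite divr_gt0.
  exists (d / (cabs v + 1)); first by rewrite divr_gt0.
  move=> k; rewrite ltr_pdivlMr // => kd.
  have e1 : z + (t + k)%:C * v = z' + k%:C * v by rewrite rmorphD /z'; ring.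
  have := hd (z' + k%:C * v); have := hp (z' + k%:C * v).
  rewrite (_ : z' + k%:C * v - z' = k%:C * v); last by ring.
  rewrite -e1 => hp1 /(_ _)/wrap[|hd1].
    by rewrite cabsM cabs_real; have := normr_ge0 k; have := cabs_ge0 v; nra.
  rewrite -prB hp1 (mulrC _ k) -prZ -prB (le_trans (prle _)) //.
  rewrite pl in hd1.
  rewrite (_ : _ - _ = k%:C * (v * (p (z + (t + k)%:C * v) - l))); last by ring.
  rewrite !cabsM cabs_real mulrC ler_wpM2r //.
  move: hd1; rewrite ltr_pdivlMr // => hd1.
  have := cabs_ge0 (p (z + (t + k)%:C * v) - l); have := cabs_ge0 v; nra.
split; apply: h.
- by move=> [? ?] [? ?].
- by move=> a [b c] /=; rewrite mul0r subr0.
- exact: cabs_Re.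
- by move=> [? ?] [? ?].
- by move=> a [b c] /=; rewrite mul0r addr0.
- exact: cabs_Im.
Qed.

Lemma cder0_ball f z (r : R) : (forall w, cabs (w - z) < r -> cder f w 0) ->
  forall w, cabs (w - z) < r -> f w = f z.
Proof.
move=> df w wz; set v := w - z.
have dl (t : R) : t \in `[0, 1] -> cder f (z + t%:C * v) 0.
  rewrite in_itv /= => /andP[t0 t1]; apply: df.
  rewrite (_ : z + t%:C * v - z = t%:C * v); last by ring.
  rewrite cabsM cabs_real ger0_norm //.
  have := cabs_ge0 v; rewrite -/v in wz; nra.
have cst (pr : C -> R) : (forall t : R, t \in `[0, 1] ->
    is_derive t 1 (fun s : R => pr (f (z + s%:C * v))) 0) -> pr (f w) = pr (f z).
  move=> dpr; pose F (s : R) := pr (f (z + s%:C * v)); pose dF (s : R) : R := 0.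
  have F1 (x : R) : x \in `]0, 1[ -> is_derive x 1 F (dF x).
    rewrite in_itv /= => /andP[t0 t1]; apply: dpr.
    by rewrite in_itv /= (ltW t0) (ltW t1).
  have F2 : {within `[0, 1], continuous F}.
    apply: derivable_within_continuous => t tI.
    exact: (@ex_derive _ _ _ _ _ _ _ (dpr t tI)).
  have [t tI] := MVT ltr01 F1 F2.
  rewrite /dF mul0r => /eqP; rewrite subr_eq0 /F => /eqP.
  by rewrite mul1r mul0r addr0 /v addrC subrK.
have Re0 : complex.Re (0 * v) = 0 by rewrite mul0r.
have Im0 : complex.Im (0 * v) = 0 by rewrite mul0r.
have e1 := cst _ (fun t tI => is_derive_eq (cder_line (dl t tI)).1 Re0).
have e2 := cst _ (fun t tI => is_derive_eq (cder_line (dl t tI)).2 Im0).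
by apply/eqP; rewrite eq_complex e1 e2 !eqxx.
Qed.

End LocallyConstant.

(** * Modular forms as functions of the nome *)

Section Modular.
Variable R : realType.
Local Notation C := R[i].
Implicit Types (z w h q tau : C).
Local Notation P := (fps_E2 R).
Local Notation a := (fps_a R).
Local Notation b := (fps_b3 R).
Local Notation c := (fps_c3 R).

Lemma cabs_nome tau : cabs (nome tau) = expR (- (2 * pi * complex.Im tau)).
Proof.
rewrite /nome cabs_cexp; congr expR; case: tau => x y /=; ring.
Qed.

Lemma nome_lt1 tau : 0 < complex.Im tau -> cabs (nome tau) < 1.
Proof.
move=> t0; rewrite cabs_nome -expR0 ltr_expR oppr_lt0 !mulr_gt0 //.
exact: pi_gt0.
Qed.

Lemma nome_neq0 tau : nome tau != 0. Proof. exact: cexp_neq0. Qed.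

Lemma cder_nome tau : cder (@nome R) tau (2 * pi%:C * 'i * nome tau).
Proof.
apply: cder_eq (cder_comp (cderM (cder_cst (2 * pi%:C * 'i) tau) (cder_id tau))
  (cder_cexp _)) _.
by rewrite mul0r add0r mulr1 mulrC.
Qed.

Lemma lambertE k tau : 0 < complex.Im tau ->
  lambert k tau = ev (lambert_sum (pow R k)) (nome tau).
Proof. by move=> /nome_lt1 q1; apply: clim_climn; exact: lambert_clim. Qed.

Lemma E2E tau : 0 < complex.Im tau -> E2 tau = ev P (nome tau).
Proof.
move=> t0; have q1 := nome_lt1 t0; rewrite /E2 lambertE //.
have tL := @tame_lambert_pow R 1.
rewrite evB ?evM ?ev1 ?ev_nat //; [exact: tame_nat|exact: tame1|].
by apply: tameM => //; exact: tame_nat.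
Qed.
Lemma E4E tau : 0 < complex.Im tau -> E4 tau = ev (fps_E4 R) (nome tau).
Proof.
move=> t0; have q1 := nome_lt1 t0; rewrite /E4 lambertE //.
have tL := @tame_lambert_pow R 3.
rewrite evD ?evM ?ev1 ?ev_nat //; [exact: tame_nat|exact: tame1|].
by apply: tameM => //; exact: tame_nat.
Qed.
Lemma E6E tau : 0 < complex.Im tau -> E6 tau = ev (fps_E6 R) (nome tau).
Proof.
move=> t0; have q1 := nome_lt1 t0; rewrite /E6 lambertE //.
have tL := @tame_lambert_pow R 5.
rewrite evB ?evM ?ev1 ?ev_nat //; [exact: tame_nat|exact: tame1|].
by apply: tameM => //; exact: tame_nat.
Qed.

Lemma hauptmodulE tau : 0 < complex.Im tau ->
  hauptmodul tau = - (ev b (nome tau) / ev c (nome tau)).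
Proof.
move=> t0; have q1 := nome_lt1 t0; have q0 := nome_neq0 tau.
have n3 : nome (3 * tau) = nome tau ^+ 3.
  by rewrite /nome -cexpMn; congr cexp; ring.
rewrite /hauptmodul /eta n3.
have -> : climn (fun N => \prod_(1 <= n < N) (1 - nome tau ^+ n)) =
    ev (fps_euler R) (nome tau) by apply: clim_climn; exact: euler_clim.
have -> : climn (fun N => \prod_(1 <= n < N) (1 - (nome tau ^+ 3) ^+ n)) =
    ev (fps_euler R) (nome tau ^+ 3).
  by apply: clim_climn; apply: euler_clim; exact: (@cabs_X_lt1 _ _ 2).
have := ev_b3_euler q1; have := ev_c3_euler q1.
have := ev_euler_neq0 q1; have := ev_euler_neq0 (@cabs_X_lt1 _ _ 2 q1).
have := ev_c3_neq0 q1 q0.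
set f := ev (fps_euler R) (nome tau); set f3 := ev (fps_euler R) (nome tau ^+ 3).
set B := ev b _; set Cc := ev c _ => C0 f30 f0 hc hb.
set e1 := cexp _; set e3 := cexp _.
have e10 : e1 != 0 by exact: cexp_neq0.
have e30 : e3 != 0 by exact: cexp_neq0.
have e13 : e3 ^+ 12 = e1 ^+ 12 * nome tau.
  by rewrite /e1 /e3 /nome -!cexpMn -cexpD; congr cexp; field.
move: C0 f30 f0 hc hb e10 e30 e13 q0.
move: f f3 B Cc e1 e3 (nome tau) => f f3 B Cc e1 e3 q C0 f30 f0 hc hb e10 e30 e13 q0.
transitivity (- (1 / 27) * (e1 ^+ 12 * (f ^+ 9 * f ^+ 3) / (e3 ^+ 12 * (f3 ^+ 9 * f3 ^+ 3)))).
  by field; rewrite f30 e30.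
have -> : f3 ^+ 9 = Cc * f ^+ 3 / (27 * q) by rewrite hc; field.
rewrite e13 -hb.
by field; rewrite q0 C0 f0 f30 e10.
Qed.

Local Notation D := (@fps_D R).

Definition evals q (x : fps R) (v : C) := tame x /\ ev x q = v.

Lemma evals_atom q x : tame x -> evals q x (ev x q).
Proof. by []. Qed.
Lemma evals_nat q n : evals q n%:R n%:R.
Proof. by split; [exact: tame_nat|exact: ev_nat]. Qed.
Lemma evalsD q x y v w : cabs q < 1 -> evals q x v -> evals q y w -> evals q (x + y) (v + w).
Proof. by move=> q1 [tx <-] [ty <-]; split; [exact: tameD|exact: evD]. Qed.
Lemma evalsN q x v : cabs q < 1 -> evals q x v -> evals q (- x) (- v).
Proof. by move=> q1 [tx <-]; split; [exact: tameN|exact: evN]. Qed.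
Lemma evalsM q x y v w : cabs q < 1 -> evals q x v -> evals q y w -> evals q (x * y) (v * w).
Proof. by move=> q1 [tx <-] [ty <-]; split; [exact: tameM|exact: evM]. Qed.
Lemma evalsX q x v n : cabs q < 1 -> evals q x v -> evals q (x ^+ n) (v ^+ n).
Proof. by move=> q1 [tx <-]; split; [exact: tameX|exact: evX]. Qed.
Lemma evals_sub3 q x : cabs q < 1 -> tame x -> evals q (fps_sub3 x) (ev x (q ^+ 3)).
Proof. by move=> q1 tx; split; [exact: tame_sub3|exact: ev_sub3]. Qed.

Lemma evals_eq q x y v w : x = y -> evals q x v -> evals q y w -> v = w.
Proof. by move=> -> [_ <-] [_ <-]. Qed.

Ltac tame_atom := first
  [ exact: tame_a | exact: tame_b3 | exact: tame_c3
  | exact: tame_E2 | exact: tame_E4 | exact: tame_E6 ].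
Ltac evals_tac := repeat lazymatch goal with
  | |- evals _ (_ + _) _ => apply: evalsD => //
  | |- evals _ (- _) _ => apply: evalsN => //
  | |- evals _ (_ * _) _ => apply: evalsM => //
  | |- evals _ (_ ^+ _) _ => apply: evalsX => //
  | |- evals _ (_ %:R) _ => exact: evals_nat
  | |- evals _ (fps_sub3 _) _ => apply: evals_sub3 => //; tame_atom
  | |- evals _ (fps_D _) _ => apply: evals_atom; apply: tame_D; tame_atom
  | |- evals _ _ _ => apply: evals_atom; tame_atom
  end.

Lemma ev_c3_a q : cabs q < 1 -> ev c q = ev a q ^+ 3 - ev b q.
Proof.
by move=> q1; apply: (@evals_eq q _ _ _ _ (erefl : c = a ^+ 3 - b)); evals_tac.
Qed.

Lemma ev_E4_c3 q : cabs q < 1 -> ev (fps_E4 R) q = ev a q * (ev a q ^+ 3 + 8 * ev c q).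
Proof. by move=> q1; apply: (evals_eq (fps_E4_c3 R) (q := q)); evals_tac. Qed.

Lemma ev_E6_c3 q : cabs q < 1 ->
  ev (fps_E6 R) q = ev a q ^+ 6 - 20 * ev a q ^+ 3 * ev c q - 8 * ev c q ^+ 2.
Proof. by move=> q1; apply: (evals_eq (fps_E6_c3 R) (q := q)); evals_tac. Qed.

Lemma ev_D_a q : cabs q < 1 ->
  12 * ev (D a) q = ev a q * ev P q + 3 * ev a q ^+ 3 - 4 * ev b q.
Proof. by move=> q1; apply: (evals_eq (fps_D_a R) (q := q)); evals_tac. Qed.
Lemma ev_D_c3 q : cabs q < 1 -> 4 * ev (D c) q = (ev P q + 3 * ev a q ^+ 2) * ev c q.
Proof. by move=> q1; apply: (evals_eq (fps_D_c3 R) (q := q)); evals_tac. Qed.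
Lemma ev_D_E2 q : cabs q < 1 -> 12 * ev (D P) q = ev P q ^+ 2 - ev (fps_E4 R) q.
Proof. by move=> q1; apply: (evals_eq (fps_D_E2 R) (q := q)); evals_tac. Qed.
Lemma ev_D_E4 q : cabs q < 1 ->
  3 * ev (D (fps_E4 R)) q = ev P q * ev (fps_E4 R) q - ev (fps_E6 R) q.
Proof. by move=> q1; apply: (evals_eq (fps_D_E4 R) (q := q)); evals_tac. Qed.
Lemma ev_D_E6 q : cabs q < 1 ->
  2 * ev (D (fps_E6 R)) q = ev P q * ev (fps_E6 R) q - ev (fps_E4 R) q ^+ 2.
Proof. by move=> q1; apply: (evals_eq (fps_D_E6 R) (q := q)); evals_tac. Qed.

End Modular.

Section Components.
Variable R : realType.
Local Notation C := R[i].

Lemma connected_locally_constant (B : set C) (T : Type) (H : C -> T) (z w : C) :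
  connected (B : set C^o) -> B z -> B w ->
  (forall x, B x -> exists2 d : R, 0 < d &
     forall y, cabs (y - x) < d -> H y = H x) -> H z = H w.
Proof.
move=> Bc Bz Bw Hloc.
pose S (Q : T -> Prop) : set C^o := [set y | exists x, exists d : R,
  [/\ B x, Q (H x), 0 < d, (forall y, cabs (y - x) < d -> H y = H x) & cabs (y - x) < d]].
have Sopen Q : open (S Q).
  rewrite openE => y [x [d [Bx Qx d0 hd yx]]]; apply/(@nbhs_ballP _ C^o).
  exists (d - cabs (y - x))%:C => /=; first by rewrite ltcR subr_gt0.
  move=> y'; rewrite /ball /= /ball_ normr_cabs ltcR => yy'.
  exists x, d; split=> //.
  have := cabs_dist_le y' x y; rewrite (cabsB_sym y' y); lra.
pose Q0 := fun t => t = H z.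
have e1 : B `&` S Q0 = B `&` [set y | H y = H z].
  apply/seteqP; split=> y [By].
    by move=> [x [d [Bx Qx d0 hd yx]]]; split=> //=; rewrite hd.
  move=> /= Hy; split=> //; have [d d0 hd] := Hloc y By.
  by exists y, d; split=> //; rewrite subrr cabs0.
have e2 : B `&` ~` S (fun t => ~ Q0 t) = B `&` [set y | H y = H z].
  apply/seteqP; split=> y [By].
    move=> nS; split=> //=; apply: contrapT => Hy; apply: nS.
    by have [d d0 hd] := Hloc y By; exists y, d; split=> //; rewrite subrr cabs0.
  move=> /= Hy; split=> // -[x [d [Bx Qx d0 hd yx]]]; apply: Qx.
  by rewrite /Q0 -Hy hd.
have /seteqP[_ /(_ w Bw)[_ /= ->]] : B `&` [set y | H y = H z] = B.
  apply: Bc.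
  - by exists z.
  - by exists (S Q0); [exact: Sopen|rewrite e1].
  - by exists (~` S (fun t => ~ Q0 t)); [exact: open_closedC|rewrite e2].
by [].
Qed.

End Components.

(** * The hypergeometric equation *)

Section Hypergeometric.
Variable R : realType.
Local Notation C := R[i].
Local Notation D := (@fps_D R).
Local Notation X := (fps_X R 1).

Fixpoint hyp_coef (n : nat) : R := if n is m.+1 then
  hyp_coef m * ((m%:R + 1 / 3) * (m%:R + 2 / 3) / m.+1%:R ^+ 2) else 1.

Lemma hyp_coef_bounds n : 0 < hyp_coef n <= 1.
Proof.
elim: n => [|n /andP[h0 h1]] /=; first by rewrite ltr01 lexx.
have n0 : 0 <= n%:R :> R by [].
have n1 : 0 < n.+1%:R ^+ 2 :> R by rewrite exprn_gt0.
apply/andP; split.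
  by rewrite !mulr_gt0 ?invr_gt0 //; lra.
rewrite -[leRHS]mulr1; apply: ler_pM => //; first exact: ltW.
rewrite ler_pdivrMr // [leRHS]mul1r -[n.+1%:R]natr1.
move: n0; move: (n%:R : R) => m m0; nra.
Qed.

Definition hyp_fps : fps R := Fps hyp_coef.

Lemma tame_hyp : tame hyp_fps.
Proof.
apply: (@tame_bounded _ _ 1) => n; have /andP[h0 h1] := hyp_coef_bounds n.
by rewrite /= ger0_norm // ltW.
Qed.

Lemma pochhammerS (a : C) n : pochhammer a n.+1 = pochhammer a n * (a + n%:R).
Proof. by rewrite /pochhammer big_ord_recr. Qed.

Lemma hyp_coefE n : pochhammer (1 / 3 : C) n * pochhammer (2 / 3) n /
  (pochhammer 1 n * n`!%:R) = (hyp_coef n)%:C.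
Proof.
elim: n => [|n IH].
  by rewrite /pochhammer !big_ord0 !mul1r invr1.
have p1 m : pochhammer (1 : C) m != 0.
  elim: m => [|m IHm]; first by rewrite /pochhammer big_ord0 oner_eq0.
  by rewrite pochhammerS mulf_neq0 // addrC natr1 pnatr_eq0.
have f0 : n`!%:R != 0 :> C by rewrite pnatr_eq0 -lt0n fact_gt0.
have -> : hyp_coef n.+1 =
  hyp_coef n * ((n%:R + 1 / 3) * (n%:R + 2 / 3) / n.+1%:R ^+ 2) by [].
have rM (x y : R) : (x * y)%:C = x%:C * y%:C by exact: rmorphM.
rewrite !pochhammerS factS natrM rM -IH.
have -> : ((n%:R + 1 / 3) * (n%:R + 2 / 3) / n.+1%:R ^+ 2)%:C =
    (n%:R + 1 / 3) * (n%:R + 2 / 3) / n.+1%:R ^+ 2 :> C.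
  rewrite rmorphM fmorphV rmorphXn rmorphM !rmorphD !rmorphM !fmorphV.
  by rewrite !rmorph_nat rmorph1.
have n1 : 1 + n%:R != 0 :> C by rewrite addrC natr1 pnatr_eq0.
rewrite -[n.+1%:R]natr1; field.
by rewrite f0 p1 andbT addrC n1.
Qed.

Lemma hyp2F1E (z : C) : hyp2F1 (1 / 3) (2 / 3) 1 z = ev hyp_fps z.
Proof.
rewrite /hyp2F1 /ev; congr climn; apply/funext => N; rewrite /psums /series /=.
by apply: eq_bigr => k _; rewrite hyp_coefE.
Qed.

(* The hypergeometric equation, in the self-adjoint form
   (x (1 - x) F')' = (2/9) F. *)
Lemma hyp_ode : 9 * D ((1 - X) * D hyp_fps) = 2 * X * hyp_fps.
Proof.
apply/fpsP => n; rewrite -mulrA !coefs_natM coefs_fps_D mulrBl mul1r coefsB.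
rewrite !coefs_XM !coefs_fps_D; case: n => [|n]; first by rewrite !mul0r !mulr0.
rewrite /= subn1 /= -[n.+1%:R]natr1; have n0 : 0 <= n%:R :> R by [].
by field; apply/eqP; lra.
Qed.

(* The logarithmic solution at 0 is F log x + K. *)
Fixpoint hyp_log_coef (n : nat) : R := if n is m.+1 then
  ((m%:R * m.+1%:R + 2 / 9) * hyp_log_coef m - 2 * m.+1%:R * hyp_coef m.+1
   + (2 * m%:R + 1) * hyp_coef m) / m.+1%:R ^+ 2 else 0.

Definition hyp_log_fps : fps R := Fps hyp_log_coef.

Lemma hyp_log_coef_bound n : `|hyp_log_coef n| <= 4 * n%:R.
Proof.
elim: n => [|n IH]; first by rewrite /= normr0 mulr0.
have /andP[h0 h1] := hyp_coef_bounds n; have /andP[k0 k1] := hyp_coef_bounds n.+1.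
have n0 : 0 <= n%:R :> R by [].
have n1 : 0 < n.+1%:R ^+ 2 :> R by rewrite exprn_gt0.
rewrite [hyp_log_coef n.+1]/= -/(hyp_coef n.+1) normrM normfV.
rewrite (ger0_norm (ltW n1)) ler_pdivrMr //.
move: IH h0 h1 k0 k1 n0; move: (hyp_coef n) (hyp_coef n.+1) (hyp_log_coef n).
rewrite -[n.+1%:R]natr1; move: n%:R => m c c' e IH h0 h1 k0 k1 m0.
apply: le_trans (ler_normD _ _) _.
rewrite [X in _ + X]ger0_norm; last by rewrite mulr_ge0 ?(ltW h0) //; lra.
apply: le_trans (lerD (ler_normB _ _) (lexx _)) _.
rewrite normrM [X in X * _]ger0_norm; last by rewrite addr_ge0 ?mulr_ge0 //; lra.
rewrite [X in _ + X + _]ger0_norm; last by rewrite !mulr_ge0 ?(ltW k0) //; lra.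
have : (m * (m + 1) + 2 / 9) * `|e| <= (m * (m + 1) + 2 / 9) * (4 * m).
  by rewrite ler_wpM2l // addr_ge0 ?mulr_ge0 //; lra.
have : (2 * (m + 1)) * c' <= (2 * (m + 1)) * 1 by rewrite ler_wpM2l //; lra.
have : (2 * m + 1) * c <= (2 * m + 1) * 1 by rewrite ler_wpM2l //; lra.
have : 0 <= m * m by rewrite mulr_ge0.
have : 0 <= m * m * m by rewrite !mulr_ge0.
nra.
Qed.

Lemma tame_hyp_log : tame hyp_log_fps.
Proof.
apply: (@tame_dom _ _ (fps_const 4 * Fps (fun n => n%:R ^+ 1))).
  move=> n; rewrite coefs_constM /= expr1.
  by rewrite [leRHS]ger0_norm ?mulr_ge0 // hyp_log_coef_bound.
by apply: tameM; [exact: tame_const|exact: tame_natpow].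
Qed.

Lemma hyp_log_ode : 9 * D ((1 - X) * D hyp_log_fps) =
  2 * X * hyp_log_fps - 18 * D hyp_fps + 18 * X * D hyp_fps + 9 * X * hyp_fps.
Proof.
apply/fpsP => n; rewrite -!(mulrA _ X) !(coefsD, coefsN) !coefs_natM coefs_fps_D.
rewrite mulrBl mul1r coefsB !coefs_XM !coefs_fps_D.
case: n => [|n]; first by rewrite !mul0r !mulr0 !addr0 ?subr0 ?oppr0.
rewrite /= subn1 /= -[n.+1%:R]natr1; have n0 : 0 <= n%:R :> R by [].
by field; apply/eqP; lra.
Qed.

Lemma fps_D_eq0 (s : fps R) : D s = 0 -> s = fps_const (coefs s 0).
Proof.
move=> /fpsP h; apply/fpsP => -[//|n]; have := h n.+1; rewrite coefs0 coefs_fps_D.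
by move=> /eqP; rewrite mulf_eq0 pnatr_eq0 /= => /eqP.
Qed.

Lemma hyp_wronskian : (1 - X) * hyp_fps ^+ 2 +
  (1 - X) * (D hyp_log_fps * hyp_fps - hyp_log_fps * D hyp_fps) = 1.
Proof.
have := hyp_ode; have := hyp_log_ode.
set F := hyp_fps; set K := hyp_log_fps => hK hF.
have DX : D X = X by rewrite fps_D_X mul1r.
set S := LHS; have DS : D S = 0.
  apply: (@fps_nat_eq0 R 9) => //; rewrite subr0.
  have -> : S = (1 - X) * F ^+ 2 + (((1 - X) * D K) * F - K * ((1 - X) * D F)).
    by rewrite /S; ring.
  rewrite fps_DD fps_DB [D ((1 - X) * F ^+ 2)]fps_DM fps_DX.
  rewrite [D ((1 - X) * D K * F)]fps_DM [D (K * _)]fps_DM [D (1 - X)]fps_DB fps_D1 DX /=.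
  transitivity (9 * ((0 - X) * F ^+ 2 + (1 - X) * (2 * F ^+ 1 * D F)) +
    (9 * D ((1 - X) * D K)) * F - K * (9 * D ((1 - X) * D F)) ); first by ring.
  by rewrite hK hF; ring.
rewrite (fps_D_eq0 DS) (_ : coefs S 0 = 1) //.
have D0 (s : fps R) : coefs (D s) 0 = 0 by rewrite coefs_fps_D mul0r.
have X0 : coefs (1 - X) 0 = 1 by rewrite coefsB coefs1 subr0.
have F0 : coefs F 0 = 1 by [].
by rewrite /S coefsD !coefs0M X0 coefsB !coefs0M !D0 F0; ring.
Qed.

End Hypergeometric.

Section Continuation.
Variable R : realType.
Local Notation C := R[i].
Local Notation D := (@fps_D R).
Local Notation X := (fps_X R 1).
Local Notation P := (ev (fps_E2 R)).
Local Notation a := (ev (fps_a R)).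
Local Notation c := (ev (fps_c3 R)).
Local Notation F := (hyp_fps R).
Local Notation K := (hyp_log_fps R).
Implicit Types (q z w tau : C).

Definition xq q : C := c q / a q ^+ 3.

Definition inU q := [/\ cabs q < 1, q != 0, a q != 0 & cabs (xq q) < 1].

Lemma xq_ccont q : cabs q < 1 -> a q != 0 -> ccont xq q.
Proof.
move=> q1 a0; apply: ccont_div; first exact: ev_ccont (@tame_c3 R) q1.
  by apply: ccontX; exact: ev_ccont (@tame_a R) q1.
by rewrite expf_neq0.
Qed.

Lemma inU_open q : inU q -> exists2 d : R, 0 < d & forall w, cabs (w - q) < d -> inU w.
Proof.
move=> [q1 q0 a0 x1].
have [d1 d10 h1] := ccont_lt (ccont_id q) q1.
have [d2 d20 h2] := ccont_neq0 (ccont_id q) q0.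
have [d3 d30 h3] := ccont_neq0 (ev_ccont (@tame_a R) q1) a0.
have [d4 d40 h4] := ccont_lt (xq_ccont q1 a0) x1.
exists (Num.min (Num.min d1 d2) (Num.min d3 d4)); first by rewrite !lt_min d10 d20 d30.
by move=> w; rewrite !lt_min => /andP[/andP[/h1 ? /h2 ?] /andP[/h3 ? /h4 ?]].
Qed.

Definition qder (f : C -> C) q l := cder f q (l / q).

Lemma qder_eq f q l l' : qder f q l -> l = l' -> qder f q l'.
Proof. by move=> ? <-. Qed.
Lemma qderM f g q l l' : qder f q l -> qder g q l' ->
  qder (fun w => f w * g w) q (l * g q + f q * l').
Proof. by move=> df dg; apply: cder_eq (cderM df dg) _; ring. Qed.
Lemma qderB f g q l l' : qder f q l -> qder g q l' ->
  qder (fun w => f w - g w) q (l - l').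
Proof. by move=> df dg; apply: cder_eq (cderB df dg) _; ring. Qed.
Lemma qderD f g q l l' : qder f q l -> qder g q l' ->
  qder (fun w => f w + g w) q (l + l').
Proof. by move=> df dg; apply: cder_eq (cderD df dg) _; ring. Qed.
Lemma qderZ k f q l : qder f q l -> qder (fun w => k * f w) q (k * l).
Proof. by move=> df; apply: cder_eq (cderM (cder_cst k q) df) _; ring. Qed.
Lemma qderX f q l n : qder f q l -> qder (fun w => f w ^+ n) q (n%:R * f q ^+ n.-1 * l).
Proof. by move=> df; apply: cder_eq (cderX n df) _; ring. Qed.
Lemma qder_cst k q : qder (fun=> k) q 0.
Proof. by apply: cder_eq (cder_cst k q) _; rewrite mul0r. Qed.
Lemma qder_div f g q l l' : q != 0 -> g q != 0 -> qder f q l -> qder g q l' ->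
  qder (fun w => f w / g w) q ((l * g q - f q * l') / g q ^+ 2).
Proof.
by move=> q0 g0 df dg; apply: cder_eq (cder_div g0 df dg) _; field; rewrite q0.
Qed.

Lemma qder_ev s q : tame s -> cabs q < 1 -> q != 0 -> qder (ev s) q (ev (D s) q).
Proof.
move=> ts q1 q0; apply: cder_eq (cder_ev ts q1) _.
by rewrite ev_fps_D // mulrAC mulfV // mul1r.
Qed.

Lemma c_xq q : inU q -> c q = xq q * a q ^+ 3.
Proof. by move=> [_ _ a0 _]; rewrite /xq divfK // expf_neq0. Qed.

Lemma b_xq q : inU q -> ev (fps_b3 R) q = a q ^+ 3 * (1 - xq q).
Proof.
move=> Uq; have [q1 _ _ _] := Uq; have := ev_c3_a q1; rewrite (c_xq Uq) => h.
by rewrite mulrBr mulr1 (mulrC _ (xq q)) h; ring.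
Qed.

Lemma D_a_xq q : inU q ->
  ev (D (fps_a R)) q = a q * (P q + a q ^+ 2 * (4 * xq q - 1)) / 12.
Proof.
move=> Uq; have [q1 _ _ _] := Uq; have := ev_D_a q1; rewrite (b_xq Uq) => h.
by apply: (@mulfI _ 12); [rewrite pnatr_eq0|rewrite h; field].
Qed.

Lemma D_c_xq q : inU q ->
  ev (D (fps_c3 R)) q = (P q + 3 * a q ^+ 2) * (xq q * a q ^+ 3) / 4.
Proof.
move=> Uq; have [q1 _ _ _] := Uq; have := ev_D_c3 q1; rewrite (c_xq Uq) => h.
by apply: (@mulfI _ 4); [rewrite pnatr_eq0|rewrite h; field].
Qed.

Lemma D_P_xq q : inU q ->
  ev (D (fps_E2 R)) q = (P q ^+ 2 - a q ^+ 4 * (1 + 8 * xq q)) / 12.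
Proof.
move=> Uq; have [q1 _ _ _] := Uq; have := ev_D_E2 q1; rewrite ev_E4_c3 // (c_xq Uq) => h.
by apply: (@mulfI _ 12); [rewrite pnatr_eq0|rewrite h; field].
Qed.

Lemma qder_xq q : inU q -> qder xq q (a q ^+ 2 * xq q * (1 - xq q)).
Proof.
move=> Uq; have [q1 q0 a0 _] := Uq.
have da := qder_ev (@tame_a R) q1 q0; have dc := qder_ev (@tame_c3 R) q1 q0.
apply: qder_eq (qder_div q0 _ dc (qderX 3 da)) _; first by rewrite expf_neq0.
rewrite (D_a_xq Uq) (D_c_xq Uq) (c_xq Uq) /=.
by move: (P q) (xq q) (a q) a0 => p x A a0; field.
Qed.

Lemma qder_comp_xq s q : tame s -> inU q ->
  qder (fun w => ev s (xq w)) q (a q ^+ 2 * (1 - xq q) * ev (D s) (xq q)).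
Proof.
move=> ts Uq; have [q1 q0 a0 x1] := Uq.
apply: cder_eq (cder_comp (qder_xq Uq) (cder_ev ts x1)) _.
rewrite ev_fps_D //. move: (xq q) (a q) (ev (fps_deriv s) _) => x A f.
by field.
Qed.

Lemma ev_hyp_theta x : cabs x < 1 -> ev ((1 - X) * D F) x = (1 - x) * ev (D F) x.
Proof.
move=> x1; have tF := @tame_hyp R; have tX := @tame_X R 1.
rewrite evM ?evB ?ev1 ?ev_X //; last exact: tame_D.
  exact: tame1.
by apply: tameB => //; exact: tame1.
Qed.

Lemma tame_hyp_theta : tame ((1 - X) * D F).
Proof.
apply: tameM; last by apply: tame_D; exact: tame_hyp.
by apply: tameB; [exact: tame1|exact: tame_X].
Qed.

Lemma ev_hyp_ode x : cabs x < 1 -> ev (D ((1 - X) * D F)) x = 2 / 9 * x * ev F x.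
Proof.
move=> x1; have tF := @tame_hyp R; have tX := @tame_X R 1.
have := congr1 (fun s => ev s x) (hyp_ode R).
have t2X : tame (2 * X) by apply: tameM => //; exact: tame_nat.
rewrite evM ?ev_nat //; [|exact: tame_nat|apply: tame_D; exact: tame_hyp_theta].
rewrite [in X in _ = X -> _]evM // [in X in _ = X -> _]evM ?ev_nat ?ev_X ?expr1 //;
  last exact: tame_nat.
move=> h; apply: (@mulfI _ 9); first by rewrite pnatr_eq0.
by rewrite h; field.
Qed.

Definition gq q : C := (P q + a q ^+ 2 * (4 * xq q - 1)) / (12 * a q).

Definition Gq q : C := ev ((1 - X) * D F) (xq q).

(* Up to the factor x (1 - x), this is the Wronskian of a and F o x
   with respect to x, both being solutions of the hypergeometric equation. *)
Definition Wq q : C := ev F (xq q) * gq q - a q * Gq q.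

Lemma qder_gq q : inU q -> qder gq q (2 / 9 * a q ^+ 3 * xq q * (1 - xq q)).
Proof.
move=> Uq; have [q1 q0 a0 _] := Uq.
have da := qder_ev (@tame_a R) q1 q0; have dP := qder_ev (@tame_E2 R) q1 q0.
have dx := qder_xq Uq.
have d1 := qderB (qderZ 4 dx) (qder_cst 1 q).
have d2 := qderD dP (qderM (qderX 2 da) d1).
apply: qder_eq (qder_div q0 _ d2 (qderZ 12 da)) _.
  by rewrite mulf_neq0 // pnatr_eq0.
rewrite (D_a_xq Uq) (D_P_xq Uq) /=.
by move: (P q) (xq q) (a q) a0 => p x A a0; field.
Qed.

Lemma qder_Wq q : inU q -> qder Wq q 0.
Proof.
move=> Uq; have [q1 q0 a0 x1] := Uq.
have da := qder_ev (@tame_a R) q1 q0.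
have dF := qder_comp_xq (@tame_hyp R) Uq; have dG := qder_comp_xq tame_hyp_theta Uq.
apply: qder_eq (qderB (qderM dF (qder_gq Uq)) (qderM da dG)) _.
rewrite (D_a_xq Uq) ev_hyp_ode // /gq /Gq !ev_hyp_theta //.
move: (ev F _) (ev (D F) _) => f g.
by move: (P q) (xq q) (a q) a0 => p x A a0; field.
Qed.

Lemma D_a_gq q : inU q -> ev (D (fps_a R)) q = a q ^+ 2 * gq q.
Proof. by move=> Uq; have [_ _ a0 _] := Uq; rewrite (D_a_xq Uq) /gq;
   move: (P q) (xq q) (a q) a0 => p x A a0; field. Qed.

Definition hq q : C := ev F (xq q) / a q.

Lemma qder_hq q : inU q -> qder hq q (- Wq q).
Proof.
move=> Uq; have [q1 q0 a0 x1] := Uq.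
have da := qder_ev (@tame_a R) q1 q0.
have dF := qder_comp_xq (@tame_hyp R) Uq.
apply: qder_eq (qder_div q0 a0 dF da) _.
rewrite (D_a_gq Uq) /Wq /Gq ev_hyp_theta //.
move: (ev F _) (ev (D F) _) (gq q) => f g h.
by move: (xq q) (a q) a0 => x A a0; field.
Qed.

Definition fps_c3_shift : fps R := Fps (fun n => coefs (fps_c3 R) n.+1).
Local Notation cs := (ev fps_c3_shift).

Lemma fps_c3_shiftE : fps_c3 R = X * fps_c3_shift.
Proof.
apply/fpsP => -[|n]; rewrite coefs_XM; first by rewrite coefs0_c3.
by rewrite subn1.
Qed.

Lemma tame_c3_shift : tame fps_c3_shift.
Proof.
move=> r /mid_radius[rho [t [rho0 rrho rho1 t01 rE]]].
have [|M M0 hM] := @tame_c3 R rho; first by rewrite (ltW rho0).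
exists (M / rho); first by rewrite divr_ge0 // ltW.
have /andP[t0 _] := t01; have r0 : 0 <= r by rewrite rE mulr_ge0 // ltW.
move=> n; rewrite ler_pdivlMr //; apply: le_trans (hM n.+1).
rewrite exprSr mulrA; apply: ler_wpM2r; first exact: ltW.
apply: (ler_wpM2l (normr_ge0 _)).
by rewrite lerXn2r ?nnegrE ?(ltW rrho) ?(ltW rho0).
Qed.

Lemma c_shift q : cabs q < 1 -> c q = q * cs q.
Proof.
move=> q1; rewrite fps_c3_shiftE evM ?ev_X ?expr1 //; first exact: tame_X.
exact: tame_c3_shift.
Qed.

Lemma D_c_shift q : cabs q < 1 -> ev (D (fps_c3 R)) q = q * cs q + q * ev (D fps_c3_shift) q.
Proof.
move=> q1; have ts := tame_c3_shift; have tDs := tame_D ts; have tX := @tame_X R 1.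
rewrite fps_c3_shiftE fps_DM fps_D_X mul1r evD ?evM ?ev_X ?expr1 //; exact: tameM.
Qed.

Definition kq q : C := cs q / (27 * a q ^+ 3) * cexp (ev K (xq q) / ev F (xq q)).

Lemma ev_hyp_wronskian x : cabs x < 1 -> (1 - x) * ev F x ^+ 2 +
  (1 - x) * (ev (D K) x * ev F x - ev K x * ev (D F) x) = 1.
Proof.
move=> x1; have tF := @tame_hyp R; have tK := @tame_hyp_log R; have tX := @tame_X R 1.
have tDF := tame_D tF; have tDK := tame_D tK; have tF2 := tameX 2 tF.
have t1X : tame (1 - X) by apply: tameB => //; exact: tame1.
have tKF := tameM tDK tF; have tFK := tameM tK tDF; have tB := tameB tKF tFK.
have := congr1 (fun s => ev s x) (hyp_wronskian R); rewrite ev1 => h; rewrite -[RHS]h.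
rewrite evD; [|exact: tameM|exact: tameM|by []].
rewrite (evM t1X tF2 x1) (evM t1X tB x1) (evB tKF tFK x1) (evM tDK tF x1) (evM tK tDF x1).
by rewrite (evX 2 tF x1) (evB (@tame1 R) tX x1) ev1 ev_X expr1.
Qed.

Lemma qder_kq q : inU q -> ev F (xq q) = a q -> qder kq q 0.
Proof.
move=> Uq Fa; have [q1 q0 a0 x1] := Uq.
have F0 : ev F (xq q) != 0 by rewrite Fa.
have da := qder_ev (@tame_a R) q1 q0; have ds := qder_ev tame_c3_shift q1 q0.
have dF := qder_comp_xq (@tame_hyp R) Uq; have dK := qder_comp_xq (@tame_hyp_log R) Uq.
have dKF := qder_div q0 F0 dK dF.
have dE := cder_comp dKF (cder_cexp _).
have a30 : 27 * a q ^+ 3 != 0.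
  by apply: mulf_neq0; [rewrite pnatr_eq0|exact: expf_neq0].
have dq := qder_div q0 a30 ds (qderZ 27 (qderX 3 da)).
apply: cder_eq (cderM dq dE) _.
have := ev_hyp_wronskian x1; rewrite Fa => hw.
have Dc : q * ev (D fps_c3_shift) q = (P q + 3 * a q ^+ 2) * (q * cs q) / 4 - q * cs q.
  by apply: (addrI (q * cs q)); rewrite -D_c_shift // (D_c_xq Uq) -(c_xq Uq) c_shift //; ring.
have Ds : ev (D fps_c3_shift) q = (P q + 3 * a q ^+ 2) * cs q / 4 - cs q.
  by apply: (mulfI q0); rewrite Dc; field.
rewrite (D_a_xq Uq) Ds mul0r /=.
set e := cexp _; move: hw; move: (ev (D K) _) (ev (D F) _) (ev K _) e => DK DF k e.
move: (P q) (xq q) (a q) (cs q) a0 => p x A s a0 hw.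
transitivity (s * e / (27 * A ^+ 3 * q) *
  ((1 - x) * A ^+ 2 + (1 - x) * (DK * A - k * DF) - 1)).
  by field; rewrite a0 q0.
by rewrite hw subrr mulr0.
Qed.

End Continuation.

(** * Continuation along the component of the cusp *)

Section Component.
Variable R : realType.
Local Notation C := R[i].
Local Notation D := (@fps_D R).
Local Notation P := (ev (fps_E2 R)).
Local Notation a := (ev (fps_a R)).
Local Notation c := (ev (fps_c3 R)).
Local Notation b := (ev (fps_b3 R)).
Local Notation F := (hyp_fps R).
Local Notation K := (hyp_log_fps R).
Local Notation cs := (ev (fps_c3_shift R)).
Implicit Types (q z w tau : C) (H : C -> C).

Lemma region_inU z : region3B z -> [/\ 0 < complex.Im z, inU (nome z),
  xq (nome z) = (1 - hauptmodul z)^-1 & 1 - hauptmodul z != 0].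
Proof.
move=> [[z0 _ _ _]]; rewrite normr_cabs ltcR => u1.
have q1 := nome_lt1 z0; have q0 := nome_neq0 z.
have c0 := ev_c3_neq0 q1 q0.
have uE : 1 - hauptmodul z = a (nome z) ^+ 3 / c (nome z).
  by rewrite hauptmodulE // ev_c3_a //; move: c0; rewrite ev_c3_a // => c0; field.
have u0 : 1 - hauptmodul z != 0.
  by rewrite -cabs_gt0; apply: lt_trans ltr01 u1.
have a0 : a (nome z) != 0.
  by apply: contraNneq u0 => e; rewrite uE e expr0n mul0r.
have xE : xq (nome z) = (1 - hauptmodul z)^-1 by rewrite uE invf_div.
split=> //; split=> //.
by rewrite xE cabsV invf_lt1 // (lt_trans ltr01).
Qed.

Lemma qder0_local H q (d : R) : 0 < d ->
  (forall w, cabs (w - q) < d -> qder H w 0) ->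
  forall w, cabs (w - q) < d -> H w = H q.
Proof.
move=> d0 hd; apply: cder0_ball => w /hd.
by rewrite /qder mul0r.
Qed.

Definition component_of z (B : set C) :=
  [/\ connected (B : set C^o), B z & B `<=` (region3B : set C)].

Lemma component_const H z : C3B_infty z ->
  (forall B, component_of z B -> forall x, B x -> exists2 d : R, 0 < d &
     forall w, cabs (w - nome x) < d -> H w = H (nome x)) ->
  (forall B, component_of z B -> forall x, B x -> H (nome x) = H (nome z)) /\
  (ccont H 0 -> H (nome z) = H 0).
Proof.
move=> [rz hz] Hloc.
have cst B : component_of z B -> forall x, B x -> H (nome x) = H (nome z).
  move=> Bc x Bx; have [Bconn Bz _] := Bc.
  apply: (@connected_locally_constant _ B _ (fun y => H (nome y)) x z Bconn Bx Bz) => y By.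
  have [d d0 hd] := Hloc B Bc y By.
  have [d' d'0 hd'] := cder_ccont (cder_nome y) d0.
  by exists d' => // w /hd' /hd.
split=> // cH; apply/eqP; rewrite -subr_eq0 -cabs_eq0; apply/negPn/negP => n0.
have e0 : 0 < cabs (H (nome z) - H 0) by rewrite lt_neqAle eq_sym n0 cabs_ge0.
have [d d0 hd] := cH _ e0.
have [w + wM] := hz `|ln d|; rewrite /connected_component => -[B [Bz Bsub Bconn] Bw].
suff wd : cabs (nome w - 0) < d.
  by have := hd _ wd; rewrite (cst B (And3 Bconn Bz Bsub) w Bw) ltxx.
rewrite subr0 cabs_nome -[X in _ < X]lnK ?posrE // ltr_expR.
have : 2 <= (pi : R) := pi_ge2 R.
have := ler_norm (- ln d); rewrite normrN.
have := normr_ge0 (ln d); nra.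
Qed.

Lemma xq0 : xq (0 : C) = 0.
Proof. by rewrite /xq ev_at0 coefs0_c3 mul0r. Qed.
Lemma a_at0 : a (0 : C) = 1.
Proof. by rewrite ev_at0 coefs0_a. Qed.
Lemma F_at0 : ev F (0 : C) = 1.
Proof. exact: ev_at0. Qed.
Lemma K_at0 : ev K (0 : C) = 0.
Proof. exact: ev_at0. Qed.

Lemma cabs0_lt1 : cabs (0 : C) < 1. Proof. by rewrite cabs0. Qed.

Lemma xq_ccont0 : ccont (@xq R) 0.
Proof. by apply: xq_ccont; [exact: cabs0_lt1|rewrite a_at0 oner_eq0]. Qed.

Lemma ev_xq_ccont0 s : tame s -> ccont (fun w : C => ev s (xq w)) 0.
Proof.
move=> ts; apply: ccont_comp xq_ccont0 _; rewrite xq0.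
exact: ev_ccont ts cabs0_lt1.
Qed.

Lemma a_ccont0 : ccont a (0 : C).
Proof. exact: ev_ccont (@tame_a R) cabs0_lt1. Qed.

Lemma Wq_component z B x : C3B_infty z -> component_of z B -> B x -> Wq (nome x) = 0.
Proof.
move=> Cz Bc Bx; have [|cst lim] := @component_const (@Wq R) z Cz.
  move=> B' [_ _ Bsub] y By; have [_ Uy _ _] := region_inU (Bsub y By).
  have [d d0 hd] := inU_open Uy; exists d; first exact: d0. apply: (qder0_local d0) => w /hd Uw.
  exact: qder_Wq.
rewrite (cst B Bc x Bx) lim.
  rewrite /Wq /gq /Gq xq0 a_at0 F_at0 !ev_at0.
  rewrite (_ : coefs (_ * _) 0 = 0); last by rewrite coefs0M coefs_fps_D mul0r mulr0.
  rewrite (_ : coefs (fps_E2 R) 0 = 1); last first.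
    by rewrite coefsB coefs_natM coefs0_lambert_sum mulr0 subr0 coefs1.
  by rewrite !mulr0 expr1n subr0 !mul1r sub0r subrr mul0r.
apply: ccontB; apply: ccontM.
- exact: ev_xq_ccont0 (@tame_hyp R).
- apply: ccont_div.
  + apply: ccontD; first exact: ev_ccont (@tame_E2 R) cabs0_lt1.
    apply: ccontM; first by apply: ccontX; exact: a_ccont0.
    apply: ccontB; last exact: ccont_cst.
    by apply: ccontM; [exact: ccont_cst|exact: xq_ccont0].
  + by apply: ccontM; [exact: ccont_cst|exact: a_ccont0].
  + by rewrite a_at0 mulr1 pnatr_eq0.
- exact: a_ccont0.
- exact: ev_xq_ccont0 (@tame_hyp_theta R).
Qed.

Lemma hq_component z : C3B_infty z ->
  (forall B, component_of z B -> forall x, B x -> exists2 d : R, 0 < d &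
     forall w, cabs (w - nome x) < d -> hq w = hq (nome x)) /\
  forall B x, component_of z B -> B x -> hq (nome x) = 1.
Proof.
move=> Cz.
have loc B : component_of z B -> forall x, B x -> exists2 d : R, 0 < d &
     forall w, cabs (w - nome x) < d -> hq w = hq (nome x).
  move=> Bc x Bx; have [_ _ Bsub] := Bc; have [_ Ux _ _] := region_inU (Bsub x Bx).
  have W0 := Wq_component Cz Bc Bx.
  have [d d0 hd] := inU_open Ux; exists d; first exact: d0. apply: (qder0_local d0) => w wd.
  have Uw := hd _ wd; apply: qder_eq (qder_hq Uw) _.
  rewrite (@qder0_local (@Wq R) (nome x) d d0 _ w wd) ?W0 ?oppr0 // => y /hd.
  exact: qder_Wq.
split=> // B x Bc Bx; have [cst lim] := component_const Cz loc.
rewrite (cst B Bc x Bx) lim; first by rewrite /hq xq0 F_at0 a_at0 divr1.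
apply: ccont_div; [exact: ev_xq_ccont0 (@tame_hyp R)|exact: a_ccont0|].
by rewrite a_at0 oner_eq0.
Qed.

Lemma component_self z : C3B_infty z -> exists B, component_of z B.
Proof.
move=> [_ /(_ 0)[w + _]]; rewrite /connected_component => -[B [Bz Bsub Bconn] _].
by exists B.
Qed.

Lemma hyp_a z : C3B_infty z -> ev F (xq (nome z)) = a (nome z).
Proof.
move=> Cz; have [_ h] := hq_component Cz; have [B Bc] := component_self Cz.
have [Bconn Bz Bsub] := Bc; have [_ [_ _ a0 _] _ _] := region_inU (Bsub z Bz).
by rewrite -[LHS](divfK a0) -/(hq (nome z)) (h B z Bc Bz) mul1r.
Qed.

Lemma hyp_theta_gq z : C3B_infty z -> Gq (nome z) = gq (nome z).
Proof.
move=> Cz; have [B Bc] := component_self Cz; have [Bconn Bz Bsub] := Bc.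
have [_ [_ _ a0 _] _ _] := region_inU (Bsub z Bz).
have := Wq_component Cz Bc Bz; rewrite /Wq hyp_a // -mulrBr => /eqP.
by rewrite mulf_eq0 (negbTE a0) /= subr_eq0 => /eqP.
Qed.

Lemma nome_of_xq z : C3B_infty z ->
  xq (nome z) * cexp (ev K (xq (nome z)) / ev F (xq (nome z))) = 27 * nome z.
Proof.
move=> Cz; have [B Bc] := component_self Cz; have [Bconn Bz Bsub] := Bc.
have [_ [q1 q0 a0 x1] _ _] := region_inU (Bsub z Bz).
have [hloc h1] := hq_component Cz.
have [|cst lim] := @component_const (@kq R) z Cz.
  move=> B' B'c y By; have [_ _ B'sub] := B'c.
  have [_ Uy _ _] := region_inU (B'sub y By).
  have [d d0 hd] := inU_open Uy; have [d' d'0 hd'] := hloc B' B'c y By.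
  exists (Num.min d d'); first by rewrite lt_min d0.
  apply: qder0_local; first by rewrite lt_min d0.
  move=> w; rewrite lt_min => /andP[/hd Uw /hd' hw]; apply: (qder_kq Uw).
  have [_ _ aw0 _] := Uw; move: hw; rewrite (h1 B' y B'c By) => hw.
  by rewrite -[LHS](divfK aw0) -/(hq w) hw mul1r.
have k1 : kq (nome z) = 1.
  rewrite lim.
    have cs0 : cs (0 : C) = 27.
      by rewrite ev_at0 -[coefs _ 0]/(coefs (fps_c3 R) 1) coefs1_c3 rmorph_nat.
    rewrite /kq xq0 F_at0 K_at0 a_at0 cs0 mul0r cexp0 expr1n !mulr1.
    by rewrite mulfV // pnatr_eq0.
  apply: ccontM.
    apply: ccont_div; first exact: ev_ccont (@tame_c3_shift R) cabs0_lt1.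
      by apply: ccontM; [exact: ccont_cst|apply: ccontX; exact: a_ccont0].
    by rewrite a_at0 expr1n mulr1 pnatr_eq0.
  apply: (@ccont_comp _ (fun w => ev K (xq w) / ev F (xq w)) (@cexp R)).
    apply: ccont_div; [exact: ev_xq_ccont0 (@tame_hyp_log R)| |].
      exact: ev_xq_ccont0 (@tame_hyp R).
    by rewrite xq0 F_at0 oner_eq0.
  exact: cder_ccont (cder_cexp _).
move: k1; rewrite /kq; set e := cexp _ => k1.
transitivity (27 * nome z * (cs (nome z) / (27 * a (nome z) ^+ 3) * e)); last first.
  by rewrite k1 mulr1.
rewrite {1}/xq (c_shift q1).
clear k1; move: (nome z) (cs _) (a _) a0 e => q s A A0 e.
by field.
Qed.

End Component.

HB.lock Definition evr (R : realType) (s : fps R) (t : R) : R := complex.Re (ev s t%:C).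

Section RealEval.
Variable R : realType.
Local Notation C := R[i].
Local Notation D := (@fps_D R).
Implicit Types (s : fps R) (t : R).

Lemma evrE s t : tame s -> `|t| < 1 -> ev s t%:C = (evr s t)%:C.
Proof.
move=> ts t1; have := ev_real t1 ts; rewrite evr.unlock.
by case: (ev s _) => p q /= ->.
Qed.

Lemma evr_eq (x y : R) : x%:C = y%:C :> C -> x = y.
Proof. by case. Qed.

Lemma is_derive_evr s t : tame s -> `|t| < 1 ->
  is_derive t 1 (evr s) (evr (fps_deriv s) t).
Proof.
move=> ts t1; have tz : cabs (0 + t%:C * 1 : C) < 1 by rewrite add0r mulr1 cabs_real.
have [+ _] := cder_line (cder_ev ts tz).
rewrite evr.unlock mulr1 add0r mulr1 => h.
have e : (fun y : R => complex.Re (ev s (0 + y%:C * 1))) = (fun y : R => complex.Re (ev s y%:C)).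
  by apply/funext => y; rewrite mulr1 add0r.
exact: (eq_ind _ (fun g : R -> R => is_derive t 1 g _) h _ e).
Qed.

Lemma evr_D s t : tame s -> `|t| < 1 -> evr (D s) t = t * evr (fps_deriv s) t.
Proof.
move=> ts t1; apply: evr_eq; rewrite -evrE //; last exact: tame_D.
rewrite ev_fps_D ?cabs_real // evrE ?rmorphM //; exact: tame_deriv.
Qed.

Lemma evr0 s : evr s 0 = coefs s 0.
Proof. by rewrite evr.unlock ev_at0. Qed.

Definition rpsums s t N := \sum_(0 <= k < N) coefs s k * t ^+ k.

Lemma psums_real s t N : psums s t%:C N = (rpsums s t N)%:C.
Proof.
by rewrite /rpsums rmorph_sum; apply: eq_bigr => k _; rewrite rmorphM rmorphXn.
Qed.

Lemma evr_lim s t : tame s -> `|t| < 1 -> forall e : R, 0 < e ->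
  exists N, forall n, (N <= n)%N -> `|rpsums s t n - evr s t| < e.
Proof.
move=> ts t1 e e0; have tz : cabs (t%:C : C) < 1 by rewrite cabs_real.
have [N hN] := ev_clim ts tz e0; exists N => n /hN.
by rewrite psums_real evrE // -rmorphB cabs_real.
Qed.

Lemma evr_ge_rpsums s t N : tame s -> 0 <= t < 1 -> (forall n, 0 <= coefs s n) ->
  rpsums s t N <= evr s t.
Proof.
move=> ts /andP[t0 t1] s0; apply/ler_addgt0Pr => e e0.
have t1' : `|t| < 1 by rewrite ger0_norm.
have [M hM] := evr_lim ts t1' e0; have := hM (maxn M N) (leq_maxl _ _).
have : rpsums s t N <= rpsums s t (maxn M N).
  rewrite /rpsums (big_cat_nat (n := N) (p := maxn M N)) ?leq_maxr //= lerDl.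
  by rewrite sumr_ge0 // => k _; rewrite mulr_ge0 ?exprn_ge0.
rewrite ltr_norml; lra.
Qed.

Lemma evr_mono s t t' : tame s -> 0 <= t -> t <= t' -> t' < 1 ->
  (forall n, 0 <= coefs s n) -> evr s t <= evr s t'.
Proof.
move=> ts t0 tt' t1 s0; apply/ler_addgt0Pr => e e0.
have t'0 := le_trans t0 tt'.
have h1 : `|t| < 1 by rewrite ger0_norm // (le_lt_trans tt').
have [M hM] := evr_lim ts h1 e0; have := hM M (leqnn _).
have : rpsums s t M <= rpsums s t' M.
  by apply: ler_sum => k _; rewrite ler_wpM2l // lerXn2r ?nnegrE.
have : rpsums s t' M <= evr s t' by apply: evr_ge_rpsums => //; rewrite t'0.
move: (evr s t) (evr s t') (rpsums s t M) (rpsums s t' M) => A B1 C1 D1.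
rewrite ltr_norml; lra.
Qed.

Lemma evr_continuous s t : tame s -> `|t| < 1 -> {for t, continuous (evr s)}.
Proof.
move=> ts t1; apply: differentiable_continuous; apply/derivable1_diffP.
exact: (@ex_derive _ _ _ _ _ _ _ (is_derive_evr ts t1)).
Qed.

Lemma deriv0_const (f : R -> R) (x y : R) :
  (forall t, 0 < t < 1 -> is_derive t 1 f 0) -> 0 < x < 1 -> 0 < y < 1 -> f x = f y.
Proof.
move=> df; wlog xy : x y / x < y.
  move=> hw hx hy; case: (ltgtP x y) => [xy|yx|->//]; first exact: hw.
  by apply/esym/hw.
move=> /andP[x0 x1] /andP[y0 y1].
pose dF (s : R) : R := 0.
have F1 (t : R) : t \in `]x, y[ -> is_derive t 1 f (dF t).
  by rewrite in_itv /= => /andP[xt ty]; apply: df; lra.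
have F2 : {within `[x, y], continuous f}.
  apply: derivable_within_continuous => t; rewrite in_itv /= => /andP[xt ty].
  by apply: (@ex_derive _ _ _ _ _ _ _ (df t _)); lra.
have [t tI] := MVT xy F1 F2.
by rewrite /dF mul0r => /eqP; rewrite subr_eq0 => /eqP.
Qed.

End RealEval.

(** * The real zero of E6 *)

Section RealModular.
Variable R : realType.
Local Notation C := R[i].
Local Notation rc := (real_complex R).
Local Notation D := (@fps_D R).
Implicit Types (t : R).
Local Notation P := (evr (fps_E2 R)).
Local Notation Q := (evr (fps_E4 R)).
Local Notation E6r := (evr (fps_E6 R)).
Local Notation a := (evr (fps_a R)).
Local Notation b := (evr (fps_b3 R)).
Local Notation c := (evr (fps_c3 R)).
Local Notation Phi := (evr (fps_euler R)).

Lemma absr_lt1 t : 0 <= t < 1 -> `|t| < 1.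
Proof. by move=> /andP[t0 t1]; rewrite ger0_norm. Qed.

Lemma evr_D_E2 t : `|t| < 1 -> 12 * evr (D (fps_E2 R)) t = P t ^+ 2 - Q t.
Proof.
move=> t1; have tz : cabs (t%:C : C) < 1 by rewrite cabs_real.
have := ev_D_E2 tz; rewrite !evrE //; [|exact: tame_E4|exact: tame_E2|by apply: tame_D; exact: tame_E2].
by rewrite -(rmorph_nat (real_complex R)) -rmorphXn -rmorphB -rmorphM => /evr_eq.
Qed.
Lemma evr_D_E4 t : `|t| < 1 -> 3 * evr (D (fps_E4 R)) t = P t * Q t - E6r t.
Proof.
move=> t1; have tz : cabs (t%:C : C) < 1 by rewrite cabs_real.
have := ev_D_E4 tz; rewrite !evrE //; [|exact: tame_E6|exact: tame_E4|exact: tame_E2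
  |by apply: tame_D; exact: tame_E4].
by rewrite -(rmorph_nat (real_complex R)) -!rmorphM -rmorphB => /evr_eq.
Qed.
Lemma evr_D_E6 t : `|t| < 1 -> 2 * evr (D (fps_E6 R)) t = P t * E6r t - Q t ^+ 2.
Proof.
move=> t1; have tz : cabs (t%:C : C) < 1 by rewrite cabs_real.
have := ev_D_E6 tz; rewrite !evrE //; [|exact: tame_E4|exact: tame_E6|exact: tame_E2
  |by apply: tame_D; exact: tame_E6].
by rewrite -(rmorph_nat (real_complex R)) -rmorphXn -!rmorphM -rmorphB => /evr_eq.
Qed.

Lemma evr_euler_gt0 t : 0 <= t < 1 -> 0 < Phi t.
Proof.
move=> t01; have t1 := absr_lt1 t01; have tz : cabs (t%:C : C) < 1 by rewrite cabs_real.
have te := @tame_euler R.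
have := ev_euler_neq0 tz; rewrite evrE // => n0.
rewrite lt_neqAle; apply/andP; split.
  by apply: contra_neq n0 => <-.
rewrite leNgt; apply/negP => neg.
have e0 : 0 < - Phi t by rewrite oppr_gt0.
have [N /(_ N (leqnn N))] := euler_clim tz e0.
have -> : \prod_(1 <= n < N) (1 - t%:C ^+ n) = (\prod_(1 <= n < N) (1 - t ^+ n))%:C.
  by rewrite rmorph_prod; apply: eq_bigr => n _; rewrite rmorphB rmorph1 rmorphXn.
rewrite evrE // -rmorphB cabs_real ltr_norml => /andP[_].
suff : 0 <= \prod_(1 <= n < N) (1 - t ^+ n) by lra.
have /andP[t0 t1'] := t01.
by apply: prodr_ge0 => n _; rewrite subr_ge0 exprn_ile1 // ltW.
Qed.

Lemma evr_b3_gt0 t : 0 < t < 1 -> 0 < b t.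
Proof.
move=> /andP[t0 t1]; have t01 : 0 <= t < 1 by rewrite ltW.
have ta1 := absr_lt1 t01; have tz : cabs (t%:C : C) < 1 by rewrite cabs_real.
have te := @tame_euler R.
have t31 : 0 <= t ^+ 3 < 1 by rewrite exprn_ge0 ?(ltW t0) //= exprn_ilt1 // ltW.
have := ev_b3_euler tz; rewrite -rmorphXn !evrE ?absr_lt1 //; last exact: tame_b3.
rewrite -!(rmorphXn rc) -(rmorphM rc) => /evr_eq h.
have p3 := evr_euler_gt0 t31; have p1 := evr_euler_gt0 t01.
by rewrite -(pmulr_lgt0 _ (exprn_gt0 3 p3)) h exprn_gt0.
Qed.
Lemma evr_c3_gt0 t : 0 < t < 1 -> 0 < c t.
Proof.
move=> /andP[t0 t1]; have t01 : 0 <= t < 1 by rewrite ltW.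
have ta1 := absr_lt1 t01; have tz : cabs (t%:C : C) < 1 by rewrite cabs_real.
have te := @tame_euler R.
have t31 : 0 <= t ^+ 3 < 1 by rewrite exprn_ge0 ?(ltW t0) //= exprn_ilt1 // ltW.
have := ev_c3_euler tz; rewrite -rmorphXn !evrE ?absr_lt1 //; last exact: tame_c3.
rewrite -(rmorph_nat rc) -!(rmorphXn rc) -!(rmorphM rc) => /evr_eq h.
have p3 := evr_euler_gt0 t31; have p1 := evr_euler_gt0 t01.
by rewrite -(pmulr_lgt0 _ (exprn_gt0 3 p1)) h !mulr_gt0 // exprn_gt0.
Qed.

Lemma discriminant_gt0 t : 0 < t < 1 -> E6r t ^+ 2 < Q t ^+ 3.
Proof.
move=> t01; have bt := evr_b3_gt0 t01; have ct := evr_c3_gt0 t01.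
have /andP[t0 t1] := t01; have ta1 : `|t| < 1 by rewrite absr_lt1 // ltW.
have tz : cabs (t%:C : C) < 1 by rewrite cabs_real.
have := ev_c3_a tz; have := ev_E4_c3 tz; have := ev_E6_c3 tz.
rewrite !evrE //; try first [exact: tame_a|exact: tame_b3|exact: tame_c3|exact: tame_E4|exact: tame_E6].
rewrite -!(rmorph_nat rc) -!(rmorphXn rc) -!(rmorphM rc) -?(rmorphD rc) -?(rmorphB rc) -?(rmorphM rc).
rewrite -?(rmorphB rc) => /evr_eq -> /evr_eq -> /evr_eq h.
have -> : c t = a t ^+ 3 - b t by [].
rewrite -subr_gt0; have -> : (a t * (a t ^+ 3 + 8 * (a t ^+ 3 - b t))) ^+ 3 -
  (a t ^+ 6 - 20 * a t ^+ 3 * (a t ^+ 3 - b t) - 8 * (a t ^+ 3 - b t) ^+ 2) ^+ 2 =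
  64 * (a t ^+ 3 - b t) * b t ^+ 3 by ring.
by rewrite -h !mulr_gt0 // exprn_gt0.
Qed.

Lemma coefs_lambert_pow_ge k n : (0 < n)%N -> 1 <= coefs (lambert_sum (pow R k)) n.
Proof.
move=> n0; rewrite coefs_lambert_sum big_nat_recl //.
rewrite coefs_lambert_atom n0 dvd1n /pow expr1n mulr1 lerDl sumr_ge0 // => d _.
by rewrite mulr_ge0 ?exprn_ge0.
Qed.

Lemma coefs_E4_ge n : 1 <= coefs (fps_E4 R) n.
Proof.
rewrite coefsD coefs_natM coefs1; case: n => [|n].
  by rewrite coefs0_lambert_sum mulr0 addr0.
have := coefs_lambert_pow_ge 3 (ltn0Sn n); rewrite /=; lra.
Qed.

Lemma E4_ge_sum t N : 0 <= t < 1 -> \sum_(0 <= k < N) t ^+ k <= Q t.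
Proof.
move=> t01; have /andP[t0 t1] := t01.
apply: le_trans (evr_ge_rpsums N (@tame_E4 R) t01 _); last first.
  by move=> n; apply: le_trans (coefs_E4_ge n).
by apply: ler_sum => k _; rewrite -[leLHS]mul1r ler_wpM2r ?exprn_ge0 // coefs_E4_ge.
Qed.

Lemma E4_ge1 t : 0 <= t < 1 -> 1 <= Q t.
Proof. by move=> t01; have := E4_ge_sum 1 t01; rewrite big_nat1 expr0. Qed.

Lemma E4_unbounded (M : R) : exists2 t0 : R, t0 < 1 & forall t, t0 < t -> 0 <= t < 1 -> M < Q t.
Proof.
have [N hN] : exists N : nat, `|M| * 2 + 2 < N%:R.
  by exists (Num.bound (`|M| * 2 + 2)); apply: archi_boundP; rewrite addr_ge0 ?mulr_ge0.
have N0 : 0 < N%:R :> R by have := normr_ge0 M; lra.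
exists (1 - 1 / (2 * N%:R)); first by rewrite gtrBl divr_gt0 // mulr_gt0.
move=> t tt t01; have /andP[t0 t1] := t01.
apply: lt_le_trans (E4_ge_sum N t01).
have tN k : 1 - k%:R * (1 - t) <= t ^+ k.
  elim: k => [|k IH]; first by rewrite mul0r subr0 expr0.
  rewrite exprS -natr1; have : 0 <= k%:R :> R by [].
  have : t * (1 - k%:R * (1 - t)) <= t * t ^+ k by rewrite ler_wpM2l.
  have : 0 <= k%:R * ((1 - t) * (1 - t)) by rewrite !mulr_ge0 // subr_ge0 ltW.
  nra.
apply: (@lt_le_trans _ _ (\sum_(0 <= k < N) (2^-1 : R))).
  rewrite sumr_const_nat subn0 -mulr_natl; have := ler_norm M; lra.
apply: ler_sum_nat => k /andP[_ kN]; apply: le_trans (tN k).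
have : k%:R * (1 - t) <= N%:R * (1 - t).
  by rewrite ler_wpM2r ?subr_ge0 ?(ltW t1) // ler_nat ltnW.
have : (1 - t) * (2 * N%:R) <= 1.
  by rewrite -ler_pdivlMr ?mulr_gt0 //; lra.
lra.
Qed.

End RealModular.

Section Theta.
Variable R : realType.
Local Notation D := (@fps_D R).
Implicit Types (f g : R -> R) (t l m : R).

(* The derivative of f along t d/dt. *)
Definition thd f t l := is_derive t 1 f (t^-1 * l).

Lemma thd_eq f t l m : thd f t l -> l = m -> thd f t m.
Proof. by move=> h <-. Qed.

Lemma thdD f g t l m : thd f t l -> thd g t m -> thd (fun x => f x + g x) t (l + m).
Proof. by move=> hf hg; rewrite /thd mulrDr; exact: is_deriveD. Qed.

Lemma thdB f g t l m : thd f t l -> thd g t m -> thd (fun x => f x - g x) t (l - m).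
Proof. by move=> hf hg; rewrite /thd mulrBr; exact: is_deriveB. Qed.

Lemma thdM f g t l m : thd f t l -> thd g t m ->
  thd (fun x => f x * g x) t (l * g t + f t * m).
Proof.
move=> hf hg; rewrite /thd mulrDr.
have -> : t^-1 * (l * g t) + t^-1 * (f t * m) = f t * (t^-1 * m) + g t * (t^-1 * l) by ring.
exact: is_deriveM.
Qed.

Lemma thd_cst (k t : R) : thd (fun=> k) t 0.
Proof. by rewrite /thd mulr0; exact: is_derive_cst. Qed.

Lemma thdZ f (k t l : R) : thd f t l -> thd (fun x => k * f x) t (k * l).
Proof. by move=> hf; apply: (thd_eq (thdM (thd_cst k t) hf)); rewrite mul0r add0r. Qed.

Lemma thd_comp f g t l (d : R) : thd f t l -> is_derive (f t) 1 g d ->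
  thd (fun x => g (f x)) t (d * l).
Proof.
move=> hf hg; rewrite /thd mulrCA mulrC mulrC.
exact: is_derive1_comp.
Qed.

Lemma thdV f t l : f t != 0 -> thd f t l -> thd (fun x => (f x)^-1) t (- l / f t ^+ 2).
Proof.
move=> f0 hf; rewrite /thd.
have -> : t^-1 * (- l / f t ^+ 2) = - (f t) ^- 2 *: (t^-1 * l).
  by rewrite /GRing.scale /=; ring.
exact: is_deriveV.
Qed.

Lemma thd_sqrt f t l : 0 < f t -> thd f t l ->
  thd (fun x => Num.sqrt (f x)) t (l / (2 * Num.sqrt (f t))).
Proof.
by move=> f0 hf; apply: (thd_eq (thd_comp hf (is_derive1_sqrt f0))); rewrite mulrC.
Qed.

Lemma thd_ln t : 0 < t -> thd (@ln R) t 1.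
Proof. by move=> t0; rewrite /thd mulr1; exact: is_derive1_ln. Qed.

Lemma thd_evr s t : tame s -> 0 < t < 1 -> thd (evr s) t (evr (D s) t).
Proof.
move=> ts /andP[t0 t1]; have ta : `|t| < 1 by rewrite gtr0_norm.
rewrite /thd (evr_D ts ta) mulKf ?gt_eqF //; exact: is_derive_evr.
Qed.

Lemma thd_evr_comp s f t l : tame s -> `|f t| < 1 -> thd f t l ->
  thd (fun x => evr s (f x)) t (evr (fps_deriv s) (f t) * l).
Proof. by move=> ts f1 hf; apply: (thd_comp hf); exact: is_derive_evr. Qed.

Lemma thd0_const f (x y : R) : (forall t, 0 < t < 1 -> thd f t 0) ->
  0 < x < 1 -> 0 < y < 1 -> f x = f y.
Proof. by move=> hf; apply: deriv0_const => t /hf; rewrite /thd mulr0. Qed.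

End Theta.

Section Legendre.
Variable R : realType.
Local Notation D := (@fps_D R).
Local Notation X := (fps_X R 1).

Fixpoint leg_coef (c0 c1 : R) (n : nat) : R :=
  if n is k.+1 then
    if k is m.+1 then
      leg_coef c0 c1 m * ((m%:R * m.+1%:R + 5 / 36) / (m.+1%:R * m.+2%:R))
    else c1
  else c0.

Lemma leg_coefSS c0 c1 m : leg_coef c0 c1 m.+2 =
  leg_coef c0 c1 m * ((m%:R * m.+1%:R + 5 / 36) / (m.+1%:R * m.+2%:R)).
Proof. by []. Qed.

Lemma nat_ind2 (Q : nat -> Prop) : Q 0%N -> Q 1%N -> (forall n, Q n -> Q n.+2) ->
  forall n, Q n.
Proof.
move=> Q0 Q1 QS n; suff [] : Q n /\ Q n.+1 by [].
by elim: n => [|n [IH1 IH2]]; split => //; exact: QS.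
Qed.

Definition leg (c0 c1 : R) : fps R := Fps (leg_coef c0 c1).

Lemma tame_leg c0 c1 : tame (leg c0 c1).
Proof.
apply: (@tame_bounded _ _ (`|c0| + `|c1|)); apply: nat_ind2 => [||n IH].
- by rewrite /= lerDl.
- by rewrite /= lerDr.
- rewrite [coefs _ _]leg_coefSS normrM; apply: le_trans IH.
  rewrite -[leRHS]mulr1; apply: ler_wpM2l => //.
  have n0 : 0 <= n%:R :> R by [].
  have p : 0 < n.+1%:R * n.+2%:R :> R by rewrite mulr_gt0.
  rewrite ger0_norm; last by rewrite divr_ge0 ?(ltW p) // addr_ge0 ?mulr_ge0 //; lra.
  rewrite ler_pdivrMr // mul1r -[n.+2%:R]natr1 -[n.+1%:R]natr1.
  move: n0; move: (n%:R : R) => x x0; nra.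
Qed.

Lemma leg_ode c0 c1 : fps_deriv ((1 - X ^+ 2) * fps_deriv (leg c0 c1)) =
  fps_const (5 / 36) * leg c0 c1.
Proof.
apply/fpsP => n; rewrite coefs_constM.
have E k : coefs ((1 - X ^+ 2) * fps_deriv (leg c0 c1)) k.+1 =
    k.+2%:R * leg_coef c0 c1 k.+2 - (if k is m.+1 then k%:R * leg_coef c0 c1 k else 0).
  rewrite mulrBl mul1r coefsB expr2 -mulrA !coefs_XM.
  by case: k => [|k]; rewrite /= ?subn1.
have -> : coefs (fps_deriv ((1 - X ^+ 2) * fps_deriv (leg c0 c1))) n =
   n.+1%:R * coefs ((1 - X ^+ 2) * fps_deriv (leg c0 c1)) n.+1 by [].
rewrite E leg_coefSS [coefs (leg _ _) _]/=.
have n0 : 0 <= n%:R :> R by [].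
rewrite -[n.+2%:R]natr1 -[n.+1%:R]natr1.
case: n n0 => [|n] n0; first by rewrite subr0; field.
move: n0; move: (leg_coef _ _ _) (n.+1%:R : R) => l x x0; field.
by apply/andP; split; apply/eqP; lra.
Qed.

Lemma leg_wronskian : leg 1 0 * ((1 - X ^+ 2) * fps_deriv (leg 0 1)) -
  leg 0 1 * ((1 - X ^+ 2) * fps_deriv (leg 1 0)) = 1.
Proof.
have oE := leg_ode 1 0; have oO := leg_ode 0 1.
set GE := (1 - X ^+ 2) * fps_deriv (leg 1 0) in oE *.
set GO := (1 - X ^+ 2) * fps_deriv (leg 0 1) in oO *.
set S := LHS; have DS : D S = 0.
  rewrite /S fps_DB [D (leg 1 0 * _)]fps_DM [D (leg 0 1 * _)]fps_DM !fps_D_deriv oE oO.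
  by rewrite /GE /GO; ring.
rewrite (fps_D_eq0 DS) (_ : coefs S 0 = 1) //.
have h (s : fps R) : coefs ((1 - X ^+ 2) * s) 0 = coefs s 0.
  by rewrite coefs0M coefsB coefs1 coefs0X /= expr0n subr0 mul1r.
by rewrite /S coefsB (coefs0M (leg 1 0)) (coefs0M (leg 0 1)) !h /= !mul1r mul0r subr0.
Qed.

Lemma evr_opp (s : fps R) (t : R) :
  evr s (- t) = evr (Fps (fun n => (-1) ^+ n * coefs s n)) t.
Proof.
rewrite evr.unlock /ev; congr (complex.Re (climn _)); apply/funext => N.
apply: eq_bigr => k _; rewrite [coefs (Fps _) k]/=.
have -> : ((-1) ^+ k * coefs s k)%:C = (-1) ^+ k * (coefs s k)%:C :> R[i].
  by rewrite (rmorphM (real_complex R)) rmorphXn rmorphN1.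
by rewrite (rmorphN (real_complex R)) (exprNn t%:C) mulrCA mulrA.
Qed.

Lemma leg_coef_sign c0 c1 n : (-1) ^+ n * leg_coef c0 c1 n = leg_coef c0 (- c1) n.
Proof.
move: n; apply: nat_ind2 => [||n IH]; first by rewrite mul1r.
  by rewrite expr1 mulN1r.
by rewrite !leg_coefSS -IH !exprS; ring.
Qed.

Lemma leg_coefN c0 c1 n : leg_coef (- c0) (- c1) n = - leg_coef c0 c1 n.
Proof. by move: n; apply: nat_ind2 => // n IH; rewrite !leg_coefSS IH mulNr. Qed.

Lemma evr_leg_even t : evr (leg 1 0) (- t) = evr (leg 1 0) t.
Proof.
rewrite evr_opp; congr evr; apply/fpsP => n.
by rewrite [LHS]leg_coef_sign oppr0.
Qed.

Lemma evr_leg_odd t : `|t| < 1 -> evr (leg 0 1) (- t) = - evr (leg 0 1) t.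
Proof.
move=> t1; rewrite evr_opp.
have -> : Fps (fun n => (-1) ^+ n * coefs (leg 0 1) n) = - leg 0 1 :> fps R.
  by apply/fpsP => n; rewrite coefsN [LHS]leg_coef_sign -{1}[0]oppr0 leg_coefN.
have tl := @tame_leg 0 1.
apply: evr_eq; rewrite -evrE //; last exact: tameN.
by rewrite evN ?cabs_real // evrE // rmorphN.
Qed.

End Legendre.

Section EllipticPoint.
Variable R : realType.
Local Notation D := (@fps_D R).
Local Notation X := (fps_X R 1).
Local Notation P := (evr (fps_E2 R)).
Local Notation Q := (evr (fps_E4 R)).
Local Notation E6r := (evr (fps_E6 R)).
Implicit Types t : R.

Definition root4 t : R := Num.sqrt (Num.sqrt (Q t)).
Definition ratio6 t : R := E6r t / root4 t ^+ 6.
Definition slope t : R := - (P t / root4 t - root4 t * ratio6 t) / 6.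

Local Notation f := root4.
Local Notation v := ratio6.
Local Notation gf := slope.

Lemma root4_gt0 t : 0 <= t < 1 -> 0 < f t.
Proof. by move=> t01; rewrite !sqrtr_gt0 (lt_le_trans _ (E4_ge1 t01)). Qed.

Lemma root4X4 t : 0 <= t < 1 -> f t ^+ 4 = Q t.
Proof.
move=> t01; have Q1 := E4_ge1 t01; rewrite -[4%N]/(2 * 2)%N exprM.
by rewrite sqr_sqrtr ?sqrtr_ge0 // sqr_sqrtr // (le_trans _ Q1).
Qed.

Lemma oo_co t : 0 < t < 1 -> 0 <= t < 1.
Proof. by move=> /andP[t0 t1]; rewrite (ltW t0). Qed.

Lemma oo_abs t : 0 < t < 1 -> `|t| < 1.
Proof. by move=> /oo_co; exact: absr_lt1. Qed.

Lemma E6_ratio t : 0 <= t < 1 -> E6r t = v t * f t ^+ 6.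
Proof. by move=> t01; rewrite divfK // expf_neq0 // gt_eqF // root4_gt0. Qed.

Lemma ratio6_abs t : 0 < t < 1 -> `|v t| < 1.
Proof.
move=> t01; have f0 := root4_gt0 (oo_co t01).
rewrite -(@ltr_pXn2r _ 2) ?nnegrE // real_normK ?num_real // expr1n.
have := discriminant_gt0 t01; rewrite (E6_ratio (oo_co t01)) -(root4X4 (oo_co t01)).
rewrite exprMn -!exprM -[ltRHS]mul1r ltr_pM2r // exprn_gt0 //.
Qed.

Lemma thd_root4 t : 0 < t < 1 -> thd f t (- 2^-1 * f t ^+ 2 * gf t).
Proof.
move=> t01; have ft := root4_gt0 (oo_co t01); have /andP[t0 t1] := t01.
have Qt : 0 < Q t by apply: lt_le_trans (E4_ge1 (oo_co t01)).
have hQ := thd_evr (@tame_E4 R) t01.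
have sQ : 0 < Num.sqrt (Q t) by rewrite sqrtr_gt0.
have h := @thd_sqrt R (fun x => Num.sqrt (Q x)) t _ sQ (thd_sqrt Qt hQ).
apply: (@thd_eq R root4 _ _ _ h).
have e : Num.sqrt (Q t) = f t ^+ 2 by rewrite /root4 sqr_sqrtr ?sqrtr_ge0.
have DQ := evr_D_E4 (oo_abs t01); have := E6_ratio (oo_co t01).
rewrite /slope -/(root4 t) e; have := root4X4 (oo_co t01).
move: DQ ft; move: (f t) (v t) (P t) (Q t) (E6r t) (evr (D _) t) => F V p q r d.
move=> DQ F0 qE rE; have -> : d = (p * F ^+ 4 - V * F ^+ 6) / 3.
  by rewrite qE -rE -DQ; field.
by field; apply/eqP; lra.
Qed.

Lemma thd_ratio6 t : 0 < t < 1 -> thd v t (- 2^-1 * f t ^+ 2 * (1 - v t ^+ 2)).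
Proof.
move=> t01; have ft := root4_gt0 (oo_co t01).
have f60 : f t ^+ 6 != 0 by rewrite expf_neq0 // gt_eqF.
have hf6 : thd (fun x => f x ^+ 6) t (6 * f t ^+ 5 * (- 2^-1 * f t ^+ 2 * gf t)).
  apply: (thd_eq (thd_comp (thd_root4 t01) (is_deriveX 6 (is_derive_id (f t) 1)))).
  by rewrite scaler1.
have h := thdM (thd_evr (@tame_E6 R) t01) (@thdV R (fun x => f x ^+ 6) t _ f60 hf6).
apply: (@thd_eq R ratio6 _ _ _ h).
have DR := evr_D_E6 (oo_abs t01); have := E6_ratio (oo_co t01); have := root4X4 (oo_co t01).
rewrite /slope; move: DR ft.
move: (f t) (v t) (P t) (Q t) (E6r t) (evr (D _) t) => F V p q r d.
move=> DQ F0 qE rE; have -> : d = (p * (V * F ^+ 6) - F ^+ 8) / 2.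
  by rewrite -rE -[8%N]/(4 * 2)%N exprM qE -DQ; field.
by rewrite rE; field; apply/eqP; lra.
Qed.

Lemma thd_slope t : 0 < t < 1 -> thd gf t (- (5 / 72) * f t ^+ 3 * (1 - v t ^+ 2)).
Proof.
move=> t01; have ft := root4_gt0 (oo_co t01).
have f0 : f t != 0 by rewrite gt_eqF.
have hf := thd_root4 t01; have hv := thd_ratio6 t01.
have hP := thd_evr (@tame_E2 R) t01.
have h := thdZ (- 6^-1) (thdB (thdM hP (thdV f0 hf)) (thdM hf hv)).
have -> : gf = (fun x => - 6^-1 * (P x * (f x)^-1 - f x * v x)).
  by apply/funext => x; rewrite /slope mulNr mulNr mulrC.
apply: (@thd_eq R _ _ _ _ h).
have DP := evr_D_E2 (oo_abs t01); have := root4X4 (oo_co t01).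
rewrite /slope; move: DP ft.
move: (f t) (v t) (P t) (Q t) (evr (D _) t) => F V p q d.
move=> DQ F0 qE; have -> : d = (p ^+ 2 - F ^+ 4) / 12.
  by rewrite qE -DQ; field.
by field; apply/eqP; lra.
Qed.

Local Notation Le := (leg (1 : R) 0).
Local Notation Lo := (leg (0 : R) 1).
Definition legp (s : fps R) : fps R := (1 - X ^+ 2) * fps_deriv s.

Lemma tame_1mX2 : tame (1 - X ^+ 2 : fps R).
Proof. by apply: tameB; [exact: tame1|apply: tameX; exact: tame_X]. Qed.

Lemma tame_legp c0 c1 : tame (legp (leg c0 c1)).
Proof. by apply: tameM; [exact: tame_1mX2|exact: tame_deriv (tame_leg _ _)]. Qed.

Lemma evr_legp c0 c1 x : `|x| < 1 ->
  evr (legp (leg c0 c1)) x = (1 - x ^+ 2) * evr (fps_deriv (leg c0 c1)) x.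
Proof.
move=> x1; have xc : cabs (x%:C : R[i]) < 1 by rewrite cabs_real.
have td := tame_deriv (tame_leg c0 c1); have tl := tame_legp c0 c1.
apply: evr_eq; rewrite -(evrE tl x1) /legp (evM tame_1mX2 td xc).
rewrite (evrE td x1) (rmorphM (real_complex R)); congr (_ * _).
rewrite evB //; [|exact: tame1|by apply: tameX; exact: tame_X].
rewrite ev1 evX //; last exact: tame_X.
by rewrite ev_X expr1 rmorphB rmorph1 rmorphXn.
Qed.

Lemma evr_deriv_legp c0 c1 x : `|x| < 1 ->
  evr (fps_deriv (legp (leg c0 c1))) x = 5 / 36 * evr (leg c0 c1) x.
Proof.
move=> x1; have xc : cabs (x%:C : R[i]) < 1 by rewrite cabs_real.
have tl := tame_leg c0 c1; have td := tame_deriv (tame_legp c0 c1).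
apply: evr_eq; rewrite -(evrE td x1) leg_ode (evM (@tame_const R _) tl xc).
by rewrite ev_const (evrE tl x1) -(rmorphM (real_complex R)).
Qed.

Lemma evr_leg_wronskian x : `|x| < 1 ->
  evr Le x * evr (legp Lo) x - evr Lo x * evr (legp Le) x = 1.
Proof.
move=> x1; have xc : cabs (x%:C : R[i]) < 1 by rewrite cabs_real.
have te := @tame_leg R 1 0; have to := @tame_leg R 0 1.
have ge := tame_legp 1 0; have go := tame_legp 0 1.
have : ev Le x%:C * ev (legp Lo) x%:C - ev Lo x%:C * ev (legp Le) x%:C = 1.
  rewrite -(evM te go xc) -(evM to ge xc) -(evB (tameM te go) (tameM to ge) xc).
  by rewrite leg_wronskian ev1.
rewrite (evrE te x1) (evrE to x1) (evrE ge x1) (evrE go x1).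
by rewrite -!(rmorphM (real_complex R)) -(rmorphB (real_complex R)) => /evr_eq.
Qed.

(* The Wronskian of f, as a function of v, with a Legendre function. *)
Definition wr c0 c1 t : R := f t * evr (legp (leg c0 c1)) (v t) - evr (leg c0 c1) (v t) * gf t.

Lemma wr_const c0 c1 (x y : R) : 0 < x < 1 -> 0 < y < 1 -> wr c0 c1 x = wr c0 c1 y.
Proof.
apply: thd0_const => t t01; have v1 := ratio6_abs t01.
have hv := thd_ratio6 t01; have hf := thd_root4 t01; have hg := thd_slope t01.
have h1 := thd_evr_comp (tame_legp c0 c1) v1 hv.
have h2 := thd_evr_comp (tame_leg c0 c1) v1 hv.
apply: (thd_eq (thdB (thdM hf h1) (thdM h2 hg))).
rewrite evr_deriv_legp // evr_legp //.
move: (f t) (v t) (gf t) (evr (leg _ _) _) (evr (fps_deriv _) _) => F V G A B; by field.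
Qed.

Lemma root4_legendre t : 0 < t < 1 -> f t = wr 0 1 t * evr Le (v t) - wr 1 0 t * evr Lo (v t).
Proof.
move=> t01; have := evr_leg_wronskian (ratio6_abs t01); rewrite /wr.
move: (evr Le _) (evr Lo _) (evr (legp Le) _) (evr (legp Lo) _) (f t) (gf t) => A B C E F G h.
by rewrite -[LHS]mulr1 -h; ring.
Qed.

Lemma leg_div_const c0 c1 (x y : R) : 0 < x < 1 -> 0 < y < 1 ->
  evr (leg c0 c1) (v x) / f x + wr c0 c1 x / 2 * ln x =
  evr (leg c0 c1) (v y) / f y + wr c0 c1 x / 2 * ln y.
Proof.
move=> hx; set w := wr c0 c1 x; move: (hx).
pose g t := evr (leg c0 c1) (v t) / f t + w / 2 * ln t.
apply: (@thd0_const _ g) => t t01; have v1 := ratio6_abs t01.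
have f0 : f t != 0 by rewrite gt_eqF // root4_gt0 // oo_co.
have t0 : 0 < t by have /andP[] := t01.
have h2 := thd_evr_comp (tame_leg c0 c1) v1 (thd_ratio6 t01).
apply: (thd_eq (thdD (thdM h2 (thdV f0 (thd_root4 t01))) (thdZ (w / 2) (thd_ln t0)))).
rewrite /w (wr_const c0 c1 hx t01) /wr evr_legp //.
by move: (f t) f0 (v t) (gf t) (evr (leg _ _) _) (evr (fps_deriv _) _) => F F0 V G A B; field.
Qed.

End EllipticPoint.

Section EllipticValue.
Variable R : realType.
Local Notation P := (evr (fps_E2 R)).
Local Notation Q := (evr (fps_E4 R)).
Local Notation E6r := (evr (fps_E6 R)).
Local Notation f := (@root4 R).
Local Notation v := (@ratio6 R).
Local Notation gf := (@slope R).
Local Notation Le := (leg (1 : R) 0).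
Local Notation Lo := (leg (0 : R) 1).
Implicit Types t : R.

Lemma root4_continuous t : 0 <= t < 1 -> {for t, continuous f}.
Proof.
move=> t01; have cQ := evr_continuous (@tame_E4 R) (absr_lt1 t01).
have c1 : {for t, continuous (@Num.sqrt R \o Q)}.
  by apply: continuous_comp => //; exact: sqrt_continuous.
exact: (continuous_comp c1 (@sqrt_continuous R _)).
Qed.

Lemma ratio6_continuous t : 0 <= t < 1 -> {for t, continuous v}.
Proof.
move=> t01; have f0 : f t ^+ 6 != 0 by rewrite expf_neq0 // gt_eqF // root4_gt0.
have c6 := continuous_comp (root4_continuous t01) (@exprn_continuous R 6 _).
have cE := evr_continuous (@tame_E6 R) (absr_lt1 t01).
exact: (cvgM cE (cvgV f0 c6)).
Qed.

Lemma ratio6_at0 : v 0 = 1.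
Proof.
have h s : coefs (1 + s : fps R) 0 = 1 + coefs s 0 by [].
have E4_0 : evr (fps_E4 R) 0 = 1.
  by rewrite evr0 coefsD coefs1 coefs_natM coefs0_lambert_sum mulr0 addr0.
have E6_0 : evr (fps_E6 R) 0 = 1.
  by rewrite evr0 coefsB coefs1 coefs_natM coefs0_lambert_sum mulr0 subr0.
by rewrite /ratio6 /root4 E4_0 E6_0 !sqrtr1 expr1n divr1.
Qed.

Lemma ratio6_decreasing (x y : R) : 0 < x -> x < y -> y < 1 -> v y < v x.
Proof.
move=> x0 xy y1.
pose dv t := t^-1 * (- 2^-1 * f t ^+ 2 * (1 - v t ^+ 2)).
have hd t : t \in `]x, y[ -> is_derive t 1 v (dv t).
  by rewrite in_itv /= => /andP[xt ty]; apply: thd_ratio6; lra.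
have hc : {within `[x, y], continuous v}.
  apply: continuous_in_subspaceT => t; rewrite inE /= in_itv /= => /andP[xt ty].
  by apply: ratio6_continuous; lra.
have [c] := MVT xy hd hc.
rewrite in_itv /= => /andP[xc cy] e; rewrite -subr_lt0 e pmulr_llt0 ?subr_gt0 //.
have c01 : 0 < c < 1 by lra.
have f0 : 0 < f c := root4_gt0 (oo_co c01).
have : 0 < 1 - v c ^+ 2.
  by rewrite subr_gt0 -real_normK ?num_real // exprn_ilt1 // ratio6_abs.
move=> w0; rewrite /dv pmulr_rlt0 ?invr_gt0 ?(lt_trans x0) //.
by rewrite mulNr mulNr oppr_lt0 !mulr_gt0 // exprn_gt0.
Qed.

Section At.
Variable q0 : R.
Hypotheses (q01 : 0 < q0 < 1) (E6q0 : E6r q0 = 0).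

Let f0_gt0 : 0 < f q0 := root4_gt0 (oo_co q01).
Let v0 : v q0 = 0. Proof. by rewrite /ratio6 E6q0 mul0r. Qed.

Lemma evr_leg_at0 c0 c1 : evr (leg c0 c1) 0 = c0 :> R.
Proof. by rewrite evr0. Qed.
Lemma evr_legp_at0 c0 c1 : evr (legp (leg c0 c1)) 0 = c1 :> R.
Proof. by rewrite evr_legp ?normr0 // evr0 expr0n subr0 mul1r /= mul1r. Qed.

Let wO : wr 0 1 q0 = f q0.
Proof. by rewrite /wr v0 evr_leg_at0 evr_legp_at0 mulr1 mul0r subr0. Qed.
Let wE : wr 1 0 q0 = P q0 / (6 * f q0).
Proof.
rewrite /wr v0 evr_leg_at0 evr_legp_at0 mulr0 mul1r sub0r /slope v0 mulr0 subr0.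
by rewrite mulNr opprK invfM mulrA mulrAC.
Qed.

Let E4_bound t : q0 < t -> t < 1 ->
  exists2 r : R, 0 <= r /\ r ^+ 4 * Q t <= Q q0 & r = 1 + P q0 / 6 * (ln q0 - ln t).
Proof.
move=> qt t1; have /andP[q0p q1] := q01; have t01 : 0 < t < 1 by lra.
have vt0 : v t < 0 by rewrite -v0; apply: ratio6_decreasing.
have vt1 := ratio6_abs t01.
have [s] : exists2 s, s \in `[0, q0] & v s = - v t.
  apply: IVT; first exact: ltW.
    apply: continuous_in_subspaceT => x; rewrite inE /= in_itv /= => /andP[xt ty].
    by apply: ratio6_continuous; lra.
  rewrite ratio6_at0 v0 (min_idPr ler01) (max_idPl ler01); move: vt1; rewrite ltr_norml; lra.
rewrite in_itv /= => /andP[s0 sq] vs.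
have s0' : 0 < s.
  rewrite lt_neqAle s0 andbT; apply: contraTneq vt1 => s_0; rewrite -leNgt.
  by rewrite -normrN -vs -s_0 ratio6_at0 normr1.
have s01 : 0 < s < 1 by lra.
have ft := root4_gt0 (oo_co t01); have fs := root4_gt0 (oo_co s01).
exists (f s / f t).
  split; first by rewrite divr_ge0 // ltW.
  rewrite expr_div_n (root4X4 (oo_co t01)) (root4X4 (oo_co s01)) divfK; last first.
    by rewrite -(root4X4 (oo_co t01)) expf_neq0 // gt_eqF.
  by apply: evr_mono => //; [exact: tame_E4|move=> n; exact: le_trans ler01 (coefs_E4_ge R n)].
have := leg_div_const 0 1 q01 t01; have := leg_div_const 1 0 q01 t01.
rewrite v0 !evr_leg_at0 wO wE mul0r add0r mul1r => hE hO.
rewrite (root4_legendre s01) (wr_const 0 1 s01 q01) (wr_const 1 0 s01 q01) wO wE vs.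
rewrite evr_leg_even evr_leg_odd //.
move: ft f0_gt0 hE hO; move: (f t) (f q0) (P q0) (ln q0) (ln t) (evr Le _) (evr Lo _).
move=> F F0 p l m A B Fp F0p hE hO.
have eA : A / F = F0^-1 + p / (6 * F0) / 2 * (l - m) by rewrite mulrBr addrA hE; ring.
have eB : B / F = F0 / 2 * (l - m) by rewrite mulrBr hO; ring.
have -> : (F0 * A - p / (6 * F0) * - B) / F = F0 * (A / F) + p / (6 * F0) * (B / F) by ring.
by rewrite eA eB; field; apply/eqP; lra.
Qed.

Lemma elliptic_E2 : P q0 * ln q0 = - 6.
Proof.
have /andP[q0p q1] := q01.
suff : 1 + P q0 / 6 * ln q0 = 0 by lra.
apply/eqP; apply/negP => /negP k0.
set k := 1 + P q0 / 6 * ln q0 in k0.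
have kp : 0 < `|k| by rewrite normr_gt0.
pose e := `|k| / 2; have e0 : 0 < e by rewrite divr_gt0.
have [t0 t01 ht0] := E4_unbounded (Q q0 / e ^+ 4).
pose p := `|P q0 / 6|; have p0 : 0 <= p by exact: normr_ge0.
pose d := e * q0 / (p + 1).
have d0 : 0 < d by rewrite divr_gt0 ?mulr_gt0 //; lra.
pose m := Num.max q0 (Num.max t0 (1 - d)).
have m1 : m < 1 by rewrite !gt_max q1 t01 /=; lra.
have [mq mt md] : [/\ q0 <= m, t0 <= m & 1 - d <= m].
  by rewrite !le_max !lexx !orbT.
pose t := (m + 1) / 2.
have [qt tt dt t1] : [/\ q0 < t, t0 < t, 1 - d < t & t < 1].
  by rewrite /t; split; lra.
have [r [r0 hr] er] := E4_bound qt t1.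
have re : r < e.
  rewrite -(@ltr_pXn2r _ 4) ?nnegrE // ?(ltW e0) //.
  have t0' : 0 <= t < 1 by lra.
  have := ht0 t tt t0'; rewrite ltr_pdivrMr ?exprn_gt0 // => h.
  have Qt : 0 < Q t := lt_le_trans ltr01 (E4_ge1 t0').
  by rewrite -(ltr_pM2r Qt) (le_lt_trans hr) // mulrC.
have lt0 : `|ln t| <= (1 - t) / q0.
  have tp : 0 < t by lra.
  have ln0 : ln t <= 0 by rewrite -ln1 ler_ln ?posrE // ltW.
  rewrite ler0_norm // -lnV ?posrE //.
  have -> : t^-1 = 1 + (t^-1 - 1) by ring.
  have ti : 0 < t^-1 by rewrite invr_gt0.
  apply: le_trans (le_ln1Dx _) _; first by lra.
  have -> : t^-1 - 1 = (1 - t) / t by field; apply/eqP; lra.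
  by rewrite ler_wpM2l ?subr_ge0 ?(ltW t1) // lef_pV2 ?posrE // ltW.
have : `|P q0 / 6 * ln t| < e.
  rewrite normrM -/p; apply: le_lt_trans (ler_wpM2l p0 lt0) _.
  have : (1 - t) / q0 < d / q0 by rewrite ltr_pM2r ?invr_gt0 //; lra.
  have -> : d / q0 = e / (p + 1) by rewrite /d; field; apply/andP; split; apply/eqP; lra.
  rewrite ltr_pdivlMr; last by lra.
  have : 0 <= (1 - t) / q0 by rewrite divr_ge0 ?subr_ge0 // ltW.
  nra.
have kE : k = r + P q0 / 6 * ln t by rewrite er /k; ring.
move=> h; have : `|k| < e + e.
  by rewrite kE; apply: le_lt_trans (ler_normD _ _) _; rewrite ltrD // ger0_norm.
by rewrite /e -splitr ltxx.
Qed.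

End At.
End EllipticValue.

(** * The main identity *)

Section RealPoints.
Variable R : realType.
Local Notation C := R[i].
Local Notation F := (hyp_fps R).
Local Notation K := (hyp_log_fps R).
Implicit Types (z : C) (r : R).

Lemma nome_polar z : nome z = (expR (- (2 * pi * complex.Im z)) * cos (2 * pi * complex.Re z)) +i*
  (expR (- (2 * pi * complex.Im z)) * sin (2 * pi * complex.Re z)) :> C.
Proof.
case: z => x y; rewrite /nome /cexp.
have -> : 2 * pi%:C * 'i * (x +i* y) = (- (2 * pi * y)) +i* (2 * pi * x) :> C.
  by apply/eqP; rewrite eq_complex /=; apply/andP; split; apply/eqP; ring.
by apply/eqP; rewrite eq_complex /=; apply/andP; split; apply/eqP; ring.
Qed.

Lemma sin_eq0_small (y : R) : `|y| < pi -> sin y = 0 -> y = 0.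
Proof.
rewrite ltr_norml => /andP[yl yu] s0; case: (ltgtP y 0) => // y0.
  have h : 0 < - y < pi by lra.
  by have := sin_gt0_pi h; rewrite sinN s0 oppr0 ltxx.
have h : 0 < y < pi by lra.
by have := sin_gt0_pi h; rewrite s0 ltxx.
Qed.

Lemma C3B_real z r : C3B_infty z -> xq (nome z) = r%:C -> complex.Re z = 0 /\ 0 < r.
Proof.
move=> Cz xr; have [[Fz _] _] := Cz; have [y0 _ _ hx] := Fz.
have [_ [_ _ _ x1] _ _] := region_inU (proj1 Cz).
have r1 : `|r| < 1 by rewrite -cabs_real -xr.
have := nome_of_xq Cz; rewrite xr (evrE (@tame_hyp R) r1) (evrE (@tame_hyp_log R) r1).
set s := evr K r / evr F r.
have -> : (evr K r)%:C / (evr F r)%:C = s%:C by rewrite /s rmorphM fmorphV.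
have -> : cexp (s%:C) = (expR s)%:C by rewrite /cexp /= cos0 sin0 mulr1.
rewrite nome_polar => /eqP; rewrite eq_complex /= => /andP[/eqP hr /eqP hi].
have e0 : 0 < expR (- (2 * pi * complex.Im z)) by exact: expR_gt0.
have s0 : 0 < expR s by exact: expR_gt0.
move: hi hr; rewrite !mulr0 !mul0r !addr0 !subr0.
move=> hi hr; have p0 := @pi_gt0 R.
have sin0' : sin (2 * pi * complex.Re z) = 0.
  apply: (mulfI (lt0r_neq0 e0)); rewrite mulr0; lra.
have : 2 * pi * complex.Re z = 0.
  apply: sin_eq0_small => //; rewrite !normrM (ger0_norm (ltW p0)) ger0_norm //.
  move: hx; nra.
move=> z0; have Re0 : complex.Re z = 0.
  by apply: (mulfI (_ : 2 * pi != 0)); rewrite ?mulr0 // mulf_neq0 ?pnatr_eq0 // gt_eqF.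
split => //; rewrite -(pmulr_lgt0 _ s0); move: hr; rewrite z0 cos0; lra.
Qed.

Lemma root_real_quadratic (x : C) : 1 - 20 * x - 8 * x ^+ 2 = 0 -> exists r : R, x = r%:C.
Proof.
case: x => x y /eqP; rewrite eq_complex /= => /andP[/eqP hr /eqP hi].
suff -> : y = 0 by exists x.
have : y * (4 * x + 5) = 0 by lra.
move=> /eqP; rewrite mulf_eq0 => /orP[/eqP //|/eqP h].
suff : 0 <= y * y by nra.
by rewrite -expr2 sqr_ge0.
Qed.
End RealPoints.

Section Values.
Variable R : realType.
Local Notation C := R[i].
Local Notation P := (ev (fps_E2 R)).
Local Notation a := (ev (fps_a R)).
Implicit Types (z : C).

Lemma E4_xq z : C3B_infty z -> E4 z = a (nome z) ^+ 4 * (1 + 8 * xq (nome z)).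
Proof.
move=> Cz; have [y0 Uq _ _] := region_inU (proj1 Cz); have [q1 _ _ _] := Uq.
by rewrite E4E // ev_E4_c3 // (c_xq Uq); ring.
Qed.

Lemma E6_xq z : C3B_infty z ->
  E6 z = a (nome z) ^+ 6 * (1 - 20 * xq (nome z) - 8 * xq (nome z) ^+ 2).
Proof.
move=> Cz; have [y0 Uq _ _] := region_inU (proj1 Cz); have [q1 _ _ _] := Uq.
by rewrite E6E // ev_E6_c3 // (c_xq Uq); ring.
Qed.

Lemma xq_neq_m8 z : C3B_infty z -> 1 + 8 * xq (nome z) != 0.
Proof.
move=> Cz; apply/eqP => e; pose r : R := - 8^-1.
have [|_] := @C3B_real _ z r Cz; last by rewrite /r oppr_gt0 invr_lt0 ltrn0.
have r8 : (r%:C : C) = - 8^-1 by rewrite /r rmorphN fmorphV rmorph_nat.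
rewrite r8; apply: (@mulfI _ 8); first by rewrite pnatr_eq0.
by rewrite mulrN mulfV ?pnatr_eq0 //; apply/eqP; rewrite -subr_eq0 opprK addrC e.
Qed.

(* In this region E6 vanishes only on the imaginary axis. *)
Lemma E2star_eq0 z : C3B_infty z -> E6 z = 0 -> E2star z = 0.
Proof.
move=> Cz; have [y0 [q1 q0 a0 _] _ _] := region_inU (proj1 Cz).
move=> e6; have := e6; rewrite (E6_xq Cz) => /eqP; rewrite mulf_eq0 expf_eq0 (negbTE a0) /=.
move=> /eqP /root_real_quadratic[r xr]; have [x0 _] := C3B_real Cz xr.
pose t : R := expR (- (2 * pi * complex.Im z)).
have tq : nome z = t%:C by rewrite nome_polar x0 mulr0 cos0 sin0 mulr1 mulr0.
have t01 : 0 < t < 1 by rewrite expR_gt0 -expR0 ltr_expR oppr_lt0 !mulr_gt0 // pi_gt0.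
have ta := oo_abs t01.
have E6t : evr (fps_E6 R) t = 0.
  by apply: evr_eq; rewrite -(evrE (@tame_E6 R) ta) -tq -E6E.
have := elliptic_E2 t01 E6t; rewrite expRK => h.
have p0 := @pi_gt0 R.
have {}h : evr (fps_E2 R) t = 3 / (pi * complex.Im z).
  apply: (mulIf (_ : pi * complex.Im z != 0)); first by rewrite mulf_neq0 ?gt_eqF.
  by rewrite divfK ?mulf_neq0 ?gt_eqF //; lra.
rewrite /E2star E2E // tq (evrE (@tame_E2 R) ta) h.
by rewrite rmorphM fmorphV rmorph_nat subrr.
Qed.

Lemma cderive_hyp_sqr z : C3B_infty z ->
  (1 - (1 - hauptmodul z)^-1) * cderive (fun x => hyp2F1 (1 / 3) (2 / 3) 1 (1 / (1 - x)) ^+ 2) (hauptmodul z) =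
  2 * (1 - hauptmodul z)^-1 * a (nome z) * gq (nome z).
Proof.
move=> Cz; have [y0 Uq xu u1] := region_inU (proj1 Cz); have [q1 q0 a0 x1] := Uq.
set u := hauptmodul z in xu u1 *; set q := nome z in xu q1 q0 a0 x1 *.
have d1 : cder (fun x : C => 1 / (1 - x)) u ((1 - u)^-1 ^+ 2).
  have h := cder_div (g := fun x => 1 - x) u1 (cder_cst 1 u) (cderB (cder_cst 1 u) (cder_id u)).
  apply: (@cder_eq R _ _ _ _ h).
  by field.
have xe : 1 / (1 - u) = xq q by rewrite div1r xu.
have x1' : cabs (1 / (1 - u)) < 1 by rewrite xe.
have d2 := cderX 2 (cder_comp d1 (cder_ev (@tame_hyp R) x1')).
have -> : (fun x => hyp2F1 (1 / 3) (2 / 3) 1 (1 / (1 - x)) ^+ 2) =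
    (fun x : C => ev (hyp_fps R) (1 / (1 - x)) ^+ 2).
  by apply/funext => x; rewrite hyp2F1E.
rewrite (cder_cderive d2) xe -xu (hyp_a Cz) -(hyp_theta_gq Cz) /Gq ev_hyp_theta // ev_fps_D //.
  move: (ev (fps_deriv _) _) => f; rewrite -/q /= expr1; ring.
exact: tame_hyp.
Qed.

End Values.

Lemma complex_quadratic (R : realType) (a b d : int) (tau : R[i]) : 0 < a ->
  0 < complex.Im tau -> tau = (- b%:~R + sqrtC (- d%:~R)) / (2 * a%:~R) ->
  sqrtC (d%:~R : R[i]) = 2 * a%:~R * (complex.Im tau)%:C.
Proof.
move=> a0 y0 htau; set s := sqrtC (- d%:~R) in htau.
have a0' : (0 : R) < a%:~R by rewrite ltr0z.
have aC : a%:~R = (a%:~R : R)%:C :> R[i] by rewrite rmorph_int.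
have bC : b%:~R = (b%:~R : R)%:C :> R[i] by rewrite rmorph_int.
have dC : d%:~R = (d%:~R : R)%:C :> R[i] by rewrite rmorph_int.
have a1 : 2 * a%:~R != 0 :> R[i] by rewrite mulf_neq0 ?pnatr_eq0 // intr_eq0 gt_eqF.
have es : s = 2 * a%:~R * tau + b%:~R by rewrite htau mulrC divfK // addrC addrA subrr add0r.
have s2 : s ^+ 2 = - d%:~R by rewrite sqrtCK.
pose Y : R := 2 * a%:~R * complex.Im tau.
have Y0 : 0 < Y by rewrite !mulr_gt0.
have eY : 2 * a%:~R * (complex.Im tau)%:C = Y%:C :> R[i].
  by rewrite aC /Y !rmorphM rmorph_nat.
have ImS : complex.Im s = Y by rewrite es aC bC /Y; case: (tau) => x y /=; ring.
rewrite eY.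
have dY : d%:~R = Y%:C ^+ 2 :> R[i].
  move: s2 ImS; rewrite dC; case: (s) => x y /eqP; rewrite eq_complex /=.
  move=> /andP[/eqP h1 /eqP h2] yY; rewrite yY in h1 h2.
  have x0 : x = 0 by apply: (mulIf (lt0r_neq0 Y0)); rewrite mul0r; lra.
  by rewrite -rmorphXn; congr (_%:C); move: h1; rewrite x0; lra.
by rewrite dY sqrCK // lecR ltW.
Qed.

Theorem mainTheorem14 (R : realType) (a b c d : int) (tau : R[i])
  (ha : 0 < a)
  (habc : gcdz (gcdz a b) c = 1)
  (hd : - d = b ^+ 2 - 4 * a * c)
  (htau : tau = (- b%:~R + sqrtC (- d%:~R)) / (2 * a%:~R))
  (hroot : a%:~R * tau ^+ 2 + b%:~R * tau + c%:~R = 0)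
  (hC : C3B_infty tau) :
  let u := hauptmodul tau in
  let F := fun x : R[i] => hyp2F1 (1 / 3) (2 / 3) 1 (1 / (1 - x)) in
  F u ^+ 2 / 6 *
      ((u + 3) - (u ^+ 2 + 18 * u - 27) / (u - 9) * s2 tau)
    - u * (u - 1) * cderive (fun x => F x ^+ 2) u
  = a%:~R / (pi%:C * sqrtC d%:~R) * (u - 1).
Proof.
move=> u F.
have [y0 Uq xu u1] := region_inU (proj1 hC); have [q1 q0 a0 x1] := Uq.
rewrite (complex_quadratic ha y0 htau).
have -> : F u = ev (fps_a R) (nome tau).
  by rewrite /F hyp2F1E div1r -xu (hyp_a hC).
have := cderive_hyp_sqr hC; rewrite -/u -/F.
have x80 := xq_neq_m8 hC; have eP := E2E y0.
have e2s : E2star tau = E2 tau - 3 / (pi%:C * (complex.Im tau)%:C).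
  by rewrite -(rmorphM (real_complex R)).
have e4 := E4_xq hC; have e6 := E6_xq hC; have h0 := E2star_eq0 hC.
have p0 : (pi%:C : R[i]) != 0 by rewrite fmorph_eq0 gt_eqF // pi_gt0.
have yC : (complex.Im tau)%:C != 0 :> R[i] by rewrite fmorph_eq0 gt_eqF.
have aC : (a%:~R : R[i]) != 0 by rewrite intr_eq0 gt_eqF.
move: e2s; rewrite -/u in xu u1; rewrite /gq /s2 -eP.
have ux : u = 1 - (xq (nome tau))^-1 by rewrite xu invrK; ring.
have x0 : xq (nome tau) != 0 by rewrite xu invr_eq0.
move: (cderive _ _) => dF; rewrite -xu ux.
move: e4 e6 h0 x80 a0 x0 p0 yC aC {ux xu u1 Uq x1}.
move: (E4 tau) (E6 tau) (E2star tau) (E2 tau) (xq _) (ev (fps_a R) _) (pi%:C : R[i]) (complex.Im tau)%:C (a%:~R : R[i]).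
move=> e4 e6 e2s e2 x A p y m he4 he6 h0 x80 A0 x0 p0 y0' m0 he2s hD.
have eD : (1 - x^-1) * (1 - x^-1 - 1) * dF =
    (x^-1) ^+ 2 * (2 * x * A * ((e2 + A ^+ 2 * (4 * x - 1)) / (12 * A))).
  by rewrite -hD; field.
rewrite eD.
have e2E : e2 = e2s + 3 / (p * y) by rewrite he2s subrK.
have [e60|e60] := eqVneq e6 0.
  rewrite e60 invr0 mulr0 mul0r mulr0 subr0 e2E (h0 e60).
  by field; rewrite x0 p0 y0' m0 A0.
rewrite he4 he6 e2E.
have N0 : 1 - 20 * x - 8 * x ^+ 2 != 0.
  by apply: contra_neq e60 => e; rewrite he6 e mulr0.
have N0' : x - 1 + - (9) * x != 0.
  have -> : x - 1 + - (9) * x = - (1 + 8 * x) by ring.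
  by rewrite oppr_eq0.
field; rewrite x0 y0' m0 p0 A0 N0 /=; exact: N0'.
Qed.
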